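(* Fix a real number $\delta$. For each $n\geq 1$, let $\mathcal{P}_n$ be the finite set of plane partitions of size $n$, equipped with the uniform probability measure, and define random variables on $\mathcal{P}_n$ by \[ X_n^+(\pi)=\frac{w_+(\pi)}{n^{2/3}},\qquad X_n^-(\pi)=\frac{w_-(\pi)}{n^{2/3}},\qquad X_n^0(\pi)=\frac{w_0(\pi)}{n^{2/3}}. \] Then, as $n\to\infty$, the distribution of the random variable $\delta\cdot X_n^0+X_n^+-X_n^-$ has the Gaussian (normal) distribution as limit law, with mean \[ \mu=\frac{\delta\,\zeta(2)}{(2\zeta(3))^{2/3}} \] and variance \[ \sigma^2=\frac{1}{(2\zeta(3))^{1/3}}. \]
   Context: A plane partition $\pi$ is an array $(\pi_{i,j})_{i,j\geq 0}$ of nonnegative integers, only finitely many nonzero, that is weakly decreasing in each index: $\pi_{i,j}\geq \pi_{i+1,j}$ and $\pi_{i,j}\geq\pi_{i,j+1}$. Its size is $|\pi|=\sum_{i,j}\pi_{i,j}$. The statistics used are $w_+(\pi)=\sum_{i<j}\pi_{i,j}$, $w_-(\pi)=\sum_{i>j}\pi_{i,j}$, and $w_0(\pi)=\sum_i \pi_{i,i}$ (the trace). $\zeta$ denotes the Riemann zeta function. *)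

(* Defs.v *)
From HB Require Import structures.
From mathcomp Require Import all_boot all_order all_algebra.
From mathcomp Require Import all_classical all_reals all_analysis.
Set Implicit Arguments. Unset Strict Implicit. Unset Printing Implicit Defensive.
Import Order.TTheory GRing.Theory Num.Theory.
Local Open Scope classical_set_scope.
Local Open Scope ring_scope.

(** Plane partitions of size n.  Every nonzero entry pi_{i,j} of a plane
    partition of size n satisfies (i+1)(j+1) <= n and pi_{i,j} <= n, so a
    plane partition of size n is determined by its restriction to the box
    [0,n) x [0,n), with entries in [0,n].  We encode such arrays as finite
    functions and extend them by 0 outside the box. *)
Definition box (n : nat) := ('I_n * 'I_n)%type.

Definition arr (n : nat) := {ffun box n -> 'I_n.+1}.

Definition ext (n : nat) (f : arr n) (i j : nat) : nat :=
  match (insub i : option 'I_n), (insub j : option 'I_n) with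
  | Some a, Some b => nat_of_ord (f (a, b))
  | _, _ => 0%N
  end.

(** weak decrease in each index (it suffices to test inside the box, since
    the array vanishes outside it) *)
Definition is_plane_partition (n : nat) (f : arr n) : bool :=
  [forall p : box n,
     (ext f (p.1).+1 p.2 <= ext f p.1 p.2)%N &&
     (ext f p.1 (p.2).+1 <= ext f p.1 p.2)%N].

Definition pp_size (n : nat) (f : arr n) : nat := (\sum_(p : box n) f p)%N.
Definition w_plus (n : nat) (f : arr n) : nat :=
  (\sum_(p : box n | (p.1 < p.2)%N) f p)%N.
Definition w_minus (n : nat) (f : arr n) : nat :=
  (\sum_(p : box n | (p.2 < p.1)%N) f p)%N.
Definition w_zero (n : nat) (f : arr n) : nat :=
  (\sum_(p : box n | p.1 == p.2) f p)%N.

Definition PP (n : nat) : {set arr n} :=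
  [set f : arr n | is_plane_partition f && (pp_size f == n)].

Definition Yn {R : realType} (delta : R) (n : nat) (f : arr n) : R :=
  delta * ((w_zero f)%:R / (n%:R `^ (2/3)))
  + (w_plus f)%:R / (n%:R `^ (2/3)) - (w_minus f)%:R / (n%:R `^ (2/3)).

Definition Yn_cdf {R : realType} (delta : R) (n : nat) (x : R) : R :=
  #|[set f in PP n | Yn delta f <= x]|%:R / #|PP n|%:R.

Definition zeta {R : realType} (s : nat) : R :=
  limn (fun n : nat => \sum_(1 <= k < n) ((k%:R : R) ^+ s)^-1).

(* Main.v *)
(* Reading the piecewise-linear form of RSK as a sequence of toggles along diagonals turns a
   plane partition of size n into an array N of nonnegative integers in the n x n box with
   sum (i + j + 1) N_ij = n; the trace becomes sum N_ij, and w_+ and w_- become sum j N_ij and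
   sum i N_ij.  A uniform plane partition is therefore a family of independent geometric
   variables, of parameters exp (- s (i + j + 1)), conditioned on H = sum (i + j + 1) N_ij
   being n.

   No local limit theorem is needed.  The parameter s is tuned so that H has median n;
   resampling the coordinates one at a time between two independent copies then shows that H
   passes near n, hence that P(H = n) is at least a negative power of n.  Events whose
   probability is smaller than every power of n thus stay negligible under the conditioning.
   Chernoff bounds give this for the deviations of the trace from zeta(2) / kappa^2 n^(2/3),
   and of V = sum_(i < j) (j - i)^2 (N_ij - N_ji)^2 from n^(4/3) / kappa, with
   kappa^3 = 2 zeta(3).

   Finally w_+ - w_- = sum_(i < j) (j - i) (N_ij - N_ji).  Exchanging N_ij and N_ji preserves
   the conditioned law and the trace, so the summands are symmetric given all the others:
   Lindeberg's replacement argument, run against the heat semigroup with the random time V,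
   yields the Gaussian limit, centred at the trace term. *)
Require Import Defs.
From HB Require Import structures.
From mathcomp Require Import all_boot all_order all_algebra.
From mathcomp Require Import all_classical all_reals all_analysis.
From mathcomp Require Import zify ring lra.
Set Implicit Arguments. Unset Strict Implicit. Unset Printing Implicit Defensive.

(** * The RSK correspondence by toggles *)

(** Conditioning on H = n destroys independence; the proof is arranged to lose only a power of n to
    it. Take L of order n^(1/3) log n. Up to a total probability of at most 1/8, no single
    coordinate moves H by more than L, so the path between the two copies cannot jump over
    [n - L, n]. The number of configurations with H = k grows with k, so this window weighs at most
    (L + 1) exp (s L) times the single value n, a power of n because s is of order n^(-1/3). An
    exact median makes both events H <= n and H > n have probability 1/2 without any central limit
    information on H. The replacement argument never uses independence, only the invariance of the
    conditioned law under exchanges. This is why the truncation and the concentration events are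
    chosen symmetric under exchanges, and why V stays random until all increments are replaced. *)

Definition lo (g : nat -> nat -> nat) (a b : nat) : nat :=
  maxn (if a is a'.+1 then g a' b else 0) (if b is b'.+1 then g a b' else 0).

(** No boundary case: a toggled cell lies strictly above and to the left of (i, j), so both of its
    successors are already processed. *)
Definition hi (g : nat -> nat -> nat) (a b : nat) : nat :=
  minn (g a.+1 b) (g a b.+1).

Definition ondiag (i j a b : nat) : bool := [&& a < i, b < j & a + j == b + i].

(* Insertion of the cell (i, j): on the rest of its diagonal, the toggles x |-> max + min - x
   of the piecewise-linear RSK correspondence. *)
Definition step (i j : nat) (g : nat -> nat -> nat) (a b : nat) : nat :=
  if (a == i) && (b == j) then g a b + lo g a b
  else if ondiag i j a b then lo g a b + hi g a b - g a b else g a b.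

Definition unstep (i j : nat) (g : nat -> nat -> nat) (a b : nat) : nat :=
  if (a == i) && (b == j) then g a b - lo g a b
  else if ondiag i j a b then lo g a b + hi g a b - g a b else g a b.

(* The cells preceding (i, j) in row-major order of the n x n box carry a reverse
   plane partition. *)
Definition rpp (n i j : nat) (g : nat -> nat -> nat) : Prop :=
  forall a b, (a < i) || (a == i) && (b < j) -> b < n -> lo g a b <= g a b.

Lemma step_off i j g a b : a + j != b + i -> step i j g a b = g a b.
Proof. by rewrite /step /ondiag => h; do 2?case: ifP => //; lia. Qed.

Lemma unstep_off i j g a b : a + j != b + i -> unstep i j g a b = g a b.
Proof. by rewrite /unstep /ondiag => h; do 2?case: ifP => //; lia. Qed.

(** The neighbours of a cell lie on the two adjacent diagonals, which a step does not touch. Hence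
    the toggles of one step do not interact, and each is undone by repeating it. *)
Lemma lo_step i j g a b : a + j = b + i -> lo (step i j g) a b = lo g a b.
Proof.
move=> h; rewrite /lo; case: a h => [|a] h; case: b h => [|b] h //;
  by rewrite !step_off //; lia.
Qed.

Lemma hi_step i j g a b : a + j = b + i -> hi (step i j g) a b = hi g a b.
Proof. by move=> h; rewrite /hi !step_off //; lia. Qed.

Lemma lo_unstep i j g a b : a + j = b + i -> lo (unstep i j g) a b = lo g a b.
Proof.
move=> h; rewrite /lo; case: a h => [|a] h; case: b h => [|b] h //;
  by rewrite !unstep_off //; lia.
Qed.

Lemma hi_unstep i j g a b : a + j = b + i -> hi (unstep i j g) a b = hi g a b.
Proof. by move=> h; rewrite /hi !unstep_off //; lia. Qed.

Lemma rpp_diag n i j g a b : j < n -> rpp n i j g -> ondiag i j a b ->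
  lo g a b <= g a b <= hi g a b.
Proof.
move=> jn r /and3P[ai bj /eqP ab].
rewrite r ?ai //=; last lia.
have := r a.+1 b; have := r a b.+1.
rewrite /hi /lo; lia.
Qed.

Lemma rpp_diag_succ n i j g a b : j < n -> rpp n i j.+1 g -> ondiag i j a b ->
  lo g a b <= g a b <= hi g a b.
Proof.
move=> jn r /and3P[ai bj /eqP ab].
rewrite r ?ai //=; last lia.
have := r a.+1 b; have := r a b.+1.
rewrite /hi /lo; lia.
Qed.

(** A toggle maps the interval from [lo] to [hi] to itself, so a toggled cell stays above its
    predecessors and below its successors; the latter is what the cells of the adjacent diagonals
    require. *)
Lemma rpp_step n i j g : j < n -> rpp n i j g -> rpp n i j.+1 (step i j g).
Proof.
move=> jn r a b sh bn.
have [ab|ab] := eqVneq (a + j) (b + i).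
  rewrite lo_step // /step; case: ifP => [_|ne]; first lia.
  case: ifP => [od|nod]; last by move: nod; rewrite /ondiag; lia.
  have := rpp_diag jn r od; lia.
rewrite step_off // /lo.
have r0 : lo g a b <= g a b by apply: r => //; lia.
rewrite geq_max; apply/andP; split.
  case: a ab sh r0 => [//|a] ab sh r0.
  rewrite /step; case: ifP => [|ne]; first lia.
  case: ifP => [od|nod]; last by move: r0; rewrite /lo; lia.
  have := rpp_diag jn r od; rewrite /hi; lia.
case: b bn ab sh r0 => [//|b] bn ab sh r0.
rewrite /step; case: ifP => [|ne]; first lia.
case: ifP => [od|nod]; last by move: r0; rewrite /lo; lia.
have := rpp_diag jn r od; rewrite /hi; lia.
Qed.

Lemma rpp_unstep n i j g : j < n -> rpp n i j.+1 g -> rpp n i j (unstep i j g).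
Proof.
move=> jn r a b sh bn.
have r0 : lo g a b <= g a b by apply: r => //; lia.
have [ab|ab] := eqVneq (a + j) (b + i).
  rewrite lo_unstep // /unstep; case: ifP => [|ne]; first lia.
  case: ifP => [od|nod //].
  have := rpp_diag_succ jn r od; lia.
rewrite unstep_off // /lo.
rewrite geq_max; apply/andP; split.
  case: a ab sh r0 => [//|a] ab sh r0.
  rewrite /unstep; case: ifP => [|ne]; first lia.
  case: ifP => [od|nod]; last by move: r0; rewrite /lo; lia.
  have := rpp_diag_succ jn r od; rewrite /hi; lia.
case: b bn ab sh r0 => [//|b] bn ab sh r0.
rewrite /unstep; case: ifP => [|ne]; first lia.
case: ifP => [od|nod]; last by move: r0; rewrite /lo; lia.
have := rpp_diag_succ jn r od; rewrite /hi; lia.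
Qed.

Lemma stepK n i j g : j < n -> rpp n i j g -> unstep i j (step i j g) = g.
Proof.
move=> jn r; apply: funext => a; apply: funext => b.
have [ab|ab] := eqVneq (a + j) (b + i); last by rewrite unstep_off ?step_off.
rewrite /unstep lo_step // hi_step // /step.
case: ifP => [e|ne]; first by rewrite e addnK.
case: ifP => od; last by rewrite ne od.
by rewrite ne od; have := rpp_diag jn r od; lia.
Qed.

Lemma unstepK n i j g : j < n -> rpp n i j.+1 g -> step i j (unstep i j g) = g.
Proof.
move=> jn r; apply: funext => a; apply: funext => b.
have [ab|ab] := eqVneq (a + j) (b + i); last by rewrite step_off ?unstep_off.
rewrite /step lo_unstep // hi_unstep // /unstep.
case: ifP => [e|ne].
  by rewrite e subnK // r //; lia.
case: ifP => od; last by rewrite ne od.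
by rewrite ne od; have := rpp_diag_succ jn r od; lia.
Qed.

Fixpoint fill_row (i j : nat) g := if j is j'.+1 then step i j' (fill_row i j' g) else g.
Fixpoint unfill_row (i j : nat) g := if j is j'.+1 then unfill_row i j' (unstep i j' g) else g.
Fixpoint fill (n i : nat) g := if i is i'.+1 then fill_row i' n (fill n i' g) else g.
Fixpoint unfill (n i : nat) g := if i is i'.+1 then unfill n i' (unfill_row i' n g) else g.

Lemma rpp_next n i g : rpp n i n g <-> rpp n i.+1 0 g.
Proof.
by split=> r a b sh bn; apply: r => //; move: sh; rewrite ltnS; lia.
Qed.

Lemma fill_row_rpp n i j g : j <= n -> rpp n i 0 g -> rpp n i j (fill_row i j g).
Proof. by move=> jn r; elim: j jn => //= j IH jn; apply: rpp_step => //; apply: IH; lia. Qed.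

Lemma fill_rowK n i j g : j <= n -> rpp n i 0 g -> unfill_row i j (fill_row i j g) = g.
Proof.
move=> jn r; elim: j jn => //= j IH jn.
by rewrite (@stepK n) ?IH //; [lia | apply: fill_row_rpp => //; lia].
Qed.

Lemma unfill_row_rpp n i j g : j <= n -> rpp n i j g -> rpp n i 0 (unfill_row i j g).
Proof.
by elim: j g => //= j IH g jn r; apply: IH; [lia | apply: rpp_unstep].
Qed.

Lemma unfill_rowK n i j g : j <= n -> rpp n i j g -> fill_row i j (unfill_row i j g) = g.
Proof.
elim: j g => //= j IH g jn r.
by rewrite IH ?(@unstepK n) //; [lia | apply: rpp_unstep].
Qed.

Lemma fill_rpp n i g : rpp n i 0 (fill n i g).
Proof.
elim: i => [|i IH]; first by move=> a b; rewrite ltn0 /= andbF.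
by apply/rpp_next; apply: fill_row_rpp.
Qed.

Lemma fillK n i g : unfill n i (fill n i g) = g.
Proof. by elim: i => //= i IH; rewrite (@fill_rowK n) //; apply: fill_rpp. Qed.

Lemma unfillK n i g : rpp n i 0 g -> fill n i (unfill n i g) = g.
Proof.
elim: i g => //= i IH g /rpp_next r.
by rewrite IH ?(@unfill_rowK n) //; apply: unfill_row_rpp r.
Qed.

Definition boxed (n : nat) (g : nat -> nat -> nat) : Prop :=
  forall a b, (n <= a) || (n <= b) -> g a b = 0.

Lemma boxed_step n i j g : i < n -> j < n -> boxed n g -> boxed n (step i j g).
Proof.
move=> jn i_n bx a b ab; rewrite /step /ondiag.
by do 2?case: ifP; [lia | lia | move=> *; apply: bx].
Qed.

Lemma boxed_unstep n i j g : i < n -> j < n -> boxed n g -> boxed n (unstep i j g).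
Proof.
move=> jn i_n bx a b ab; rewrite /unstep /ondiag.
by do 2?case: ifP; [lia | lia | move=> *; apply: bx].
Qed.

Lemma boxed_fill n i g : i <= n -> boxed n g -> boxed n (fill n i g).
Proof.
move=> i_n bx; elim: i i_n => //= i IH i_n.
have {IH}: boxed n (fill n i g) by apply: IH; lia.
move: (fill n i g) => {bx}g bx.
suff h : forall j, j <= n -> boxed n (fill_row i j g) by apply: h.
by elim=> //= j IHj jn; apply: boxed_step => //; apply: IHj; lia.
Qed.

Lemma boxed_unfill n i g : i <= n -> boxed n g -> boxed n (unfill n i g).
Proof.
elim: i g => //= i IH g i_n bx; apply: IH; first lia.
suff h : forall j, j <= n -> boxed n (unfill_row i j g) by apply: h.
move=> j; elim: j g bx => //= j IHj g bx jn; apply: IHj; last lia.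
by apply: boxed_unstep; first lia.
Qed.

(** * Diagonal sums of the filled array and rectangle sums of the original one *)

Fixpoint dsum (g : nat -> nat -> nat) (i j : nat) {struct i} : nat :=
  g i j + match i, j with i'.+1, j'.+1 => dsum g i' j' | _, _ => 0 end.

(** [D], [U] and [L] are the three other corners in the inclusion-exclusion for rectangle sums. *)
Definition dsumD g i j := match i, j with i'.+1, j'.+1 => dsum g i' j' | _, _ => 0 end.
Definition dsumU g i j := if i is i'.+1 then dsum g i' j else 0.
Definition dsumL g i j := if j is j'.+1 then dsum g i j' else 0.

Lemma dsumE g i j : dsum g i j = g i j + dsumD g i j.
Proof. by case: i; case: j. Qed.

Lemma dsum_off i j g a b : a + j != b + i -> dsum (step i j g) a b = dsum g a b.
Proof. by elim: a b => [|a IH] [|b] ab; rewrite !dsumE step_off //= IH //; lia. Qed.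

(* max + min is the sum, and the minimum at a diagonal cell and the maximum at the next
   one are taken over the same pair of neighbours. *)
Lemma dsum_toggle n i j g a b : j < n -> rpp n i j g -> ondiag i j a b ->
  dsum (step i j g) a b + dsum g a b = dsumU g a b + dsumL g a b + hi g a b.
Proof.
move=> jn r; elim: a b => [|a IH] b od; have := rpp_diag jn r od;
  rewrite (dsumE (step i j g)) (dsumE g) {1}/step; case: ifP (od);
  rewrite {1}/ondiag; try lia; rewrite od => _ _.
  by rewrite /dsumD /dsumU /dsumL; case: b {od} => [|b] /=; rewrite /lo; lia.
case: b od => [|b] od.
  by rewrite /dsumD /dsumU /dsumL /lo dsumE /dsumD; case: a {IH od} => *; lia.
have od' : ondiag i j a b by move: od; rewrite /ondiag; lia.
have := IH _ od'.
rewrite [dsumU _ _.+1 _]/dsumU [dsumL _ _ _.+1]/dsumL [dsumD _ _.+1 _.+1]/dsumD.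
rewrite [dsumD _ _.+1 _.+1]/dsumD (dsumE g a b.+1) (dsumE g a.+1 b).
have -> : dsumD g a b.+1 = dsumU g a b by case: (a).
have -> : dsumD g a.+1 b = dsumL g a b by case: (b).
rewrite /lo /hi; lia.
Qed.

(** The toggle identity on the diagonal ending just before (i, j) turns into the four-corner
    recurrence of [rectS], with the still untouched entry g i j as source term. *)
Lemma dsum_step n i j g : j < n -> rpp n i j g ->
  dsum (step i j g) i j + dsumD g i j = g i j + dsumU g i j + dsumL g i j.
Proof.
move=> jn r; rewrite dsumE {1}/step !eqxx /=.
case: i r => [|i] r.
  by rewrite /dsumD /dsumU /dsumL /lo; case: j jn r => [|j] *; rewrite ?dsumE /dsumD; lia.
case: j jn r => [|j] jn r.
  by rewrite /dsumD /dsumU /dsumL /lo dsumE /dsumD; case: i r => *; lia.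
have od : ondiag i.+1 j.+1 i j by rewrite /ondiag; lia.
have := dsum_toggle jn r od.
rewrite [dsumU _ _.+1 _]/dsumU [dsumL _ _ _.+1]/dsumL [dsumD _ _.+1 _.+1]/dsumD.
rewrite [dsumD _ _.+1 _.+1]/dsumD /lo (dsumE g i j.+1) (dsumE g i.+1 j).
have -> : dsumD g i j.+1 = dsumU g i j by case: (i).
have -> : dsumD g i.+1 j = dsumL g i j by case: (j).
rewrite /hi; lia.
Qed.

Definition rect (g : nat -> nat -> nat) (i j : nat) : nat :=
  \sum_(a < i.+1) \sum_(b < j.+1) g a b.

Lemma rectS g i j :
  rect g i.+1 j.+1 + rect g i j = g i.+1 j.+1 + rect g i j.+1 + rect g i.+1 j.
Proof.
rewrite /rect big_ord_recr /= [in RHS](big_ord_recr i.+1) /= [in LHS](big_ord_recr j.+1) /=.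
lia.
Qed.

Lemma rect0S g j : rect g 0 j.+1 = g 0 j.+1 + rect g 0 j.
Proof. by rewrite /rect !big_ord1 big_ord_recr /= addnC. Qed.

Lemma rectS0 g i : rect g i.+1 0 = g i.+1 0 + rect g i 0.
Proof. by rewrite /rect big_ord_recr /= big_ord1 addnC. Qed.

Lemma rect00 g : rect g 0 0 = g 0 0.
Proof. by rewrite /rect !big_ord1. Qed.

(* State of the process started at m just before cell (i, j) is inserted: the diagonals
   ending on the border of the processed region carry the rectangle sums of m. *)
Definition border (m : nat -> nat -> nat) (n i j : nat) (g : nat -> nat -> nat) : Prop :=
  [/\ forall a b, b < n -> (i < a) || (a == i) && (j <= b) -> g a b = m a b,
      forall b, b < j -> dsum g i b = rect m i b,
      forall a b, i = a.+1 -> j <= b.+1 -> b < n -> dsum g a b = rect m a b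
    & forall a, a < i -> dsum g a n.-1 = rect m a n.-1].

Lemma border_step m n i j g : i < n -> j < n -> rpp n i j g -> border m n i j g ->
  border m n i j.+1 (step i j g).
Proof.
move=> i_n jn r [b0 b1 b2 b3]; split.
- move=> a b bn ab; rewrite /step /ondiag; case: ifP; first lia.
  by case: ifP; [lia | move=> _ _; apply: b0 => //; lia].
- move=> b; rewrite ltnS leq_eqVlt => /orP[/eqP->|bj]; last first.
    by rewrite dsum_off ?b1 //; lia.
  have := dsum_step jn r; rewrite b0 //; last lia.
  case: i {i_n r} b0 b1 b2 b3 => [|i] b0 b1 b2 b3; case: j jn b0 b1 b2 => [|j] jn b0 b1 b2;
    rewrite /dsumD /dsumU /dsumL.
  + by rewrite rect00; lia.
  + by rewrite rect0S b1 //; lia.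
  + by rewrite rectS0 (b2 i) //; lia.
  + by have := rectS m i j; rewrite b1 // !(b2 i) //; lia.
- by move=> a b ia jb bn; rewrite dsum_off; [apply: b2 => //; lia | lia].
- by move=> a ai; rewrite dsum_off ?b3 //; lia.
Qed.

Lemma border_fill m n i : i <= n -> border m n i 0 (fill n i m).
Proof.
elim: i => [|i IH] i_n; first by split.
have {IH} : border m n i 0 (fill n i m) by apply: IH; lia.
rewrite /=; have := @fill_rpp n i m; move: (fill n i m) => g r bd.
have {bd} : border m n i n (fill_row i n g).
  suff h : forall j, j <= n -> border m n i j (fill_row i j g) by apply: h.
  elim=> //= j IH jn; apply: border_step => //; last by apply: IH; lia.
  by apply: fill_row_rpp => //; lia.
move=> [b0 b1 b2 b3]; split => //.
- by move=> a b bn ab; apply: b0 => //; lia.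
- by move=> a b [<-] _ bn; apply: b1.
- move=> a; rewrite ltnS leq_eqVlt => /orP[/eqP->|ai]; last exact: b3.
  by apply: b1; lia.
Qed.

(** The diagonals ending in the last row partition the part strictly below the main diagonal. *)
Lemma lower_dsum n (g : nat -> nat -> nat) : \sum_(a < n.+1) \sum_(b < n.+1 | b < a) g a b = \sum_(b < n) dsum g n b.
Proof.
elim: n => [|n IH]; first by rewrite !big_ord1 big_ord0 big_pred0.
rewrite big_ord_recr /= [X in _ + X]big_mkcond [X in _ + X]big_ord_recr /= ltnn addn0.
under [X in _ + X]eq_bigr => i _ do rewrite ltn_ord.
have -> : \sum_(i < n.+1) \sum_(b < n.+2 | b < i) g i b
   = \sum_(a < n.+1) \sum_(b < n.+1 | b < a) g a b.
  apply: eq_bigr => a _; rewrite big_mkcond big_ord_recr /= -big_mkcond /=.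
  by case: ltnP => h; [have := ltn_ord a; rewrite ltnNge ltnW | rewrite addn0].
rewrite IH.
rewrite big_split /= addnC; congr addn.
by rewrite big_ord_recl.
Qed.

Lemma dsumC g i j : dsum g i j = dsum (fun a b => g b a) j i.
Proof. by elim: i j => [|i IH] [|j]; rewrite !dsumE //= IH. Qed.

Lemma upper_dsum n (g : nat -> nat -> nat) : \sum_(a < n.+1) \sum_(b < n.+1 | a < b) g a b = \sum_(a < n) dsum g a n.
Proof.
under [RHS]eq_bigr => i _ do rewrite dsumC.
by rewrite -lower_dsum (exchange_big_dep xpredT).
Qed.

Lemma diag_dsum n (g : nat -> nat -> nat) : \sum_(a < n.+1) g a a = dsum g n n.
Proof.
elim: n => [|n IH]; first by rewrite big_ord1 dsumE addn0.
by rewrite big_ord_recr /= IH addnC.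
Qed.

(** The entry m a b lies in the rectangles whose last column is b, ..., n - 1, hence the weight n -
    b. *)
Lemma sum_rect_row n (m : nat -> nat -> nat) :
  \sum_(b < n) rect m n b = \sum_(a < n.+1) \sum_(b < n.+1) (n - b) * m a b.
Proof.
rewrite /rect exchange_big /=; apply: eq_bigr => a _.
elim: n {a} (m a) => [|n IH] f; first by rewrite big_ord0 big_ord1.
rewrite big_ord_recr /= IH [RHS]big_ord_recr /= subnn mul0n addn0.
rewrite -big_split /=; apply: eq_bigr => b _.
have h : b <= n by rewrite -ltnS.
by rewrite subSn // mulSn addnC.
Qed.

Lemma rectC g i j : rect g i j = rect (fun a b => g b a) j i.
Proof. exact: exchange_big. Qed.

Lemma sum_rect_col n (m : nat -> nat -> nat) :
  \sum_(a < n) rect m a n = \sum_(a < n.+1) \sum_(b < n.+1) (n - a) * m a b.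
Proof.
under eq_bigr => i _ do rewrite rectC.
by rewrite sum_rect_row exchange_big.
Qed.

Lemma fill_stats n (m : nat -> nat -> nat) : let g := fill n.+1 n.+1 m in
  [/\ \sum_(a < n.+1) \sum_(b < n.+1 | b < a) g a b
        = \sum_(a < n.+1) \sum_(b < n.+1) (n - b) * m a b,
      \sum_(a < n.+1) \sum_(b < n.+1 | a < b) g a b
        = \sum_(a < n.+1) \sum_(b < n.+1) (n - a) * m a b
    & \sum_(a < n.+1) g a a = \sum_(a < n.+1) \sum_(b < n.+1) m a b].
Proof.
have [_ _ b2 b3] := border_fill m (leqnn n.+1); split.
- rewrite lower_dsum -sum_rect_row; apply: eq_bigr => b _.
  by apply: b2 => //; rewrite ltnS ltnW.
- rewrite upper_dsum -sum_rect_col; apply: eq_bigr => a _.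
  by apply: b3; rewrite ltnS ltnW.
- by rewrite diag_dsum; exact: b3.
Qed.

(* Values outside the box are 0; the indices are reversed, so that plane partitions become
   arrays increasing in each index. *)
Definition flat (m k : nat) (f : {ffun box m.+1 -> 'I_k.+1}) (a b : nat) : nat :=
  if (a <= m) && (b <= m) then nat_of_ord (f (inord (m - a), inord (m - b))) else 0.

Definition unflat (m k : nat) (g : nat -> nat -> nat) : {ffun box m.+1 -> 'I_k.+1} :=
  [ffun p : box m.+1 => inord (g (m - p.1) (m - p.2))].

Lemma flat_boxed m k (f : {ffun box m.+1 -> 'I_k.+1}) : boxed m.+1 (flat f).
Proof. by move=> a b h; rewrite /flat; case: ifP => //; lia. Qed.

Lemma flatE m k (f : {ffun box m.+1 -> 'I_k.+1}) (a b : 'I_m.+1) :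
  flat f a b = f (rev_ord a, rev_ord b).
Proof.
have am : a <= m by rewrite -ltnS.
have bm : b <= m by rewrite -ltnS.
rewrite /flat am bm /=; congr (nat_of_ord (f (_, _)));
  by apply: val_inj; rewrite /= inordK ?subSS // ltnS leq_subr.
Qed.

Lemma flatK m k : cancel (@flat m k) (@unflat m k).
Proof.
move=> f; apply/ffunP => -[i j]; rewrite ffunE /=; apply: val_inj => /=.
have := flatE f (rev_ord i) (rev_ord j); rewrite !rev_ordK /= !subSS => ->.
by rewrite inordK // ltn_ord.
Qed.

Lemma unflatK m k g : boxed m.+1 g -> (forall a b, g a b <= k) ->
  flat (unflat m k g) = g.
Proof.
move=> bx gk; apply: funext => a; apply: funext => b.
rewrite /flat; case: ifP => h; last by rewrite bx //; lia.
by rewrite ffunE !inordK ?ltnS ?gk //; try lia; congr g; lia.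
Qed.

Lemma sum_flat m k (f : {ffun box m.+1 -> 'I_k.+1}) (P : nat -> nat -> bool)
    (c : nat -> nat -> nat) :
  \sum_(a < m.+1) \sum_(b < m.+1 | P a b) c a b * flat f a b =
  \sum_(p : box m.+1 | P (m - p.1) (m - p.2)) c (m - p.1) (m - p.2) * f p.
Proof.
rewrite pair_big_dep /=.
rewrite (reindex_inj (h := fun p : box m.+1 => (rev_ord p.1, rev_ord p.2))) /=; last first.
  apply: (can_inj (g := fun p : box m.+1 => (rev_ord p.1, rev_ord p.2))).
  by move=> [i j] /=; rewrite !rev_ordK.
apply: eq_big => [p|p _]; rewrite ?subSS //.
by have := flatE f (rev_ord p.1) (rev_ord p.2); rewrite /= !rev_ordK subSS => ->; case: p.
Qed.

Lemma ext_rev m (f : arr m.+1) (a b : nat) : a <= m -> b <= m ->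
  ext f (m - a) (m - b) = flat f a b.
Proof.
move=> am bm; rewrite /ext /flat am bm /=.
have e c (h : m - c < m.+1) : insub (m - c) = Some (inord (m - c) : 'I_m.+1).
  by rewrite insubT; congr Some; apply: val_inj; rewrite /= inordK.
by rewrite !e //; lia.
Qed.

Lemma ext_out m (f : arr m.+1) (i j : nat) : (m < i) || (m < j) -> ext f i j = 0.
Proof.
rewrite /ext => h; case: insubP => [u _ ui|//]; case: insubP => [v _ vj|//].
by move: h; rewrite -ui -vj /=; have := ltn_ord u; have := ltn_ord v; lia.
Qed.

Lemma is_pp_rpp m (f : arr m.+1) : is_plane_partition f <-> rpp m.+1 m.+1 0 (flat f).
Proof.
split=> [/forallP h a b sh bn|r].
  have am : a <= m by lia.
  have /= := h (inord (m - a), inord (m - b)).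
  rewrite !inordK; [|lia|lia].
  rewrite ext_rev // /lo => /andP[h1 h2]; rewrite geq_max; apply/andP; split.
    case: a am {sh} h1 {h2} => [//|a] am.
    by rewrite -subSn // subSS ext_rev //; lia.
  case: b bn {sh} h2 {h1} => [//|b] bn.
  by rewrite -subSn // subSS ext_rev //; lia.
apply/forallP => -[i j] /=.
have im := ltn_ord i; have jm := ltn_ord j.
have sh : (m - i < m.+1) || (m - i == m.+1) && (m - j < 0) by lia.
have jb : m - j < m.+1 by lia.
have im1 : i <= m by rewrite -ltnS.
have jm1 : j <= m by rewrite -ltnS.
have := r _ _ sh jb; rewrite -ext_rev ?leq_subr // !subKn //.
rewrite /lo geq_max => /andP[h1 h2].
apply/andP; split.
  have [im'|im'] := leqP m i; first by rewrite ext_out //; lia.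
  move: h1; case e : (m - i) => [|c]; first by lia.
  have ei : m - c = i.+1 by lia.
  by rewrite -ext_rev ?leq_subr ?ei ?subKn //; lia.
have [jm'|jm'] := leqP m j; first by rewrite ext_out //; lia.
move: h2; case e : (m - j) => [|c]; first by lia.
have ej : m - c = j.+1 by lia.
by rewrite -ext_rev ?leq_subr ?ej ?subKn //; lia.
Qed.

Section stats.
Context {m k : nat}.
Implicit Types f : {ffun box m.+1 -> 'I_k.+1}.
Definition mass f : nat := \sum_p f p.
Definition col_mass f : nat := \sum_(p : box m.+1) p.2 * f p.
Definition row_mass f : nat := \sum_(p : box m.+1) p.1 * f p.
Definition hook_mass f : nat := \sum_(p : box m.+1) (p.1 + p.2).+1 * f p.

Lemma hook_massE f : hook_mass f = mass f + col_mass f + row_mass f.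
Proof. by rewrite /hook_mass /mass -!big_split; apply: eq_bigr => p _ /=; lia. Qed.

End stats.

Lemma pp_sizeE n (f : arr n) : pp_size f = w_zero f + w_plus f + w_minus f.
Proof.
rewrite /pp_size /w_zero /w_plus /w_minus (bigID (fun p : box n => p.1 == p.2)) /= -addnA.
congr addn; rewrite (bigID (fun p : box n => p.1 < p.2)) /=; congr addn.
  by apply: eq_bigl => p; rewrite -val_eqE /=; lia.
by apply: eq_bigl => p; rewrite -val_eqE /=; lia.
Qed.

Lemma fill_stats_arr m k (f : arr m.+1) (N : {ffun box m.+1 -> 'I_k.+1}) :
  flat f = fill m.+1 m.+1 (flat N) ->
  [/\ w_zero f = mass N, w_plus f = col_mass N & w_minus f = row_mass N].
Proof.
have := fill_stats m (flat N); rewrite /= => + e; rewrite -e => -[h1 h2 h3].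
have s1 := sum_flat f (fun a b => b < a) (fun _ _ => 1).
have s2 := sum_flat f (fun a b => a < b) (fun _ _ => 1).
have s3 := sum_flat f (fun a b => a == b) (fun _ _ => 1).
have t1 := sum_flat N (fun a b => true) (fun a b => m - b).
have t2 := sum_flat N (fun a b => true) (fun a b => m - a).
have t3 := sum_flat N (fun a b => true) (fun a b => 1).
move: s1 s2 s3 t1 t2 t3 => /= s1 s2 s3 t1 t2 t3.
have e1 (F : nat -> nat -> nat) (P : nat -> nat -> bool) : \sum_(a < m.+1) \sum_(b < m.+1 | P a b) 1 * F a b =
  \sum_(a < m.+1) \sum_(b < m.+1 | P a b) F a b.
  by apply: eq_bigr => a _; apply: eq_bigr => b _; rewrite mul1n.
split.
- rewrite /mass -(eq_bigr _ (fun p _ => mul1n (N p))) -t3 (e1 _ (fun _ _ => true)) -h3.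
  have -> : \sum_(a < m.+1) flat f a a = \sum_(a < m.+1) \sum_(b < m.+1 | a == b :> nat) 1 * flat f a b.
    apply: eq_bigr => a _; rewrite (eq_bigl (pred1 a)) ?big_pred1_eq ?mul1n // => b; rewrite -val_eqE eq_sym.
  rewrite s3 /w_zero; apply: eq_big => p; last by rewrite mul1n.
  case: p => [[i im] [j jm]] /=; rewrite -[LHS]val_eqE /=. lia.
- rewrite /col_mass (eq_bigr (fun p : box m.+1 => (m - (m - p.2)) * N p)); last first.
    by move=> p _; rewrite subKn // -ltnS.
  rewrite -t1 -h1 -(e1 _ (fun a b => b < a)) /= s1 /w_plus; apply: eq_big => p; last by rewrite mul1n.
  by case: p => [[i im] [j jm]] /=; lia.
- rewrite /row_mass (eq_bigr (fun p : box m.+1 => (m - (m - p.1)) * N p)); last first.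
    by move=> p _; rewrite subKn // -ltnS.
  rewrite -t2 -h2 -(e1 _ (fun a b => a < b)) /= s2 /w_minus; apply: eq_big => p; last by rewrite mul1n.
  by case: p => [[i im] [j jm]] /=; lia.
Qed.

Lemma total_fill m (g : nat -> nat -> nat) :
  \sum_(a < m.+1) \sum_(b < m.+1) fill m.+1 m.+1 g a b =
  \sum_(a < m.+1) \sum_(b < m.+1) (m - a + (m - b)).+1 * g a b.
Proof.
have [s1 s2 s3] := fill_stats m g.
have -> : \sum_(a < m.+1) \sum_(b < m.+1) (m - a + (m - b)).+1 * g a b =
  \sum_(a < m.+1) \sum_(b < m.+1) g a b + (\sum_(a < m.+1) \sum_(b < m.+1) (m - a) * g a b
   + \sum_(a < m.+1) \sum_(b < m.+1) (m - b) * g a b).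
  rewrite -!big_split; apply: eq_bigr => a _ /=; rewrite -!big_split; apply: eq_bigr => b _ /=.
  by rewrite mulSn mulnDl.
rewrite -s1 -s2 -s3 -!big_split; apply: eq_bigr => a _ /=.
rewrite (bigD1 a) //= (bigID (fun b : 'I_m.+1 => a < b)) /=; congr (_ + (_ + _));
  by apply: eq_bigl => b; rewrite -val_eqE /=; lia.
Qed.

Lemma term_le_total m (g : nat -> nat -> nat) a b : boxed m.+1 g ->
  g a b <= \sum_(a < m.+1) \sum_(b < m.+1) g a b.
Proof.
move=> gb.
have [ab|ab] := boolP ((a < m.+1) && (b < m.+1)); last by rewrite gb //; lia.
case/andP: ab => am bm.
by rewrite (bigD1 (Ordinal am)) //= (bigD1 (Ordinal bm)) //= -addnA; exact: leq_addr.
Qed.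

Lemma total_flat m k (f : {ffun box m.+1 -> 'I_k.+1}) :
  \sum_(a < m.+1) \sum_(b < m.+1) flat f a b = \sum_p f p.
Proof.
have /= := sum_flat f (fun _ _ => true) (fun _ _ => 1).
under [X in _ = X -> _]eq_bigr do rewrite mul1n.
by move=> <-; apply: eq_bigr => a _; apply: eq_bigr => b _; rewrite mul1n.
Qed.

Lemma total_hook m k (f : {ffun box m.+1 -> 'I_k.+1}) :
  \sum_(a < m.+1) \sum_(b < m.+1) (m - a + (m - b)).+1 * flat f a b = hook_mass f.
Proof.
rewrite (sum_flat f (fun _ _ => true) (fun a b => (m - a + (m - b)).+1)).
apply: eq_bigr => p _; congr (_ * _).
by case: p => [[i im] [j jm]] /=; lia.
Qed.

(** Two injections, [unfill] one way and [fill] the other. A cell weighs at least 1 in [hook_mass],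
    so a total of m.+1 bounds every entry and the cap k never truncates. The arbitrary P carries the
    joint law of the three statistics. *)
Lemma card_pp m k (P : nat -> nat -> nat -> bool) : m < k ->
  #|[set f in PP m.+1 | P (w_zero f) (w_plus f) (w_minus f)]| =
  #|[set N : {ffun box m.+1 -> 'I_k.+1} |
      (hook_mass N == m.+1) && P (mass N) (col_mass N) (row_mass N)]|.
Proof.
move=> mk; apply/eqP; rewrite eqn_leq; apply/andP; split.
  pose F (f : arr m.+1) : {ffun box m.+1 -> 'I_k.+1} := unflat m k (unfill m.+1 m.+1 (flat f)).
  have FP f : f \in PP m.+1 -> flat f = fill m.+1 m.+1 (flat (F f)) /\ hook_mass (F f) = m.+1.
    rewrite inE => /andP[/is_pp_rpp r /eqP sz].
    pose g := unfill m.+1 m.+1 (flat f).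
    have gb : boxed m.+1 g by apply: boxed_unfill => //; apply: flat_boxed.
    have rg : fill m.+1 m.+1 g = flat f by apply: unfillK.
    have hg : \sum_(a < m.+1) \sum_(b < m.+1) (m - a + (m - b)).+1 * g a b = m.+1.
      by rewrite -total_fill rg total_flat.
    have gk a b : g a b <= k.
      apply: leq_trans mk; rewrite -hg; apply: leq_trans (term_le_total a b gb) _.
      by apply: leq_sum => i _; apply: leq_sum => j _; rewrite leq_pmull.
    have e : flat (F f) = g by rewrite /F unflatK.
    by split; rewrite -?total_hook e.
  rewrite -(card_in_imset (f := F)); last first.
    move=> f f'; rewrite !inE => /andP[fP _] /andP[fP' _] ee.
    have [|e _] := FP f; first by rewrite inE.
    have [|e' _] := FP f'; first by rewrite inE.
    by apply: (can_inj (@flatK _ _)); rewrite e e' ee.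
  apply/subset_leq_card/fintype.subsetP => N /imsetP[f]; rewrite !inE => /andP[fP pf] ->.
  have [|e h] := FP f; first by rewrite inE.
  have [h0 h1 h2] := fill_stats_arr e.
  by rewrite h eqxx -h0 -h1 -h2.
pose G (N : {ffun box m.+1 -> 'I_k.+1}) : arr m.+1 := unflat m m.+1 (fill m.+1 m.+1 (flat N)).
have GP N : hook_mass N = m.+1 -> flat (G N) = fill m.+1 m.+1 (flat N).
  move=> hN; have gb : boxed m.+1 (fill m.+1 m.+1 (flat N)).
    by apply: boxed_fill => //; apply: flat_boxed.
  rewrite /G unflatK // => a b; apply: leq_trans (term_le_total a b gb) _.
  by rewrite total_fill total_hook hN.
rewrite -(card_in_imset (f := G)); last first.
  move=> N N'; rewrite !inE => /andP[/eqP/GP e _] /andP[/eqP/GP e' _] ee.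
  have : flat N = flat N' by rewrite -(fillK m.+1 m.+1 (flat N)) -e ee e' fillK.
  exact: (can_inj (@flatK _ _)).
apply/subset_leq_card/fintype.subsetP => f /imsetP[N]; rewrite !inE => /andP[/eqP hN pf] ->.
have e := GP _ hN; have [h0 h1 h2] := fill_stats_arr e.
rewrite h0 h1 h2 pf andbT; apply/andP; split.
  by apply/is_pp_rpp; rewrite e; apply: fill_rpp.
by rewrite pp_sizeE h0 h1 h2 -hook_massE hN.
Qed.

Import Order.TTheory GRing.Theory Num.Theory.
Local Open Scope ring_scope.

(** * Product measures on a finite product *)

Section product_measure.
Context {R : realType} {T K : finType}.
Variable w : T -> K -> R.
Hypothesis w_ge0 : forall t k, 0 <= w t k.
Hypothesis w_sum : forall t, \sum_k w t k = 1.
Implicit Types (N : {ffun T -> K}) (F G : {ffun T -> K} -> R) (B : {set T}).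

Definition pw N : R := \prod_t w t (N t).
Definition Ex F : R := \sum_N pw N * F N.

Lemma pw_ge0 N : 0 <= pw N.
Proof. exact: prodr_ge0. Qed.

Lemma Ex_cst (c : R) : Ex (fun=> c) = c.
Proof.
rewrite /Ex -mulr_suml /pw -(bigA_distr_bigA (fun t k => w t k)).
by rewrite big1 ?mul1r.
Qed.

Lemma eq_Ex F G : F =1 G -> Ex F = Ex G.
Proof. by move=> FG; apply: eq_bigr => N _; rewrite FG. Qed.

Lemma le_Ex F G : (forall N, F N <= G N) -> Ex F <= Ex G.
Proof. by move=> FG; apply: ler_sum => N _; rewrite ler_wpM2l ?pw_ge0. Qed.

Lemma Ex_ge0 F : (forall N, 0 <= F N) -> 0 <= Ex F.
Proof. by move=> F0; apply: sumr_ge0 => N _; rewrite mulr_ge0 ?pw_ge0. Qed.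

Lemma ExD F G : Ex (fun N => F N + G N) = Ex F + Ex G.
Proof. by rewrite -big_split; apply: eq_bigr => N _; rewrite mulrDr. Qed.

Lemma ExZ (c : R) F : Ex (fun N => c * F N) = c * Ex F.
Proof. by rewrite /Ex mulr_sumr; apply: eq_bigr => N _; rewrite mulrCA. Qed.

Lemma Ex_sum (J : Type) (s : seq J) (P : pred J) (F : J -> {ffun T -> K} -> R) :
  Ex (fun N => \sum_(j <- s | P j) F j N) = \sum_(j <- s | P j) Ex (F j).
Proof. by rewrite /Ex exchange_big; apply: eq_bigr => N _; rewrite mulr_sumr. Qed.

Lemma Ex_marginal t (f : K -> R) : Ex (fun N => f (N t)) = \sum_k w t k * f k.
Proof.
transitivity (\sum_(N : {ffun T -> K})
    \prod_u (w u (N u) * (if u == t then f (N u) else 1))).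
  apply: eq_bigr => N _; rewrite big_split /=; congr (_ * _).
  by rewrite -big_mkcond big_pred1_eq.
rewrite -(bigA_distr_bigA (fun u k => w u k * (if u == t then f k else 1))).
rewrite (bigD1 t) //= eqxx [X in _ * X]big1 ?mulr1 // => u /negPf ut.
by rewrite -[RHS](w_sum u); apply: eq_bigr => k _; rewrite ut mulr1.
Qed.

Definition mix B N N' : {ffun T -> K} := [ffun t => if t \in B then N t else N' t].

Lemma pw_mix B N N' : pw (mix B N N') * pw (mix B N' N) = pw N * pw N'.
Proof.
rewrite /pw -!big_split; apply: eq_bigr => t _; rewrite !ffunE.
by case: (t \in B); rewrite /= mulrC.
Qed.

Lemma mixK B N N' : mix B (mix B N N') (mix B N' N) = N.
Proof.
by apply/ffunP => t; rewrite !ffunE; case: (t \in B).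
Qed.

(** Exchanging coordinates between two independent copies is an involution that preserves their
    joint weight. Both the independence of coordinates and the resampling argument rest on this. *)
Lemma Ex2_mix B (F : {ffun T -> K} -> {ffun T -> K} -> R) :
  Ex (fun N => Ex (fun N' => F (mix B N N') (mix B N' N))) = Ex (fun N => Ex (F N)).
Proof.
pose h (p : {ffun T -> K} * {ffun T -> K}) := (mix B p.1 p.2, mix B p.2 p.1).
have hK : involutive h by move=> [N N']; rewrite /h /= !mixK.
have e (G : {ffun T -> K} -> {ffun T -> K} -> R) :
    Ex (fun N => Ex (G N)) = \sum_p pw p.1 * pw p.2 * G p.1 p.2.
  rewrite -(pair_bigA _ (fun N N' => pw N * pw N' * G N N')) /=.
  by apply: eq_bigr => N _; rewrite /Ex mulr_sumr; apply: eq_bigr => N' _; rewrite mulrA.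
rewrite !e [RHS](reindex_inj (inv_inj hK)) /=.
by apply: eq_bigr => p _; rewrite pw_mix.
Qed.

Definition depends_on B F := forall N N', {in B, N =1 N'} -> F N = F N'.

(** The product of the means is the mean of F N * G N' over two independent copies; after the
    exchange both factors read the same copy. *)
Lemma Ex_indep B F G : depends_on B F -> depends_on (~: B) G ->
  Ex (fun N => F N * G N) = Ex F * Ex G.
Proof.
move=> dF dG; transitivity (Ex (fun N => Ex (fun N' => F N * G N'))); last first.
  by rewrite mulrC -ExZ; apply: eq_Ex => N; rewrite ExZ mulrC.
rewrite -(Ex2_mix B (fun N N' => F N * G N')); apply: eq_Ex => N.
rewrite -[LHS]Ex_cst; apply: eq_Ex => N'; congr (_ * _).
  by apply: dF => t tB; rewrite ffunE tB.
by apply: dG => t; rewrite inE ffunE => /negPf ->.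
Qed.

Lemma Ex_prod (J : eqType) (s : seq J) (D : J -> {set T}) (F : J -> {ffun T -> K} -> R) :
  uniq s -> {in s &, forall i j, i != j -> [disjoint D i & D j]} ->
  (forall j, depends_on (D j) (F j)) ->
  Ex (fun N => \prod_(j <- s) F j N) = \prod_(j <- s) Ex (F j).
Proof.
move=> + + dF; elim: s => [_ _|j s IH /= /andP[js us] dis].
  by under eq_Ex do rewrite big_nil; rewrite big_nil Ex_cst.
under eq_Ex do rewrite big_cons; rewrite big_cons (@Ex_indep (D j)) //.
  by rewrite IH // => i k iS kS; apply: dis; rewrite inE ?iS ?kS orbT.
move=> N N' e; apply: eq_big_seq => i iS; apply: dF => t ti; apply: e.
rewrite inE; apply/negP => tj.
have ji : j != i by apply: contraNneq js => ->.
by have /disjointFr/(_ tj) := dis j i (mem_head _ _) (mem_behead (iS : i \in behead (j :: s))) ji; rewrite ti.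
Qed.

End product_measure.

(** Multiply by 1 - x and use exp x (1 - x) <= 1. Since (1 + x + 2 x^2) (1 - x) = 1 + x^2 (1 - 2 x),
    the range stops at 1/2. *)
Lemma expR_le_quad (R : realType) (x : R) : 0 <= x -> x <= 2^-1 ->
  expR x <= 1 + x + 2 * x ^+ 2.
Proof.
move=> x0 x1; have h := expR_ge1Dx (- x).
have e : expR x * expR (- x) = 1 by rewrite -expRD subrr expR0.
have p := expR_gt0 x.
have q : expR x * (1 - x) <= 1 by apply: le_trans (ler_wpM2l (ltW p) h) _; rewrite e.
have : (1 + x + 2 * x ^+ 2) * (1 - x) >= 1.
  have : 0 <= x ^+ 2 * (1 - 2 * x) by rewrite mulr_ge0 ?sqr_ge0 //; lra.
  by rewrite expr2; nra.
by move=> k; rewrite -(@ler_pM2r _ (1 - x)); [apply: le_trans q k | lra].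
Qed.

Lemma expRN_le_quad (R : realType) (x : R) : 0 <= x -> expR (- x) <= 1 - x + 2 * x ^+ 2.
Proof.
move=> x0; have h := expR_ge1Dx x.
have e : expR (- x) * expR x = 1 by rewrite -expRD addNr expR0.
have p := expR_gt0 (- x).
have q : expR (- x) * (1 + x) <= 1 by apply: le_trans (ler_wpM2l (ltW p) h) _; rewrite e.
have : (1 - x + 2 * x ^+ 2) * (1 + x) >= 1.
  have : 0 <= x ^+ 2 * (1 + 2 * x) by rewrite mulr_ge0 ?sqr_ge0 //; lra.
  by rewrite expr2; nra.
by move=> k; rewrite -(@ler_pM2r _ (1 + x)); [apply: le_trans q k | lra].
Qed.

(** * Chernoff bounds for nonnegative functions of disjoint blocks of coordinates *)

Section concentration.
Context {R : realType} {T K : finType}.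
Variable w : T -> K -> R.
Hypothesis w_ge0 : forall t k, 0 <= w t k.
Hypothesis w_sum : forall t, \sum_k w t k = 1.
Local Notation Ex := (Ex w).
Context {J : eqType} (s : seq J) (D : J -> {set T}) (Y : J -> {ffun T -> K} -> R).
Hypothesis us : uniq s.
Hypothesis dis : {in s &, forall i j, i != j -> [disjoint D i & D j]}.
Hypothesis dY : forall j, depends_on (D j) (Y j).
Hypothesis Y_ge0 : forall j N, 0 <= Y j N.

Lemma Ex_prod_quad (c d : R) : (forall j N, 0 <= 1 + c * Y j N + d * Y j N ^+ 2) ->
  Ex (fun N => \prod_(j <- s) (1 + c * Y j N + d * Y j N ^+ 2)) <=
  expR (c * (\sum_(j <- s) Ex (Y j)) + d * \sum_(j <- s) Ex (fun N => Y j N ^+ 2)).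
Proof.
move=> ge0; rewrite (Ex_prod w_sum us dis) => [|j N N' e]; last by rewrite (dY e).
rewrite !mulr_sumr -big_split expR_sum; apply: ler_prod => j _.
rewrite Ex_ge0 //=; apply: le_trans (expR_ge1Dx _).
by rewrite !ExD !ExZ Ex_cst // addrA.
Qed.

(** Markov's inequality is applied to a product of quadratic polynomials instead of the exponential:
    it is nonnegative everywhere and dominates the exponential where l * Y j N <= 1/2. The
    truncation thus enters only through the event, and the means and second moments stay
    untruncated. *)
Lemma chernoff_upper (l t : R) : 0 < l ->
  Ex (fun N => ((all (fun j => l * Y j N <= 2^-1) s) &&
      (\sum_(j <- s) Ex (Y j) + t <= \sum_(j <- s) Y j N))%:R) <=
  expR (2 * l ^+ 2 * \sum_(j <- s) Ex (fun N => Y j N ^+ 2) - l * t).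
Proof.
move=> l0; set m := \sum_(j <- s) Ex (Y j).
have h0 j N : 0 <= 1 + l * Y j N + (2 * l ^+ 2) * Y j N ^+ 2.
  by rewrite !addr_ge0 ?mulr_ge0 ?sqr_ge0 // ltW.
apply: (@le_trans _ _ (Ex (fun N => expR (- (l * (m + t))) *
    \prod_(j <- s) (1 + l * Y j N + (2 * l ^+ 2) * Y j N ^+ 2)))).
  apply: le_Ex => // N; case: andP => [[/allP ok big]|_]; last first.
    by rewrite mulr_ge0 ?expR_ge0 ?prodr_ge0.
  apply: (@le_trans _ _ (expR (- (l * (m + t))) * expR (l * (m + t)))).
    by rewrite -expRD addNr expR0.
  rewrite ler_wpM2l ?expR_ge0 //; apply: (@le_trans _ _ (expR (l * \sum_(j <- s) Y j N))).
    by rewrite ler_expR ler_wpM2l // ltW.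
  rewrite mulr_sumr expR_sum big_seq [leRHS]big_seq.
  apply: ler_prod => j js.
  rewrite expR_ge0 /=; apply: le_trans (expR_le_quad _ (ok j js)) _.
    by rewrite mulr_ge0 // ltW.
  by rewrite exprMn mulrA.
rewrite ExZ; apply: (@le_trans _ _ (expR (- (l * (m + t))) *
   expR (l * m + 2 * l ^+ 2 * \sum_(j <- s) Ex (fun N => Y j N ^+ 2)))).
  by rewrite ler_wpM2l ?expR_ge0 ?Ex_prod_quad.
by rewrite -expRD ler_expR; lra.
Qed.

Lemma chernoff_lower (l t : R) : 0 < l ->
  Ex (fun N => (\sum_(j <- s) Y j N <= \sum_(j <- s) Ex (Y j) - t)%R%:R) <=
  expR (2 * l ^+ 2 * \sum_(j <- s) Ex (fun N => Y j N ^+ 2) - l * t).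
Proof.
move=> l0; set m := \sum_(j <- s) Ex (Y j).
have hq j N : expR (- (l * Y j N)) <= 1 + (- l) * Y j N + (2 * l ^+ 2) * Y j N ^+ 2.
  apply: le_trans (expRN_le_quad _) _; first by rewrite mulr_ge0 // ltW.
  by rewrite exprMn mulrA mulNr.
have h0 j N : 0 <= 1 + (- l) * Y j N + (2 * l ^+ 2) * Y j N ^+ 2.
  by apply: le_trans (hq j N); exact: expR_ge0.
apply: (@le_trans _ _ (Ex (fun N => expR (l * (m - t)) *
    \prod_(j <- s) (1 + (- l) * Y j N + (2 * l ^+ 2) * Y j N ^+ 2)))).
  apply: le_Ex => // N; case: (leP (\sum_(j <- s) Y j N)) => [small|_]; last first.
    by rewrite mulr_ge0 ?expR_ge0 ?prodr_ge0.
  apply: (@le_trans _ _ (expR (l * (m - t)) * expR (- (l * (m - t))))).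
    by rewrite -expRD subrr expR0.
  rewrite ler_wpM2l ?expR_ge0 //; apply: (@le_trans _ _ (expR (- (l * \sum_(j <- s) Y j N)))).
    by rewrite ler_expR lerN2 ler_wpM2l // ltW.
  rewrite mulr_sumr -sumrN expR_sum; apply: ler_prod => j _.
  by rewrite expR_ge0 hq.
rewrite ExZ; apply: (@le_trans _ _ (expR (l * (m - t)) *
   expR (- l * m + 2 * l ^+ 2 * \sum_(j <- s) Ex (fun N => Y j N ^+ 2)))).
  by rewrite ler_wpM2l ?expR_ge0 ?Ex_prod_quad.
by rewrite -expRD ler_expR; lra.
Qed.

End concentration.

(** * Mass of a window by resampling *)

Section discrete_ivt.
Context {R : realType} {T K : finType}.
Variable w : T -> K -> R.
Hypothesis w_ge0 : forall t k, 0 <= w t k.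
Hypothesis w_sum : forall t, \sum_k w t k = 1.
Local Notation Ex := (Ex w).
Variable h : T -> K -> nat.
Let H (N : {ffun T -> K}) := (\sum_t h t (N t))%N.

(* Resampling the coordinates one by one leads from N to an independent copy N' through
   configurations that all have the law of N; if H passes from below n to above n with
   increments at most L, then it visits the window [n - L, n]. *)
Lemma window_mass (n L : nat) :
  Ex (fun N => (H N <= n)%:R) * Ex (fun N => (n < H N)%:R) <=
  #|T|.+1%:R * Ex (fun N => (n <= H N + L <= n + L)%:R) + \sum_t Ex (fun N => (L < h t (N t))%:R).
Proof.
pose B k := [set t : T | (enum_rank t < k)%N].
pose M (N N' : {ffun T -> K}) k := mix (B k) N' N.
(* [n <= H + L <= n + L] places H in [n - L, n] without truncated subtraction. If no coordinate of
   N' contributes more than L and no intermediate configuration is in the window, then H stays below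
   n - L along the whole path, against n < H N'. *)
have pt N N' : (H N <= n)%:R * (n < H N')%:R <=
    \sum_(k < #|T|.+1) (n <= H (M N N' k) + L <= n + L)%:R
     + \sum_t (L < h t (N' t))%:R :> R.
  have s0 : 0 <= \sum_(k < #|T|.+1) (n <= H (M N N' k) + L <= n + L)%:R :> R by apply: sumr_ge0.
  have s1 : 0 <= \sum_t (L < h t (N' t))%:R :> R by apply: sumr_ge0.
  case: (leqP (H N) n) => HN; last by rewrite mul0r addr_ge0.
  case: (ltnP n (H N')) => HN'; last by rewrite mulr0 addr_ge0.
  rewrite mulr1.
  have [/existsP[t Lt]|/existsPn noL] := boolP [exists t, (L < h t (N' t))%N].
    by rewrite (bigD1 t) //= Lt addrCA lerDl addr_ge0 // sumr_ge0.
  have [/existsP[k win]|/existsPn now] :=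
      boolP [exists k : 'I_#|T|.+1, (n <= H (M N N' k) + L <= n + L)%N].
    by rewrite (bigD1 k) //= win -!addrA lerDl addr_ge0 // sumr_ge0.
  exfalso.
  have below k : (k <= #|T|)%N -> (H (M N N' k) + L < n)%N.
    elim: k => [_|k IH kT].
      have := now ord0; suff -> : M N N' (@ord0 #|T|) = N by lia.
      by apply/ffunP => t; rewrite ffunE inE ltn0.
    have := now (Ordinal (kT : (k.+1 < #|T|.+1)%N)); rewrite /=.
    suff : (H (M N N' k.+1) <= H (M N N' k) + L)%N by have := IH (ltnW kT); lia.
    have le1 : (H (M N N' k.+1) <= H (M N N' k) +
        \sum_(t | enum_rank t == k :> nat) h t (N' t))%N.
      rewrite /H [X in (_ + X)%N]big_mkcond -big_split /=; apply: leq_sum => t _.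
      rewrite !ffunE !inE ltnS; case: ltngtP => //= e; rewrite ?e ?addn0 //; lia.
    apply: leq_trans le1 _; rewrite leq_add2l.
    rewrite (big_pred1 (enum_val (Ordinal kT))); first by rewrite leqNgt noL.
    by move=> t; rewrite /= -(inj_eq enum_rank_inj) enum_valK -val_eqE.
  have := below #|T| (leqnn _); suff -> : M N N' #|T| = N' by lia.
  by apply/ffunP => t; rewrite ffunE inE ltn_ord.
have -> : Ex (fun N => (H N <= n)%:R) * Ex (fun N => (n < H N)%:R) =
   Ex (fun N => Ex (fun N' => (H N <= n)%:R * (n < H N')%:R)).
  by rewrite mulrC -ExZ; apply: eq_Ex => N; rewrite ExZ mulrC.
apply: (@le_trans _ _ (Ex (fun N => Ex (fun N' => \sum_(k < #|T|.+1) (n <= H (M N N' k) + L <= n + L)%:R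
     + \sum_t (L < h t (N' t))%:R)))).
  by apply: le_Ex => // N; apply: le_Ex.
under eq_Ex do rewrite ExD; rewrite ExD lerD //; last first.
  by rewrite Ex_cst // Ex_sum.
under eq_Ex do rewrite Ex_sum; rewrite Ex_sum.
have e k : Ex (fun N => Ex (fun N' => (n <= H (M N N' k) + L <= n + L)%:R)) =
    Ex (fun N => (n <= H N + L <= n + L)%:R).
  have := Ex2_mix w (~: B k) (fun N _ => (n <= H N + L <= n + L)%:R).
  have -> : (fun N => Ex (fun N' => (n <= H (mix (~: B k) N N') + L <= n + L)%:R)) =
     (fun N => Ex (fun N' => (n <= H (M N N' k) + L <= n + L)%:R)).
    apply/funext => N; apply: eq_Ex => N'; congr (nat_of_bool (n <= H _ + L <= n + L)%N)%:R;
    by apply/ffunP => t; rewrite !ffunE !inE; case: (enum_rank t < k)%N.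
  by move=> ->; apply: eq_Ex => N; rewrite Ex_cst.
by rewrite (eq_bigr (fun=> Ex (fun N => (n <= H N + L <= n + L)%:R))) // sumr_const card_ord mulr_natl.
Qed.

End discrete_ivt.

Import numFieldNormedType.Exports.
Local Open Scope classical_set_scope.
Local Open Scope ring_scope.

(** * The normal distribution and the heat flow *)

Section normal_cdf.
Context {R : realType}.
Implicit Types m s x y : R.

Definition normal_cdf m s x : R := fine (normal_prob m s `]-oo, x]).

Lemma normal_cdfE m s x : normal_prob m s `]-oo, x] = (normal_cdf m s x)%:E.
Proof. by rewrite /normal_cdf fineK // fin_num_measure. Qed.

Lemma normal_cdf_ge0 m s x : 0 <= normal_cdf m s x.
Proof. exact: fine_ge0. Qed.

Lemma normal_cdf_le1 m s x : normal_cdf m s x <= 1.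
Proof. by rewrite -lee_fin -normal_cdfE probability_le1. Qed.

Lemma normal_cdf_mono m s x y : x <= y -> normal_cdf m s x <= normal_cdf m s y.
Proof.
move=> xy; rewrite -lee_fin -!normal_cdfE le_measure ?inE //.
exact: subitvPr.
Qed.

Lemma is_derive_normal_cdf m s x : s != 0 ->
  is_derive x 1 (normal_cdf m s) (normal_pdf m s x).
Proof.
move=> s0.
have i : (lebesgue_measure).-integrable `]-oo, (x + 1)] (EFin \o normal_pdf m s).
  by apply: integrableS (integrable_normal_pdf m s).
have x1 : x < x + 1 by rewrite ltrDl.
have [d1 d2] := continuous_FTC1 x1 i (ltNyr x) (@continuous_normal_pdf _ m s s0 x).
by apply: DeriveDef => //; rewrite -derive1E d2.
Qed.

(** The identity is a random variable of law [normal_prob m s], and [normal_cdf] is its distribution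
    function. *)
Lemma normal_cdfy m s : normal_cdf m s x @[x --> +oo%R] --> (1 : R).
Proof.
pose X : measurableTypeR R -> R := idfun.
pose mX := @isMeasurableFun.Build _ _ _ _ X (@measurable_id _ _ setT).
pose X' : {RV (normal_prob m s) >-> R} := HB.pack X mX.
have := cvg_cdfy1 X'.
by move=> /fine_cvg.
Qed.

Lemma normal_cdfNy m s : normal_cdf m s x @[x --> -oo%R] --> (0 : R).
Proof.
pose X : measurableTypeR R -> R := idfun.
pose mX := @isMeasurableFun.Build _ _ _ _ X (@measurable_id _ _ setT).
pose X' : {RV (normal_prob m s) >-> R} := HB.pack X mX.
have := cvg_cdfNy0 X'.
by move=> /fine_cvg.
Qed.

(** Both sides have the same derivative and tend to 0 at -oo; this replaces a change of variable in
    the integral. *)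
Lemma normal_cdf_std m s x : 0 < s -> normal_cdf m s x = normal_cdf 0 1 ((x - m) / s).
Proof.
move=> s0; have sn0 : s != 0 by rewrite gt_eqF.
pose g y := normal_cdf m s y - normal_cdf 0 1 ((y - m) / s).
have dg y : is_derive y 1 g 0.
  have d1 := @is_derive_normal_cdf m s y sn0.
  have d2 : is_derive y 1 (fun y => (y - m) / s) s^-1.
    by apply: trigger_derive; rewrite /GRing.scale /=; lra.
  have d3 := @is_derive_normal_cdf 0 1 ((y - m) / s) (oner_neq0 R).
  have d4 := @is_derive1_comp _ (normal_cdf 0 1) (fun y => (y - m) / s) y _ _ d3 d2.
  apply: is_derive_eq.
  rewrite !normal_pdfE ?oner_neq0 //.
  have -> : normal_peak s = normal_peak 1 / s.
    rewrite /normal_peak; have -> : s ^+ 2 * pi *+ 2 = s ^+ 2 * (1 ^+ 2 * pi *+ 2) by ring.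
    by rewrite sqrtrM ?sqr_ge0 // sqrtr_sqr gtr0_norm // invfM mulrC.
  have -> : normal_fun m s y = normal_fun 0 1 ((y - m) / s).
    by congr expR; field.
  by ring.
have cg y : g y = g x by apply: is_derive_0_is_cst.
have : g y @[y --> -oo%R] --> (0 - 0 : R).
  apply: cvgB; first exact: normal_cdfNy.
  apply: (cvg_comp (fun y => (y - m) / s) (normal_cdf 0 1)); last exact: normal_cdfNy.
  by apply: gt0_cvgMlNy; [rewrite invr_gt0 | exact: cvg_addrr_Ny].
have -> : g = fun=> g x by apply/funext => y; exact: cg.
rewrite subr0 => h; apply/eqP; rewrite -subr_eq0; apply/eqP.
exact: (cvg_unique _ (cvg_cst (g x)) h).
Qed.

Lemma is_derive_MVT (f df : R -> R) (a b : R) : a <= b ->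
  (forall x, is_derive x 1 f (df x)) ->
  exists2 c, a <= c <= b & f b - f a = df c * (b - a).
Proof.
move=> ab d; have [|c] := @MVT_segment R f df a b ab (fun x _ => d x).
  apply: continuous_subspaceT => x; apply: differentiable_continuous.
  by apply/derivable1_diffP; case: (d x).
by rewrite in_itv /= => cab e; exists c.
Qed.

Lemma is_derive_lipschitz (f df : R -> R) (C : R) (a b : R) :
  (forall x, is_derive x 1 f (df x)) -> (forall x, `|df x| <= C) ->
  `|f b - f a| <= C * `|b - a|.
Proof.
move=> d C0; wlog ab : a b / a <= b => [h|].
  have [/h //|/ltW /h] := leP a b.
  by rewrite distrC (distrC a).
have [c _ ->] := is_derive_MVT ab d.
by rewrite normrM ler_wpM2r.
Qed.

Local Notation phi := (normal_pdf (0 : R) 1).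
Local Notation c0 := (normal_peak (1 : R)).
(** [gauss1] and [gauss2] are the first two derivatives of the standard normal density. *)
Definition gauss1 x : R := - (x * phi x).
Definition gauss2 x : R := (x ^+ 2 - 1) * phi x.

Lemma phiE x : phi x = c0 * expR (- (x ^+ 2 / 2)).
Proof. by rewrite normal_pdfE ?oner_neq0 // /normal_fun subr0 expr1n mulNr. Qed.

Lemma c0_gt0 : 0 < c0. Proof. exact/normal_peak_gt0/oner_neq0. Qed.

Lemma is_derive_phi x : is_derive x 1 phi (gauss1 x).
Proof.
have -> : phi = fun x => c0 * expR (- (x ^+ 2 / 2)) by apply/funext => y; exact: phiE.
have d1 : is_derive x 1 (fun x : R => - (x ^+ 2 / 2)) (- x).
  by apply: trigger_derive; rewrite /GRing.scale /=; field.
have d2 := @is_derive1_comp _ expR _ x _ _ (is_derive_expR _) d1.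
rewrite /gauss1 phiE.
have -> : - (x * (c0 * expR (- (x ^+ 2 / 2)))) = c0 *: (expR (- (x ^+ 2 / 2)) * - x).
  by rewrite /GRing.scale /=; ring.
exact: is_deriveZ.
Qed.

Lemma is_derive_gauss1 x : is_derive x 1 gauss1 (gauss2 x).
Proof.
have d1 := is_derive_phi x.
have d2 : is_derive x 1 (fun x : R => - x) (-1) by apply: trigger_derive.
have := @is_deriveM _ _ (fun x : R => - x) phi x 1 _ _ d2 d1.
have -> : ((fun x : R => - x) * phi) = gauss1.
  by apply/funext => y; rewrite /gauss1 -mulNr.
move=> h; apply: (is_derive_eq h); rewrite /gauss1 /gauss2 /GRing.scale /=; ring.
Qed.

(** The polynomial is (1 + x^2/4)^2, which is at most exp (x^2/2), so growth up to degree 4 is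
    absorbed by the density. The sup bounds on derivatives below are instances. *)
Lemma phi_poly_bound x (p K : R) : 0 <= K ->
  p <= K * (1 + x ^+ 2 / 2 + x ^+ 4 / 16) -> p * phi x <= K * c0.
Proof.
move=> K0 h; have e := expR_ge1Dx (x ^+ 2 / 2 / 2).
have x0 : 0 <= x ^+ 2 / 2 / 2 by rewrite !divr_ge0 ?sqr_ge0.
have e2 : 1 + x ^+ 2 / 2 + x ^+ 4 / 16 <= expR (x ^+ 2 / 2).
  have -> : x ^+ 2 / 2 = x ^+ 2 / 2 / 2 + x ^+ 2 / 2 / 2 by field.
  rewrite expRD; apply: le_trans (ler_pM _ _ e e); [|lra|lra].
  by rewrite le_eqVlt; apply/orP; left; apply/eqP; field.
have E0 := expR_gt0 (- (x ^+ 2 / 2)); have c := c0_gt0.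
have ee : expR (x ^+ 2 / 2) * expR (- (x ^+ 2 / 2)) = 1 by rewrite -expRD subrr expR0.
rewrite phiE mulrCA mulrC ler_pM2r //.
have -> : K = K * expR (x ^+ 2 / 2) * expR (- (x ^+ 2 / 2)) by rewrite -mulrA ee mulr1.
rewrite ler_pM2r //; apply: le_trans h _; exact: ler_wpM2l.
Qed.

Lemma phi_ge0 x : 0 <= phi x. Proof. exact: normal_pdf_ge0. Qed.

Lemma gauss1_bound x : `|gauss1 x| <= c0.
Proof.
rewrite /gauss1 normrN normrM (ger0_norm (phi_ge0 x)) -[leRHS]mul1r.
apply: phi_poly_bound => //; rewrite mul1r.
have : 0 <= x ^+ 4 by rewrite exprn_even_ge0.
have : `|x| <= 1 + x ^+ 2 / 2.
  by rewrite -(real_normK (num_real x)); have := sqr_ge0 (`|x| - 1); rewrite expr2; lra.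
lra.
Qed.

Lemma gauss2_bound x : `|gauss2 x| <= 3 * c0.
Proof.
rewrite /gauss2 normrM (ger0_norm (phi_ge0 x)); apply: phi_poly_bound => //.
have : 0 <= x ^+ 4 by rewrite exprn_even_ge0.
have : `|x ^+ 2 - 1| <= x ^+ 2 + 1.
  by rewrite ler_norml; have := sqr_ge0 x; lra.
have := sqr_ge0 x; lra.
Qed.

Lemma gauss2_bound_mul x : `|x| * `|gauss2 x| <= 9 * c0.
Proof.
rewrite /gauss2 normrM (ger0_norm (phi_ge0 x)) mulrA; apply: phi_poly_bound => //.
have h : `|x ^+ 2 - 1| <= x ^+ 2 + 1 by rewrite ler_norml; have := sqr_ge0 x; lra.
apply: le_trans (ler_wpM2l (normr_ge0 x) h) _.
have -> : x ^+ 4 = `|x| ^+ 4 by rewrite -normrX ger0_norm // exprn_even_ge0.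
rewrite -(real_normK (num_real x)); have := normr_ge0 x; move: `|x| => a a0.
have := sqr_ge0 (a - 1); have := sqr_ge0 (a ^+ 2 - a); nra.
Qed.

Lemma phi_symdiff x d : 0 <= d -> `|phi (x + d) - phi (x - d) - 2 * d * gauss1 x| <= 6 * c0 * d ^+ 2.
Proof.
move=> d0; have xd : x - d <= x + d by lra.
have [c /andP[h1 h2] ->] := is_derive_MVT xd is_derive_phi.
have -> : gauss1 c * (x + d - (x - d)) - 2 * d * gauss1 x = 2 * d * (gauss1 c - gauss1 x) by ring.
rewrite normrM (@ger0_norm _ (2 * d)); last lra.
have h := @is_derive_lipschitz gauss1 gauss2 (3 * c0) x c is_derive_gauss1 gauss2_bound.
have h3 : `|c - x| <= d by rewrite ler_norml; lra.
have h4 : `|gauss1 c - gauss1 x| <= 3 * c0 * d.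
  by apply: le_trans h _; rewrite ler_wpM2l // mulr_ge0 // ltW // c0_gt0.
have -> : 6 * c0 * d ^+ 2 = 2 * d * (3 * c0 * d) by ring.
by rewrite ler_wpM2l // mulr_ge0.
Qed.

(** The bound must be uniform in y. The two arguments differ by y / p times (p - r) / r, and the
    mean value point is at least y / p in absolute value, so the factor y / p is absorbed by
    [gauss2_bound_mul]. *)
Lemma gauss1_scale y r p : 0 < r -> r <= p ->
  `|gauss1 (y / r) - gauss1 (y / p)| <= 9 * c0 * ((p - r) / r).
Proof.
move=> r0 rp; have p0 : 0 < p by apply: lt_le_trans rp.
have key a b c : `|a| <= `|c| -> b - a = a * ((p - r) / r) ->
   `|gauss2 c * (b - a)| <= 9 * c0 * ((p - r) / r).
  move=> ac ->; have q0 : 0 <= (p - r) / r by rewrite divr_ge0 ?subr_ge0 // ltW.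
  rewrite mulrA normrM (ger0_norm q0) ler_wpM2r // normrM mulrC.
  by apply: le_trans (gauss2_bound_mul c); rewrite ler_wpM2r.
have eq : y / r - y / p = y / p * ((p - r) / r).
  by field; rewrite !gt_eqF.
have y0 : (0 <= y) = (0 <= y / p) by rewrite pmulr_lge0 ?invr_gt0.
have q0 : 0 <= (p - r) / r by rewrite divr_ge0 ?subr_ge0 // ltW.
have [yge|ylt] := leP 0 y.
  have a0 : 0 <= y / p by rewrite -y0.
  have ab : y / p <= y / r by rewrite -subr_ge0 eq mulr_ge0.
  have [c /andP[c1 c2] ->] := is_derive_MVT ab is_derive_gauss1.
  by apply: key => //; rewrite !ger0_norm //; apply: le_trans c1.
have a0 : y / p < 0 by rewrite ltNge -y0 -ltNge.
have ab : y / r <= y / p by rewrite -subr_le0 eq mulr_le0_ge0 // ltW.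
have [c /andP[c1 c2] e] := is_derive_MVT ab is_derive_gauss1.
rewrite -opprB normrN e; have -> : gauss2 c * (y / p - y / r) = - (gauss2 c * (y / r - y / p)) by ring.
have cle : c <= 0 by apply: le_trans c2 (ltW a0).
by rewrite normrN; apply: key; rewrite // !ler0_norm ?lerN2 // ltW.
Qed.

(* Solution of the heat equation 2 u_t = u_yy whose initial value is the indicator of [0, +oo[. *)
Definition heat (t y : R) : R := normal_cdf 0 1 (y / Num.sqrt t).

Lemma is_derive_sqrt_shift t x : 0 < t ->
  is_derive x 1 (fun x => (Num.sqrt (t + x ^+ 2))^-1) (- (x / Num.sqrt (t + x ^+ 2) ^+ 3)).
Proof.
move=> t0; have tx : 0 < t + x ^+ 2 by rewrite ltr_wpDr ?sqr_ge0.
have p0 : Num.sqrt (t + x ^+ 2) != 0 by rewrite gt_eqF // sqrtr_gt0.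
have d1 : is_derive x 1 (fun x : R => t + x ^+ 2) (2 * x).
  by apply: trigger_derive; rewrite /GRing.scale /=; ring.
have d2 := @is_derive1_comp _ (@Num.sqrt R) _ x _ _ (is_derive1_sqrt tx) d1.
have d3 := @is_deriveV R (Num.sqrt \o (fun x : R => t + x ^+ 2)) x _ 1 p0 d2.
apply: (is_derive_eq d3); rewrite /GRing.scale /=; field; exact: p0.
Qed.

(** The difference vanishes at x = 0; its derivative at c is at most 13 c0 c^2 / r^3, because the
    leading terms cancel by the heat equation. The errors are 3 from [phi_symdiff], 9 from moving
    the argument of [gauss1] from y / r to y / p c, and 1 from replacing the factor r^-2 by (p
    c)^-2. *)
Lemma heat_step_pos t y x : 0 < t -> 0 <= x ->
  `|(heat t (y + x) + heat t (y - x)) / 2 - heat (t + x ^+ 2) y|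
  <= 13 * c0 / Num.sqrt t ^+ 3 * x ^+ 3.
Proof.
move=> t0 x0; set r := Num.sqrt t; have r0 : 0 < r by rewrite sqrtr_gt0.
have rn : r != 0 by rewrite gt_eqF.
pose p x := Num.sqrt (t + x ^+ 2).
pose k x := (heat t (y + x) + heat t (y - x)) / 2 - heat (t + x ^+ 2) y.
pose k' x := (phi ((y + x) / r) - phi ((y - x) / r)) / (2 * r) - x * gauss1 (y / p x) / p x ^+ 2.
have p_gt0 z : 0 < p z by rewrite sqrtr_gt0 ltr_wpDr ?sqr_ge0.
have dk (z : R) : is_derive z 1 k (k' z).
  have dN w := @is_derive_normal_cdf 0 1 w (oner_neq0 R).
  have d1 : is_derive z 1 (fun x => (y + x) / r) r^-1.
    by apply: trigger_derive; rewrite /GRing.scale /=; field.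
  have d2 : is_derive z 1 (fun x => (y - x) / r) (- r^-1).
    by apply: trigger_derive; rewrite /GRing.scale /=; field.
  have d3 : is_derive z 1 (fun x => y / p x) (y * - (z / p z ^+ 3)).
    by have := is_derive_sqrt_shift z t0 => /(is_deriveZ y).
  have e1 := @is_derive1_comp _ (normal_cdf 0 1) _ z _ _ (dN _) d1.
  have e2 := @is_derive1_comp _ (normal_cdf 0 1) _ z _ _ (dN _) d2.
  have e3 := @is_derive1_comp _ (normal_cdf 0 1) _ z _ _ (dN _) d3.
  have -> : k = (2^-1 \*: ((normal_cdf 0 1 \o (fun x => (y + x) / r)) +
     (normal_cdf 0 1 \o (fun x => (y - x) / r)))) - (normal_cdf 0 1 \o (fun x => y / p x)).
    by apply/funext => w; rewrite /k /heat /= mulrC.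
  have := is_deriveB (is_deriveZ 2^-1 (is_deriveD e1 e2)) e3.
  move=> h; apply: (is_derive_eq h); rewrite /k' /gauss1 /GRing.scale /=.
  by field; rewrite rn gt_eqF.
have k0 : k 0 = 0.
  by rewrite /k expr0n !addr0 subr0; field.
have [c /andP[c0' cx]] := is_derive_MVT x0 dk; rewrite k0 !subr0 => kx.
have bound : `|k' c| <= 13 * c0 / r ^+ 3 * c ^+ 2.
  have C0 := c0_gt0; have pc := p_gt0 c; have pn : p c != 0 by rewrite gt_eqF.
  have rE : r ^+ 2 = t by rewrite sqr_sqrtr // ltW.
  have pE : p c ^+ 2 = r ^+ 2 + c ^+ 2.
    by rewrite rE sqr_sqrtr // addr_ge0 ?sqr_ge0 // ltW.
  have rp : r <= p c by rewrite ler_wsqrtr // lerDl sqr_ge0.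
  have prc : p c - r <= c.
    have cr : 0 <= 2 * (c * r) by rewrite !mulr_ge0 // ltW.
    rewrite lerBlDr -(@ler_pXn2r _ 2) ?nnegrE ?addr_ge0 ?(ltW pc) ?(ltW r0) // pE.
    have -> : (c + r) ^+ 2 = r ^+ 2 + c ^+ 2 + 2 * (c * r) by ring.
    by rewrite lerDl.
  have cp : c <= p c by rewrite -(@ler_pXn2r _ 2) ?nnegrE ?(ltW pc) // pE lerDr sqr_ge0.
  have d0 : 0 <= c / r by rewrite divr_ge0 // ltW.
  pose E1 := phi (y / r + c / r) - phi (y / r - c / r) - 2 * (c / r) * gauss1 (y / r).
  have A : `|E1| <= 6 * c0 * (c / r) ^+ 2 := phi_symdiff (y / r) d0.
  have B := gauss1_scale y r0 rp.
  have Q := gauss1_bound (y / p c).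
  have -> : k' c = E1 / (2 * r) + c / r ^+ 2 * (gauss1 (y / r) - gauss1 (y / p c))
     + c * (r ^- 2 - p c ^- 2) * gauss1 (y / p c).
    by rewrite /k' /E1 -mulrDl -mulrBl; field; rewrite rn pn.
  have i1 : `|E1 / (2 * r)| <= 3 * c0 / r ^+ 3 * c ^+ 2.
    rewrite normrM normfV (@ger0_norm _ (2 * r)); last lra.
    apply: le_trans (ler_wpM2r _ A) _; first by rewrite invr_ge0; lra.
    by rewrite le_eqVlt; apply/orP; left; apply/eqP; field.
  have i2 : `|c / r ^+ 2 * (gauss1 (y / r) - gauss1 (y / p c))| <= 9 * c0 / r ^+ 3 * c ^+ 2.
    have w : 0 <= c / r ^+ 2 by rewrite divr_ge0 // sqr_ge0.
    rewrite normrM (ger0_norm w); apply: le_trans (ler_wpM2l w B) _.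
    have -> : 9 * c0 / r ^+ 3 * c ^+ 2 = c / r ^+ 2 * (9 * c0 * (c / r)) by field.
    by rewrite ler_wpM2l // ler_wpM2l ?ler_wpM2r ?invr_ge0 //; lra.
  have i3 : `|c * (r ^- 2 - p c ^- 2) * gauss1 (y / p c)| <= c0 / r ^+ 3 * c ^+ 2.
    have e : r ^- 2 - p c ^- 2 = c ^+ 2 / p c ^+ 2 / r ^+ 2.
      have -> : c ^+ 2 = p c ^+ 2 - r ^+ 2 by rewrite pE addrAC subrr add0r.
      by field; rewrite rn pn.
    have w0 : 0 <= r ^- 2 - p c ^- 2 by rewrite e !divr_ge0 ?sqr_ge0.
    have w1 : r ^- 2 - p c ^- 2 <= c / r ^+ 3.
      have -> : c / r ^+ 3 = (c / r) / r ^+ 2 by field.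
      rewrite e ler_wpM2r ?invr_ge0 ?sqr_ge0 //.
      rewrite -expr_div_n expr2; have cp1 : c / p c <= 1 by rewrite ler_pdivrMr // mul1r.
      have cp0 : 0 <= c / p c by rewrite divr_ge0 // ltW.
      apply: le_trans (ler_piMl cp0 cp1) _.
      by rewrite ler_wpM2l // lef_pV2 ?posrE.
    rewrite normrM normrM (ger0_norm c0') (ger0_norm w0).
    have -> : c0 / r ^+ 3 * c ^+ 2 = c * (c / r ^+ 3) * c0 by field.
    by rewrite ler_pM // ?mulr_ge0 // ler_wpM2l.
  have := ler_normD (E1 / (2 * r) + c / r ^+ 2 * (gauss1 (y / r) - gauss1 (y / p c)))
    (c * (r ^- 2 - p c ^- 2) * gauss1 (y / p c)).
  have := ler_normD (E1 / (2 * r)) (c / r ^+ 2 * (gauss1 (y / r) - gauss1 (y / p c))).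
  have -> : 13 * c0 / r ^+ 3 * c ^+ 2 = 3 * c0 / r ^+ 3 * c ^+ 2 + 9 * c0 / r ^+ 3 * c ^+ 2
     + c0 / r ^+ 3 * c ^+ 2 by ring.
  lra.
rewrite -/(k x) kx normrM (ger0_norm x0).
have -> : 13 * c0 / r ^+ 3 * x ^+ 3 = 13 * c0 / r ^+ 3 * x ^+ 2 * x by ring.
rewrite ler_wpM2r //; apply: le_trans bound _; rewrite ler_wpM2l ?lerXn2r ?nnegrE //.
by rewrite divr_ge0 ?exprn_ge0 ?mulr_ge0 // ltW // c0_gt0.
Qed.

Lemma heat_step t y x : 0 < t ->
  `|(heat t (y + x) + heat t (y - x)) / 2 - heat (t + x ^+ 2) y|
  <= 13 * c0 / Num.sqrt t ^+ 3 * `|x| ^+ 3.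
Proof.
move=> t0; have [x0|x0] := leP 0 x; first by rewrite (ger0_norm x0); apply: heat_step_pos.
have := @heat_step_pos t y (- x) t0; rewrite opprK sqrrN [heat t (y - x) + _]addrC (ltr0_norm x0).
by apply; rewrite oppr_ge0 ltW.
Qed.

End normal_cdf.

(** * Lindeberg replacement under sign symmetries *)

Section lindeberg.
Context {R : realType} {Omega : finType} {J : eqType}.
Variables (G : {set Omega}) (x : J -> Omega -> R) (flip : J -> Omega -> Omega).
Variables (m : Omega -> R) (eta : R).
Hypothesis eta0 : 0 < eta.
Hypothesis flipK : forall j, involutive (flip j).
Hypothesis flipG : forall j N, (flip j N \in G) = (N \in G).
Hypothesis x_flip : forall j N, x j (flip j N) = - x j N.
Hypothesis x_flip_neq : forall i j N, i != j -> x i (flip j N) = x i N.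
Hypothesis m_flip : forall j N, m (flip j N) = m N.

(* Each x j is symmetric given all the others, so averaging over flip j replaces the
   increment x j by x j ^+ 2 units of heat flow. *)
Lemma lindeberg (s : seq J) (t : Omega -> R) : uniq s -> (forall N, eta <= t N) ->
  (forall j N, j \in s -> t (flip j N) = t N) ->
  `|\sum_(N in G) (heat (t N) (m N + \sum_(j <- s) x j N)
     - heat (t N + \sum_(j <- s) x j N ^+ 2) (m N))| <=
  \sum_(N in G) 13 * normal_peak 1 / Num.sqrt eta ^+ 3 * \sum_(j <- s) `|x j N| ^+ 3.
Proof.
set C := 13 * _ / _.
have C0 : 0 <= C by rewrite divr_ge0 ?exprn_ge0 // mulr_ge0 // ltW // c0_gt0.
(* The time is generalised: after j it becomes t N + x j N ^+ 2, which is still at least eta and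
   invariant under the remaining flips. *)
elim: s t => [|j s IH] t us t_ge tf.
  rewrite [X in `|X|]big1 ?normr0; last by move=> N _; rewrite !big_nil !addr0 subrr.
  by apply: sumr_ge0 => N _; rewrite big_nil mulr0.
case/andP: us => js us.
pose y N := m N + \sum_(i <- s) x i N.
have y_flip N : y (flip j N) = y N.
  rewrite /y m_flip; congr (_ + _); apply: eq_big_seq => i iS.
  by rewrite x_flip_neq //; apply: contraNneq js => <-.
have t_flip N : t (flip j N) = t N by rewrite tf // mem_head.
have step1 : `|\sum_(N in G) (heat (t N) (y N + x j N) - heat (t N + x j N ^+ 2) (y N))|
    <= \sum_(N in G) C * `|x j N| ^+ 3.
  have -> : \sum_(N in G) (heat (t N) (y N + x j N) - heat (t N + x j N ^+ 2) (y N)) =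
     \sum_(N in G) ((heat (t N) (y N + x j N) + heat (t N) (y N - x j N)) / 2
       - heat (t N + x j N ^+ 2) (y N)).
    rewrite !sumrB; congr (_ - _); rewrite -mulr_suml big_split /=.
    have <- : \sum_(N in G) heat (t N) (y N + x j N) = \sum_(N in G) heat (t N) (y N - x j N).
      rewrite (reindex_inj (inv_inj (@flipK j))) /=; apply: eq_big => [N|N _].
        exact: flipG.
      by rewrite t_flip y_flip x_flip.
    by field.
  apply: le_trans (ler_norm_sum _ _ _) _; apply: ler_sum => N _.
  apply: le_trans (heat_step _ _ (lt_le_trans eta0 (t_ge N))) _.
  rewrite ler_wpM2r ?exprn_ge0 // ler_wpM2l ?mulr_ge0 // ?(ltW c0_gt0) //.
  have e0 : 0 < Num.sqrt eta by rewrite sqrtr_gt0.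
  have le : Num.sqrt eta <= Num.sqrt (t N) by rewrite ler_wsqrtr.
  rewrite lef_pV2 ?posrE ?exprn_gt0 ?(lt_le_trans e0 le) //.
  by rewrite lerXn2r ?nnegrE ?(ltW e0) ?(ltW (lt_le_trans e0 le)).
have t2_ge N : eta <= t N + x j N ^+ 2 by rewrite ler_wpDr ?sqr_ge0.
have t2_flip i N : i \in s -> t (flip i N) + x j (flip i N) ^+ 2 = t N + x j N ^+ 2.
  move=> iS; rewrite tf ?inE ?iS ?orbT // x_flip_neq //.
  by apply: contraNneq js => ->.
have step2 := IH _ us t2_ge t2_flip.
have -> : \sum_(N in G) C * \sum_(i <- j :: s) `|x i N| ^+ 3 =
   \sum_(N in G) C * `|x j N| ^+ 3 + \sum_(N in G) C * \sum_(i <- s) `|x i N| ^+ 3.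
  by rewrite -big_split; apply: eq_bigr => N _; rewrite big_cons mulrDr.
apply: le_trans (lerD step1 step2); apply: le_trans (ler_normD _ _).
rewrite -big_split /= le_eqVlt; apply/orP; left; apply/eqP; congr `|_|.
apply: eq_bigr => N _; rewrite !big_cons /y addrA subrKA; congr (heat _ _ - heat _ _).
  by rewrite addrAC.
by rewrite addrA.
Qed.

End lindeberg.

(** * Moments of the geometric variables and their asymptotics *)

Section capped_geometric.
Context {R : realType}.
Implicit Types (x : R) (c k : nat).

(* Law of min(X, c) for X geometric with P(X >= a) = x ^ a. *)
Definition capgeo c x k : R := if (k < c)%N then (1 - x) * x ^+ k else x ^+ c.

Lemma capgeo_ge0 c x k : 0 <= x -> x <= 1 -> 0 <= capgeo c x k.
Proof. by move=> x0 x1; rewrite /capgeo; case: ifP => _; rewrite ?mulr_ge0 ?exprn_ge0 ?subr_ge0. Qed.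

(** Abel summation against the tails x ^ a, 1 <= a <= c. Moments become polynomials in x, ready to
    be summed over the box. *)
Lemma capgeo_sum c x (f : nat -> R) :
  \sum_(k < c.+1) capgeo c x k * f k = f 0 + \sum_(a < c) (f a.+1 - f a) * x ^+ a.+1.
Proof.
elim: c => [|c IH]; first by rewrite big_ord1 big_ord0 /capgeo /= expr0 mul1r addr0.
rewrite big_ord_recr /= [in RHS]big_ord_recr /= addrA -IH big_ord_recr [in RHS]big_ord_recr /=.
rewrite /capgeo ltnn ltnSn ltnn.
under eq_bigr => k _ do rewrite (ltn_trans (ltn_ord k) (ltnSn c)).
under [in RHS]eq_bigr => k _ do rewrite ltn_ord.
by rewrite !exprS; ring.
Qed.

Lemma capgeo_sum1 c x : \sum_(k < c.+1) capgeo c x k = 1.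
Proof.
have := capgeo_sum c x (fun=> 1); rewrite [X in _ = _ + X -> _]big1 => [|a _]; last by rewrite subrr mul0r.
by rewrite addr0 => <-; apply: eq_bigr => k _; rewrite mulr1.
Qed.

Definition geo1 c x : R := \sum_(a < c) x ^+ a.+1.
Definition geo2 c x : R := \sum_(a < c) (2 * a%:R + 1) * x ^+ a.+1.

Lemma capgeo_mean c x : \sum_(k < c.+1) capgeo c x k * k%:R = geo1 c x.
Proof.
rewrite (capgeo_sum c x (fun k => k%:R)) add0r; apply: eq_bigr => a _.
by rewrite -natrB // subSnn mul1r.
Qed.

Lemma capgeo_sqr c x : \sum_(k < c.+1) capgeo c x k * k%:R ^+ 2 = geo2 c x.
Proof.
rewrite (capgeo_sum c x (fun k => k%:R ^+ 2)) expr0n add0r; apply: eq_bigr => a _.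
by congr (_ * _); rewrite -natr1; ring.
Qed.

Lemma capgeo_pow4 c x : 0 <= x ->
  \sum_(k < c.+1) capgeo c x k * k%:R ^+ 4 <= \sum_(a < c) 4 * a.+1%:R ^+ 3 * x ^+ a.+1.
Proof.
move=> x0; rewrite (capgeo_sum c x (fun k => k%:R ^+ 4)) expr0n add0r; apply: ler_sum => a _.
rewrite ler_wpM2r ?exprn_ge0 // -natr1; have : 0 <= a%:R :> R by [].
move: (a%:R : R) => {a}a a0.
have := exprn_ge0 2 a0; have := exprn_ge0 3 a0.
have -> : (a + 1) ^+ 4 - a ^+ 4 = 4 * a ^+ 3 + 6 * a ^+ 2 + 4 * a + 1 by ring.
have -> : 4 * (a + 1) ^+ 3 = 4 * a ^+ 3 + 12 * a ^+ 2 + 12 * a + 4 by ring.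
lra.
Qed.

(** For an increasing predicate the increments in [capgeo_sum] telescope to at most 1, and each
    nonzero one is weighted by a tail of at most B. *)
Lemma capgeo_tail c x B (P : nat -> bool) : 0 <= x -> x <= 1 -> P 0 = false ->
  (forall a, P a -> P a.+1) -> (forall a, P a -> x ^+ a <= B) -> 0 <= B ->
  \sum_(k < c.+1) capgeo c x k * (P k)%:R <= B.
Proof.
move=> x0 x1 P0 Pm PB B0; rewrite (capgeo_sum c x (fun k => (P k)%:R)) P0 add0r.
apply: (@le_trans _ _ (\sum_(a < c) ((P a.+1)%:R - (P a)%:R) * B)).
  apply: ler_sum => a _; case: (boolP (P a.+1)) => p1.
    by rewrite ler_wpM2l ?PB // subr_ge0 ler_nat; case: (P a).
  have /negPf -> : ~~ P a by apply: contraNN p1; exact: Pm.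
  by rewrite subrr !mul0r.
rewrite -mulr_suml; suff -> : \sum_(a < c) ((P a.+1)%:R - (P a)%:R : R) = (P c)%:R.
  by case: (P c); rewrite ?mul1r ?mul0r.
rewrite -(big_mkord xpredT (fun a => (P a.+1)%:R - (P a)%:R)) telescope_sumr //.
by rewrite P0 subr0.
Qed.

(** For the uncapped geometric law the variance is exactly the full series of a.+1 x ^ a.+1. This
    form is linear in the powers of x, as summation over the box requires; the cap costs a boundary
    term. *)
Lemma geo_var c x : 0 <= x < 1 ->
  `|\sum_(a < c) a.+1%:R * x ^+ a.+1 - (geo2 c x - geo1 c x ^+ 2)|
  <= (2 * c%:R + 2) * x ^+ c.+1 / (1 - x) ^+ 2.
Proof.
case/andP=> x0 x1; have y0 : 0 < 1 - x by rewrite subr_gt0.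
have e1 : (1 - x) * geo1 c x = x - x ^+ c.+1.
  rewrite /geo1; elim: c => [|c IH]; first by rewrite big_ord0 expr1; ring.
  by rewrite big_ord_recr /= mulrDr IH !exprS; ring.
have e2 : (1 - x) ^+ 2 * (\sum_(a < c) a%:R * x ^+ a.+1) =
    x ^+ 2 - c%:R * x ^+ c.+1 + (c%:R - 1) * x ^+ c.+2.
  elim: c {e1} => [|c IH]; first by rewrite big_ord0; ring.
  by rewrite big_ord_recr /= mulrDr IH -natr1 !exprS; ring.
have -> : \sum_(a < c) a.+1%:R * x ^+ a.+1 - (geo2 c x - geo1 c x ^+ 2) =
   geo1 c x ^+ 2 - \sum_(a < c) a%:R * x ^+ a.+1.
  suff -> : geo2 c x = \sum_(a < c) a.+1%:R * x ^+ a.+1 + \sum_(a < c) a%:R * x ^+ a.+1 by ring.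
  by rewrite -big_split; apply: eq_bigr => a _ /=; rewrite -natr1; ring.
rewrite ler_pdivlMr ?exprn_gt0 // -[X in _ * X]ger0_norm ?sqr_ge0 // -normrM.
have -> : (geo1 c x ^+ 2 - \sum_(a < c) a%:R * x ^+ a.+1) * (1 - x) ^+ 2 =
   (c%:R - (c%:R + 1) * x + x ^+ c.+1) * x ^+ c.+1.
  rewrite mulrBl [X in _ - X]mulrC e2 -exprMn [geo1 c x * _]mulrC e1 !exprS; ring.
rewrite normrM (@ger0_norm _ (x ^+ c.+1)) ?exprn_ge0 // ler_wpM2r ?exprn_ge0 //.
have p0 : 0 <= x ^+ c.+1 by rewrite exprn_ge0.
have p1 : x ^+ c.+1 <= 1 by rewrite exprn_ile1 // ltW.
have C0 : 0 <= c%:R :> R by [].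
rewrite ler_norml; nra.
Qed.
End capped_geometric.

(** * Exponential sums over the box, bounded uniformly in its size *)

Section box_sums.
Context {R : realType}.
Implicit Types (z s y : R) (n r : nat).

Definition hook n (p : box n) : nat := (p.1 + p.2).+1.

Definition box_sum n r z : R := \sum_(p : box n) (hook p)%:R ^+ r * expR (- (z * (hook p)%:R)).

Lemma expRMn_nat z k : expR (- (z * k%:R)) = expR (- z) ^+ k.
Proof. by rewrite -mulNr mulrC expRM_natl. Qed.

Lemma pow_le_exp r (t : R) : 0 <= t -> t ^+ r <= r%:R ^+ r * expR t.
Proof.
move=> t0; case: r => [|r]; first by rewrite !expr0 mul1r -expR0 ler_expR.
have -> : expR t = expR (t / r.+1%:R) ^+ r.+1.
  by rewrite -expRM_natl mulrC -mulr_natr -mulrA mulVf ?mulr1 // pnatr_eq0.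
rewrite -exprMn lerXn2r ?nnegrE ?mulr_ge0 ?expR_ge0 //.
rewrite -ler_pdivrMl ?ltr0n // mulrC.
by apply: le_trans (expR_ge1Dx _); rewrite lerDr.
Qed.

Lemma one_sub_exp_ge x : 0 <= x :> R -> x / (1 + x) <= 1 - expR (- x).
Proof.
move=> x0; have h := expR_ge1Dx x; have p := expR_gt0 (- x).
have e : expR (- x) * expR x = 1 by rewrite -expRD addNr expR0.
have x1 : 0 < 1 + x by lra.
rewrite ler_pdivrMr //; have := ler_wpM2l (ltW p) h; rewrite e; lra.
Qed.

Lemma geometric_le n y : 0 <= y < 1 -> \sum_(i < n) y ^+ i <= (1 - y)^-1.
Proof.
case/andP=> y0 y1; have h : 0 < 1 - y by lra.
rewrite -div1r ler_pdivlMr // mulrC.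
have -> : (1 - y) * \sum_(i < n) y ^+ i = 1 - y ^+ n.
  by rewrite -opprB mulNr -subrX1 opprB.
by rewrite gerBl exprn_ge0.
Qed.

Lemma box_sum_prod n (f g : nat -> R) :
  \sum_(p : box n) f p.1 * g p.2 = (\sum_(i < n) f i) * (\sum_(j < n) g j).
Proof.
rewrite mulr_suml -(pair_bigA _ (fun i j : 'I_n => f i * g j)) /=.
by apply: eq_bigr => i _; rewrite mulr_sumr.
Qed.

Lemma box_sum0_le n z : 0 < z -> box_sum n 0 z <= 4 / z ^+ 2.
Proof.
move=> z0; rewrite /box_sum; set y := expR (- z).
have y0 : 0 < y by apply: expR_gt0.
have y1 : y < 1 by rewrite -[1]expR0 ltr_expR; lra.
have -> : \sum_(p : box n) (hook p)%:R ^+ 0 * expR (- (z * (hook p)%:R)) =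
   y * (\sum_(i < n) y ^+ i) ^+ 2.
  rewrite expr2 -(box_sum_prod n (fun i => y ^+ i) (fun i => y ^+ i)) mulr_sumr.
  by apply: eq_bigr => p _; rewrite expr0 mul1r expRMn_nat /hook exprS exprD.
have g := geometric_le n (y := y); rewrite (ltW y0) y1 in g; have {}g := g isT.
have g0 : 0 <= \sum_(i < n) y ^+ i by apply: sumr_ge0 => i _; rewrite exprn_ge0 // ltW.
have h := one_sub_exp_ge (ltW z0); have h2 : 0 < 1 - y by lra.
have : (\sum_(i < n) y ^+ i) ^+ 2 <= ((1 - y)^-1) ^+ 2.
  by rewrite lerXn2r ?nnegrE // invr_ge0 ltW.
move=> k; apply: le_trans (ler_wpM2l (ltW y0) k) _.
(* Half of the exponential is set aside: z w <= 2 (1 - y) holds for all z > 0, large ones included,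
   and its square is the claim because y = w ^+ 2. *)
set w := expR (- (z / 2)); have w0 : 0 < w by apply: expR_gt0.
have yw : y = w ^+ 2 by rewrite expr2 -expRD; congr expR; field.
have w1 : w * (1 + z / 2) <= 1.
  have := expR_ge1Dx (z / 2) => q; have := ler_wpM2l (ltW w0) q.
  by rewrite -expRD addNr expR0.
have key : z * w <= 2 * (1 - y).
  have t : z / (1 + z) <= 1 - y := h.
  rewrite ler_pdivrMr in t; last lra.
  have := ltW w0; nra.
rewrite exprVn ler_pdivlMr ?exprn_gt0 // mulrAC ler_pdivrMr ?exprn_gt0 //.
have -> : y * z ^+ 2 = (z * w) ^+ 2 by rewrite yw; ring.
have -> : 4 * (1 - y) ^+ 2 = (2 * (1 - y)) ^+ 2 by ring.
by rewrite lerXn2r ?nnegrE ?mulr_ge0 ?(ltW z0) ?(ltW w0) ?(ltW h2).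
Qed.

Definition boxC r : R := r%:R ^+ r * 2 ^+ r * 16.

Lemma boxC_ge0 r : 0 <= boxC r.
Proof. by rewrite /boxC !mulr_ge0 ?exprn_ge0. Qed.

(** Half of the exponential absorbs the power of the hook length by [pow_le_exp], the other half is
    summed at z / 2. Hence the factors of [boxC], where 16 is 4 * 2 ^+ 2. *)
Lemma box_sum_le n r z : 0 < z -> box_sum n r z <= boxC r / z ^+ (r + 2).
Proof.
move=> z0; have z2 : 0 < z / 2 by rewrite divr_gt0.
apply: (@le_trans _ _ (r%:R ^+ r * 2 ^+ r / z ^+ r * box_sum n 0 (z / 2))).
  rewrite mulr_sumr; apply: ler_sum => p _; rewrite expr0 mul1r.
  set t := (hook p)%:R; have t0 : 0 <= t by [].
  have := @pow_le_exp r (z / 2 * t) (mulr_ge0 (ltW z2) t0).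
  have -> : expR (- (z * t)) = expR (- (z / 2 * t)) * expR (- (z / 2 * t)).
    by rewrite -expRD; congr expR; field.
  move=> h; rewrite mulrA ler_wpM2r ?expR_ge0 //.
  have e : expR (z / 2 * t) * expR (- (z / 2 * t)) = 1 by rewrite -expRD subrr expR0.
  have zr : z ^+ r != 0 by rewrite expf_neq0 // gt_eqF.
  have h2 : (z / 2 * t) ^+ r * expR (- (z / 2 * t)) <= r%:R ^+ r.
    by apply: le_trans (ler_wpM2r (expR_ge0 _) h) _; rewrite -[leLHS]mulrA e mulr1.
  have k0 : 0 <= 2 ^+ r / z ^+ r by rewrite divr_ge0 ?exprn_ge0 // ltW.
  have := ler_wpM2l k0 h2; rewrite mulrA -expr_div_n -exprMn.
  have -> : 2 / z * (z / 2 * t) = t by field; rewrite gt_eqF.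
  have -> : r%:R ^+ r * 2 ^+ r / z ^+ r = 2 ^+ r / z ^+ r * r%:R ^+ r by ring.
  by rewrite expr_div_n.
have c0 : 0 <= r%:R ^+ r * 2 ^+ r / z ^+ r by rewrite divr_ge0 ?mulr_ge0 ?exprn_ge0 // ltW.
apply: le_trans (ler_wpM2l c0 (box_sum0_le n z2)) _.
rewrite /boxC exprD le_eqVlt; apply/orP; left; apply/eqP; field.
by rewrite expf_neq0 gt_eqF.
Qed.

Lemma sum_inv_sqr_tail (A c : nat) :
  \sum_(A.+1 <= a < c) (a.+1%:R ^+ 2)^-1 <= (A.+1%:R)^-1 :> R.
Proof.
have [cA|Ac] := leqP c A.+1; first by rewrite big_geq // invr_ge0.
apply: (@le_trans _ _ (\sum_(A.+1 <= a < c) ((- (a.+1%:R)^-1) - (- (a%:R)^-1)))); last first.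
  by rewrite telescope_sumr ?(ltnW Ac) // opprK addrC gerBl invr_ge0.
apply: ler_sum_nat => a /andP[Aa _]; have a0 : 0 < a%:R :> R by rewrite ltr0n; lia.
rewrite -natr1 opprK -subr_ge0.
have -> : - (a%:R + 1)^-1 + a%:R^-1 - ((a%:R + 1) ^+ 2)^-1 = (a%:R * (a%:R + 1) ^+ 2)^-1 :> R.
  by field; lra.
by rewrite invr_ge0 mulr_ge0 ?sqr_ge0 // ltW.
Qed.

Lemma sum_inv_sqr (c : nat) : \sum_(a < c) (a.+1%:R ^+ 2)^-1 <= 2 :> R.
Proof.
rewrite -(big_mkord xpredT (fun a => (a.+1%:R ^+ 2)^-1)).
case: c => [|c]; first by rewrite big_geq.
rewrite big_nat_recl // expr1n invr1 [leRHS](_ : _ = 1 + 1) // lerD2l.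
case: c => [|c]; first by rewrite big_geq.
by have := sum_inv_sqr_tail 0 c.+2; rewrite big_add1 /= invr1.
Qed.

(** At z = s a.+1 the sum decays like a.+1 to the power - (r + 2). A factor a.+1 ^ q with q <= r
    therefore leaves a summable bound uniform in n, the domination used with [tannery]. *)
Lemma box_sum_term n a q r s : 0 < s -> (q <= r)%N ->
  a.+1%:R ^+ q * box_sum n r (s * a.+1%:R) <= boxC r / s ^+ (r + 2) * (a.+1%:R ^+ 2)^-1.
Proof.
move=> s0 qr; have a0 : 0 < a.+1%:R :> R by rewrite ltr0n.
apply: le_trans (ler_wpM2l (exprn_ge0 q (ltW a0)) (box_sum_le n r (mulr_gt0 s0 a0))) _.
rewrite exprMn; set t : R := a.+1%:R.
have tn : t != 0 by rewrite gt_eqF.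
have sn : s ^+ (r + 2) != 0 by rewrite expf_neq0 // gt_eqF.
have -> : t ^+ q * (boxC r / (s ^+ (r + 2) * t ^+ (r + 2))) =
   boxC r / s ^+ (r + 2) * ((t ^+ 2)^-1 * (t ^+ q / t ^+ r)).
  by rewrite [t ^+ (r + 2)]exprD; field; rewrite ?sn ?expf_neq0 ?tn // gt_eqF.
rewrite ler_wpM2l ?divr_ge0 ?boxC_ge0 ?exprn_ge0 ?(ltW s0) //.
rewrite ler_piMr ?invr_ge0 ?sqr_ge0 // ler_pdivrMr ?exprn_gt0 // mul1r.
by rewrite ler_weXn2l // ler1n.
Qed.

Lemma box_sum_series n c q r s : 0 < s -> (q <= r)%N ->
  \sum_(a < c) a.+1%:R ^+ q * box_sum n r (s * a.+1%:R) <= 2 * boxC r / s ^+ (r + 2).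
Proof.
move=> s0 qr.
apply: le_trans (ler_sum _ (fun (a : 'I_c) _ => box_sum_term n a s0 qr)) _.
rewrite -mulr_sumr; have -> : 2 * boxC r / s ^+ (r + 2) = boxC r / s ^+ (r + 2) * 2 by ring.
by rewrite ler_wpM2l ?sum_inv_sqr // divr_ge0 ?boxC_ge0 ?exprn_ge0 // ltW.
Qed.

End box_sums.

(** * Dominated passage to the limit, and zeta values *)

Section tannery.
Context {R : realType}.

Lemma tannery (f : nat -> nat -> R) (l : nat -> R) (B L : R) (c : nat -> nat) :
  (forall n a, `|f n a| <= B / a.+1%:R ^+ 2) ->
  (forall a, f n a @[n --> \oo] --> l a) ->
  (fun N => \sum_(a < N) l a) @ \oo --> L ->
  (forall A, \forall n \near \oo, (A <= c n)%N) ->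
  (fun n => \sum_(a < c n) f n a) @ \oo --> L.
Proof.
move=> fB fl lL cy; apply/cvgrPdist_le => e e0.
have B0 : 0 <= B by have := fB 0 0; rewrite expr1n divr1; apply: le_trans; exact: normr_ge0.
have e3 : 0 < e / 3 by rewrite divr_gt0.
have [A [A1 A2]] : exists A : nat, `|L - \sum_(a < A.+1) l a| <= e / 3 /\ B / A.+1%:R <= e / 3.
  have /cvgrPdist_le /(_ _ e3) [N1 _ h1] := lL.
  pose N2 := Num.truncn (B / (e / 3)).
  exists (maxn N1 N2); split; first by apply: h1; rewrite /= leqW // leq_maxl.
  rewrite ler_pdivrMr ?ltr0n // mulrC -ler_pdivrMr //.
  by apply: ltW; apply: lt_le_trans (truncnS_gt _) _; rewrite ler_nat ltnS leq_maxr.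
have head M : (fun n => \sum_(a < M) f n a) @ \oo --> \sum_(a < M) l a.
  elim: M => [|M IH].
    by under eq_fun do rewrite big_ord0; rewrite big_ord0; exact: cvg_cst.
  by under eq_fun do rewrite big_ord_recr; rewrite big_ord_recr; apply: cvgD.
have /cvgrPdist_le /(_ _ e3) hd := head A.+1.
near=> n.
have h2 : `|\sum_(a < A.+1) l a - \sum_(a < A.+1) f n a| <= e / 3 by near: n.
have h3 : (A.+1 <= c n)%N by near: n; exact: cy.
have h4 : `|\sum_(a < A.+1) f n a - \sum_(a < c n) f n a| <= e / 3.
  rewrite -!(big_mkord xpredT (fun a => f n a)) (big_cat_nat (leq0n A.+1) h3) //= opprD addNKr normrN.
  apply: le_trans A2; apply: le_trans (ler_norm_sum _ _ _) _.
  apply: (@le_trans _ _ (\sum_(A.+1 <= a < c n) B * (a.+1%:R ^+ 2)^-1)).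
    by apply: ler_sum => a _; exact: fB.
  by rewrite -mulr_sumr ler_wpM2l // sum_inv_sqr_tail.
have := ler_normD (L - \sum_(a < A.+1) l a) (\sum_(a < A.+1) l a - \sum_(a < A.+1) f n a).
have := ler_normD (L - \sum_(a < A.+1) f n a) (\sum_(a < A.+1) f n a - \sum_(a < c n) f n a).
rewrite !subrKA; lra.
Unshelve. all: by end_near. Qed.

Lemma zetaP (k : nat) : (2 <= k)%N ->
  (fun N => \sum_(a < N) (a.+1%:R ^+ k)^-1) @ \oo --> (zeta k : R).
Proof.
move=> k2.
have -> : (fun N => \sum_(a < N) (a.+1%:R ^+ k)^-1 : R) =
   (fun N => \sum_(1 <= j < N.+1) (j%:R ^+ k)^-1).
  by apply/funext => N; rewrite big_add1 /= big_mkord.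
have cv : cvgn (fun N : nat => \sum_(1 <= j < N) ((j%:R : R) ^+ k)^-1).
  have nd : nondecreasing_seq (fun N : nat => \sum_(1 <= j < N) ((j%:R : R) ^+ k)^-1).
    apply/nondecreasing_seqP => N; case: N => [|N]; first by rewrite !big_geq.
    by rewrite [leRHS]big_nat_recr //= lerDl invr_ge0 exprn_ge0.
  apply: nondecreasing_is_cvgn => //; exists 2 => _ [N _ <-].
  case: N => [|N]; first by rewrite big_geq.
  rewrite big_add1 /= big_mkord; apply: le_trans (sum_inv_sqr N); apply: ler_sum => a _.
  by rewrite lef_pV2 ?posrE ?exprn_gt0 // ler_weXn2l // ler1n.
exact: (cvg_comp _ _ (cvg_addnl 1) cv).
Qed.

End tannery.

Section power_sums.
Context {R : realType}.
Implicit Types (z y : R) (n r : nat).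

Definition psum n r y : R := \sum_(i < n) i%:R ^+ r * y ^+ i.

(** In this identity and the next two, multiplying by 1 - y is summation by parts: it lowers the
    degree, at the price of a boundary term in y ^+ n. *)
Lemma psum0E n y : (1 - y) * psum n 0 y = 1 - y ^+ n.
Proof.
elim: n => [|n IH]; first by rewrite /psum big_ord0 expr0; ring.
by rewrite /psum big_ord_recr /= mulrDr IH exprS; ring.
Qed.

Lemma psum1E n y : (1 - y) * psum n 1 y = psum n 0 y - 1 - (n%:R - 1) * y ^+ n.
Proof.
elim: n => [|n IH]; first by rewrite /psum !big_ord0 expr0; ring.
by rewrite /psum !big_ord_recr /= mulrDr IH /psum -natr1 [y ^+ n.+1]exprS; ring.
Qed.

Lemma psum2E n y : (1 - y) * psum n 2 y =
  2 * psum n 1 y - psum n 0 y + 1 - (n%:R - 1) ^+ 2 * y ^+ n.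
Proof.
elim: n => [|n IH]; first by rewrite /psum !big_ord0 expr0; ring.
by rewrite /psum !big_ord_recr /= mulrDr IH /psum -natr1 [y ^+ n.+1]exprS; ring.
Qed.

Lemma box_sum0E n z : let y := expR (- z) in box_sum n 0 z = y * psum n 0 y ^+ 2.
Proof.
move=> y; rewrite /psum expr2 -(box_sum_prod n (fun i => i%:R ^+ 0 * y ^+ i) (fun i => i%:R ^+ 0 * y ^+ i)).
rewrite mulr_sumr; apply: eq_bigr => p _.
by rewrite !expr0 !mul1r expRMn_nat /hook exprS exprD.
Qed.

Lemma box_sum1E n z : let y := expR (- z) in
  box_sum n 1 z = y * (2 * (psum n 1 y * psum n 0 y) + psum n 0 y ^+ 2).
Proof.
move=> y; have e : 2 * (psum n 1 y * psum n 0 y) + psum n 0 y ^+ 2 =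
  psum n 1 y * psum n 0 y + psum n 0 y * psum n 1 y + psum n 0 y * psum n 0 y by ring.
rewrite e /psum -!(box_sum_prod n (fun i => i%:R ^+ _ * y ^+ i) (fun i => i%:R ^+ _ * y ^+ i)).
rewrite -!big_split mulr_sumr; apply: eq_bigr => p _ /=.
by rewrite !expr0 expRMn_nat /hook -natr1 natrD [_ ^+ (p.1 + p.2).+1]exprS [_ ^+ (p.1 + p.2)]exprD -/y; ring.
Qed.

Definition dif_sqr n (p : box n) : R := (p.2%:R - p.1%:R) ^+ 2.
Definition box_dif n z : R := \sum_(p : box n) dif_sqr p * expR (- (z * (hook p)%:R)).

Lemma box_difE n z : let y := expR (- z) in
  box_dif n z = y * (2 * (psum n 2 y * psum n 0 y) - 2 * psum n 1 y ^+ 2).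
Proof.
move=> y; have e : 2 * (psum n 2 y * psum n 0 y) - 2 * psum n 1 y ^+ 2 =
  psum n 2 y * psum n 0 y + psum n 0 y * psum n 2 y + - 2 * (psum n 1 y * psum n 1 y) by ring.
rewrite e /psum -!(box_sum_prod n (fun i => i%:R ^+ _ * y ^+ i) (fun i => i%:R ^+ _ * y ^+ i)).
rewrite [X in _ + X]mulr_sumr -!big_split mulr_sumr; apply: eq_bigr => p _ /=.
by rewrite !expr0 expRMn_nat /hook /dif_sqr [_ ^+ (p.1 + p.2).+1]exprS [_ ^+ (p.1 + p.2)]exprD -/y; ring.
Qed.

Lemma dif_sqr_le n (p : box n) : dif_sqr p <= (hook p)%:R ^+ 2.
Proof.
rewrite /dif_sqr /hook -natr1 natrD.
have : 0 <= p.1%:R :> R by []. have : 0 <= p.2%:R :> R by [].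
move: (p.1%:R : R) (p.2%:R : R) => a b *; nra.
Qed.

Lemma dif_sqr_ge0 n (p : box n) : 0 <= dif_sqr p. Proof. exact: sqr_ge0. Qed.

Lemma box_dif_le n z : box_dif n z <= box_sum n 2 z.
Proof. by apply: ler_sum => p _; rewrite ler_wpM2r ?expR_ge0 ?dif_sqr_le. Qed.

Lemma box_dif_ge0 n z : 0 <= box_dif n z.
Proof. by apply: sumr_ge0 => p _; rewrite mulr_ge0 ?expR_ge0 ?dif_sqr_ge0. Qed.

Lemma box_sum_ge0 n r z : 0 <= box_sum n r z.
Proof. by apply: sumr_ge0 => p _; rewrite mulr_ge0 ?expR_ge0 ?exprn_ge0. Qed.

End power_sums.

Lemma cvg_to_eq {R : realType} (u : nat -> R) (l l' : R) : u @ \oo --> l' -> l' = l -> u @ \oo --> l.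
Proof. by move=> + <-. Qed.

Section power_sum_limits.
Context {R : realType}.
Variables z : nat -> R.
Hypothesis z0 : forall m, 0 < z m.
Hypothesis zl : z @ \oo --> (0 : R).
Hypothesis zn : (fun m => m.+1%:R ^+ 2 * expR (- (z m * m.+1%:R))) @ \oo --> (0 : R).
Let y m := expR (- z m).

Let y1 m : 0 < 1 - y m.
Proof. by rewrite subr_gt0 -[ltRHS]expR0 ltr_expR oppr_lt0. Qed.

Let g m := z m / (1 - y m).

Let g_lim : g @ \oo --> (1 : R).
Proof.
apply: (@squeeze_cvgr _ _ _ _ (fun=> 1) (fun m => 1 + z m)); last 2 first.
- exact: cvg_cst.
- by rewrite -[X in _ --> X]addr0; apply: cvgD => //; exact: cvg_cst.
near=> m; have h := one_sub_exp_ge (ltW (z0 m)); have h2 := expR_ge1Dx (- z m).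
have p := y1 m; have zm := z0 m.
rewrite /g ler_pdivlMr // mul1r; apply/andP; split; first by rewrite /y; lra.
by rewrite ler_pdivrMr // mulrC; move: h; rewrite ler_pdivrMr //; lra.
Unshelve. all: by end_near. Qed.

Let yl : y @ \oo --> (1 : R).
Proof.
have -> : (1 : R) = expR (- 0) by rewrite oppr0 expR0.
by apply: continuous_cvg; [exact: continuous_expR | exact: cvgN].
Qed.

(** This kills the boundary terms of [psum0E], [psum1E] and [psum2E], whose coefficients are at most
    quadratic in the size. *)
Let yn_bound (q : nat -> R) : (forall m, `|q m| <= m.+1%:R ^+ 2) ->
  (fun m => q m * y m ^+ m.+1) @ \oo --> (0 : R).
Proof.
move=> qb; apply/norm_cvg0P; apply: (@squeeze_cvgr _ _ _ _ (fun=> 0)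
  (fun m => m.+1%:R ^+ 2 * expR (- (z m * m.+1%:R)))) => //; last exact: cvg_cst.
near=> m; rewrite /= normr_ge0 /= normrM -expRMn_nat (ger0_norm (expR_ge0 _)).
by rewrite ler_wpM2r ?expR_ge0.
Unshelve. all: by end_near. Qed.

Lemma psum0_lim : (fun m => z m * psum m.+1 0 (y m)) @ \oo --> (1 : R).
Proof.
have -> : (fun m => z m * psum m.+1 0 (y m)) = (fun m => g m * (1 - 1 * y m ^+ m.+1)).
  apply/funext => m; rewrite mul1r -psum0E /g mulrA divfK ?gt_eqF //.
apply: (@cvg_to_eq _ _ _ (1 * (1 - 0))); last by ring.
apply: cvgM => //; apply: cvgB.
  exact: cvg_cst.
by apply: yn_bound => m; rewrite normr1 exprn_ege1 // ler1n.
Qed.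

Lemma psum1_lim : (fun m => z m ^+ 2 * psum m.+1 1 (y m)) @ \oo --> (1 : R).
Proof.
have -> : (fun m => z m ^+ 2 * psum m.+1 1 (y m)) =
    (fun m => g m * (z m * psum m.+1 0 (y m) - z m - z m * ((m.+1%:R - 1) * y m ^+ m.+1))).
  apply/funext => m; transitivity (g m * z m * ((1 - y m) * psum m.+1 1 (y m))).
    by rewrite /g; field; rewrite gt_eqF.
  by rewrite psum1E; ring.
apply: (@cvg_to_eq _ _ _ (1 * (1 - 0 - 0 * 0))); last by ring.
apply: cvgM => //; apply: cvgB; first by apply: cvgB => //; exact: psum0_lim.
apply: cvgM => //; apply: yn_bound => m.
rewrite -natr1 addrK ger0_norm // expr2; have : 0 <= m%:R :> R by []; nra.
Qed.

Lemma psum2_lim : (fun m => z m ^+ 3 * psum m.+1 2 (y m)) @ \oo --> (2 : R).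
Proof.
have -> : (fun m => z m ^+ 3 * psum m.+1 2 (y m)) =
    (fun m => g m * (2 * (z m ^+ 2 * psum m.+1 1 (y m)) - z m * (z m * psum m.+1 0 (y m))
       + z m * z m - z m * (z m * ((m.+1%:R - 1) ^+ 2 * y m ^+ m.+1)))).
  apply/funext => m; transitivity (g m * z m ^+ 2 * ((1 - y m) * psum m.+1 2 (y m))).
    by rewrite /g; field; rewrite gt_eqF.
  by rewrite psum2E; ring.
apply: (@cvg_to_eq _ _ _ (1 * (2 * 1 - 0 * 1 + 0 * 0 - 0 * (0 * 0)))); last by ring.
apply: cvgM => //; apply: cvgB.
  apply: cvgD; last exact: cvgM.
  apply: cvgB; apply: cvgM => //; [exact: cvg_cst | exact: psum1_lim | exact: psum0_lim].
do 2!apply: cvgM => //; apply: yn_bound => m.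
by rewrite -natr1 addrK ger0_norm ?sqr_ge0 // lerXn2r ?nnegrE ?addr_ge0 // lerDl.
Qed.

(** The limits 1, 2, 2 here and in the next two lemmas are the integrals over the quadrant of 1, u +
    v and (u - v)^2 against exp (- u - v). *)
Lemma box_sum0_lim : (fun m => z m ^+ 2 * box_sum m.+1 0 (z m)) @ \oo --> (1 : R).
Proof.
have -> : (fun m => z m ^+ 2 * box_sum m.+1 0 (z m)) =
   (fun m => y m * ((z m * psum m.+1 0 (y m)) * (z m * psum m.+1 0 (y m)))).
  by apply/funext => m; rewrite box_sum0E /= -/(y m); ring.
apply: (@cvg_to_eq _ _ _ (1 * (1 * 1))); last by ring.
by apply: cvgM => //; apply: cvgM; exact: psum0_lim.
Qed.

Lemma box_sum1_lim : (fun m => z m ^+ 3 * box_sum m.+1 1 (z m)) @ \oo --> (2 : R).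
Proof.
have -> : (fun m => z m ^+ 3 * box_sum m.+1 1 (z m)) =
   (fun m => y m * (2 * ((z m ^+ 2 * psum m.+1 1 (y m)) * (z m * psum m.+1 0 (y m))) +
     z m * ((z m * psum m.+1 0 (y m)) * (z m * psum m.+1 0 (y m))))).
  by apply/funext => m; rewrite box_sum1E /= -/(y m); ring.
apply: (@cvg_to_eq _ _ _ (1 * (2 * (1 * 1) + 0 * (1 * 1)))); last by ring.
apply: cvgM => //; apply: cvgD; apply: cvgM => //; first exact: cvg_cst.
  by apply: cvgM; [exact: psum1_lim | exact: psum0_lim].
by apply: cvgM; exact: psum0_lim.
Qed.

Lemma box_dif_lim : (fun m => z m ^+ 4 * box_dif m.+1 (z m)) @ \oo --> (2 : R).
Proof.
have -> : (fun m => z m ^+ 4 * box_dif m.+1 (z m)) =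
   (fun m => y m * (2 * ((z m ^+ 3 * psum m.+1 2 (y m)) * (z m * psum m.+1 0 (y m))) -
     2 * ((z m ^+ 2 * psum m.+1 1 (y m)) * (z m ^+ 2 * psum m.+1 1 (y m))))).
  by apply/funext => m; rewrite box_difE /= -/(y m); ring.
apply: (@cvg_to_eq _ _ _ (1 * (2 * (2 * 1) - 2 * (1 * 1)))); last by ring.
apply: cvgM => //; apply: cvgB; apply: cvgM; try exact: cvg_cst.
  by apply: cvgM; [exact: psum2_lim | exact: psum0_lim].
by apply: cvgM; exact: psum1_lim.
Qed.

End power_sum_limits.

Section omega.
Context {R : realType}.

(* With n = m.+1, all the scales below (n ^ (1/3), n ^ (2/3), the cut-offs) are integral
   powers of n ^ (1/12). *)
Definition om (m : nat) : R := m.+1%:R `^ (12%:R)^-1.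

Lemma om12 m : om m ^+ 12 = m.+1%:R.
Proof. by rewrite -powR_mulrn ?powR_ge0 // /om -powRrM mulVf ?pnatr_eq0 // powRr1. Qed.

Lemma om_ge1 m : 1 <= om m.
Proof. by rewrite /om -[leLHS](powRr0 m.+1%:R) ler_powR ?invr_ge0 // ler1n. Qed.

Lemma om_gt0 m : 0 < om m. Proof. by apply: lt_le_trans (om_ge1 m). Qed.

Lemma om_neq0 m : om m != 0. Proof. by rewrite gt_eqF ?om_gt0. Qed.

Lemma om_inv_cvg : (fun m => (om m)^-1) @ \oo --> (0 : R).
Proof.
apply/cvgrPdist_le => e e0.
near=> m; rewrite sub0r normrN ger0_norm ?invr_ge0 ?(ltW (om_gt0 m)) //.
have e1 : 0 < e^-1 by rewrite invr_gt0.
rewrite -[leRHS]invrK lef_pV2 ?posrE ?om_gt0 //.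
rewrite -(@ler_pXn2r _ 12) ?nnegrE ?(ltW e1) ?(ltW (om_gt0 m)) // om12.
apply: ltW; apply: lt_le_trans (truncnS_gt _) _; rewrite ler_nat ltnS.
near: m; exact: nbhs_infty_ge.
Unshelve. all: by end_near. Qed.

Lemma om_exp_cvg k (e : R) : 0 < e -> (fun m => om m ^+ k * expR (- (e * om m))) @ \oo --> (0 : R).
Proof.
move=> e0; set C : R := k.+1%:R ^+ k.+1 / e ^+ k.+1.
have hC : (fun m => C * (om m)^-1) @ \oo --> (0 : R).
  apply: (@cvg_to_eq R _ _ (C * 0)); last by rewrite mulr0.
  by apply: cvgM; [exact: cvg_cst | exact: om_inv_cvg].
apply: (@squeeze_cvgr _ _ _ _ (fun=> 0) (fun m => C * (om m)^-1)) => //; last exact: cvg_cst.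
near=> m; rewrite mulr_ge0 ?exprn_ge0 ?expR_ge0 ?(ltW (om_gt0 m)) //=.
have h := @pow_le_exp R k.+1 (e * om m) (mulr_ge0 (ltW e0) (ltW (om_gt0 m))).
have E : expR (e * om m) * expR (- (e * om m)) = 1 by rewrite -expRD subrr expR0.
have h2 := ler_wpM2r (expR_ge0 (- (e * om m))) h.
rewrite -[leRHS]mulrA E mulr1 exprMn in h2.
rewrite ler_pdivlMr ?om_gt0 // ler_pdivlMr ?exprn_gt0 //; apply: le_trans h2.
by rewrite [om m ^+ k.+1]exprSr le_eqVlt; apply/orP; left; apply/eqP; ring.
Unshelve. all: by end_near. Qed.

End omega.

(** * Limits of the means for a tilt of order n^(-1/3) *)

Section scaling.
Context {R : realType}.
Variables (kap : nat -> R) (kap0 : R).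
Hypothesis kap_gt0 : forall m, 0 < kap m.
Hypothesis kap0_gt0 : 0 < kap0.
Hypothesis kap_lim : kap @ \oo --> kap0.
Local Notation om := (@om R).

(** With n = m.+1 = om ^+ 12 the tilt is kap n^(-1/3). The coefficient varies with m because the
    median condition determines it only in the limit. *)
Definition scl (m : nat) : R := kap m / om m ^+ 4.

Lemma scl_gt0 m : 0 < scl m.
Proof. by rewrite divr_gt0 ?exprn_gt0 ?om_gt0. Qed.

Lemma om_pow_inv_cvg k : (fun m => (om m ^+ k.+1)^-1) @ \oo --> (0 : R).
Proof.
elim: k => [|k IH]; first exact: om_inv_cvg.
have -> : (fun m => (om m ^+ k.+2)^-1) = (fun m => (om m)^-1 * (om m ^+ k.+1)^-1).
  by apply/funext => m; rewrite exprS invfM.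
by apply: (@cvg_to_eq R _ _ (0 * 0)); [apply: cvgM => //; exact: om_inv_cvg | rewrite mulr0].
Qed.

Lemma scl_cvg0 : scl @ \oo --> (0 : R).
Proof.
apply: (@cvg_to_eq R _ _ (kap0 * 0)); last by rewrite mulr0.
by apply: cvgM => //; exact: om_pow_inv_cvg.
Qed.

Lemma kap_half : \forall m \near \oo, kap0 / 2 <= kap m.
Proof.
have e0 : 0 < kap0 / 2 by rewrite divr_gt0.
move/cvgrPdist_le/(_ _ e0): kap_lim; apply: filterS => m.
rewrite ler_norml; lra.
Qed.

Lemma scl_om k m : scl m ^+ k * om m ^+ (4 * k) = kap m ^+ k.
Proof. by rewrite exprM -exprMn /scl divfK // expf_neq0 // om_neq0. Qed.

(** The exponent is at least of order n^(2/3) = om ^+ 8. One power of om is kept, enough to beat all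
    powers of n. *)
Lemma scl_exp_le : \forall m \near \oo, forall a, expR (- (scl m * a.+1%:R * m.+1%:R)) <= expR (- (kap0 / 2 * om m)).
Proof.
apply: filterS kap_half => m km a; rewrite ler_expR lerN2 -(om12 m).
have -> : scl m * a.+1%:R * om m ^+ 12 = a.+1%:R * (scl m ^+ 1 * om m ^+ (4 * 1)) * (om m ^+ 7 * om m).
  by rewrite expr1 muln1; ring.
rewrite scl_om expr1 mulrA; have o1 := om_ge1 (R := R) m.
rewrite ler_wpM2r ?(ltW (om_gt0 m)) //.
have k0 := kap_gt0 m; apply: le_trans km _; rewrite -[leLHS]mul1r -[leLHS]mulr1.
have a1 : 1 <= a.+1%:R :> R by rewrite ler1n.
have o7 : 1 <= om m ^+ 7 by rewrite exprn_ege1.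
by rewrite ler_pM ?mul1r ?(ltW k0) // ler_peMl // ltW.
Qed.

Lemma scl_poly_exp k : (fun m => om m ^+ k * expR (- (scl m * m.+1%:R))) @ \oo --> (0 : R).
Proof.
have e0 : 0 < kap0 / 2 by rewrite divr_gt0.
apply: (@squeeze_cvgr _ _ _ _ (fun=> 0) (fun m => om m ^+ k * expR (- (kap0 / 2 * om m)))).
- have := scl_exp_le; apply: filterS => m /(_ 0); rewrite mulr1 => h.
  rewrite mulr_ge0 ?exprn_ge0 ?expR_ge0 ?(ltW (om_gt0 m)) //=.
  by rewrite ler_wpM2l ?exprn_ge0 ?(ltW (om_gt0 m)).
- exact: cvg_cst.
- exact: om_exp_cvg.
Qed.

Let z a m := scl m * a.+1%:R.
Let z_gt0 a m : 0 < z a m. Proof. by rewrite mulr_gt0 ?scl_gt0. Qed.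
Let z_cvg a : z a @ \oo --> (0 : R).
Proof.
apply: (@cvg_to_eq R _ _ (0 * a.+1%:R)); last by rewrite mul0r.
by apply: cvgM; [exact: scl_cvg0 | exact: cvg_cst].
Qed.
Let z_exp a : (fun m => m.+1%:R ^+ 2 * expR (- (z a m * m.+1%:R))) @ \oo --> (0 : R).
Proof.
have e0 : 0 < kap0 / 2 by rewrite divr_gt0.
apply: (@squeeze_cvgr _ _ _ _ (fun=> 0) (fun m => om m ^+ 24 * expR (- (kap0 / 2 * om m)))).
- have := scl_exp_le; apply: filterS => m /(_ a) h.
  rewrite mulr_ge0 ?exprn_ge0 ?expR_ge0 //= -(om12 m) -exprM.
  by rewrite ler_wpM2l ?exprn_ge0 ?(ltW (om_gt0 m)) // om12.
- exact: cvg_cst.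
- exact: om_exp_cvg.
Qed.

Let size_cvg A : \forall m \near \oo, (A <= m.+2)%N.
Proof. by near=> m; apply: leqW; apply: leqW; near: m; exact: nbhs_infty_ge. Unshelve. all: by end_near. Qed.

Let term_bound r q n s a (X : R) : 0 < s -> (q <= r)%N ->
  0 <= X <= a.+1%:R ^+ q * box_sum n r (s * a.+1%:R) ->
  `|s ^+ (r + 2) * X| <= boxC r / a.+1%:R ^+ 2.
Proof.
move=> s0 qr /andP[X0 X1]; have sr : 0 < s ^+ (r + 2) by rewrite exprn_gt0.
rewrite ger0_norm ?(mulr_ge0 (ltW sr)) // mulrC -ler_pdivlMr //.
apply: le_trans X1 (le_trans (box_sum_term _ _ s0 qr) _).
by rewrite mulrAC.
Qed.

(** Multiplied by s ^ (r + 2), the a-th term tends to l a under the domination of [box_sum_term].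
    Dividing by kap ^ (r + 2) then trades the scale s for the scale om. *)
Let mean_lim r q (t : nat -> nat -> R) (l : nat -> R) (L : R) :
  (q <= r)%N ->
  (forall a m, 0 <= t a m <= a.+1%:R ^+ q * box_sum m.+1 r (z a m)) ->
  (forall a, (fun m => scl m ^+ (r + 2) * t a m) @ \oo --> l a) ->
  (fun N => \sum_(a < N) l a) @ \oo --> L ->
  (fun m => (\sum_(a < m.+2) t a m) / om m ^+ (4 * (r + 2))) @ \oo --> L / kap0 ^+ (r + 2).
Proof.
move=> qr tb tl lL.
have h := @tannery R (fun m a => scl m ^+ (r + 2) * t a m) l (boxC r) L (fun m => m.+2)
  (fun m a => term_bound (scl_gt0 m) qr (tb a m)) tl lL size_cvg.
have -> : (fun m => (\sum_(a < m.+2) t a m) / om m ^+ (4 * (r + 2))) =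
   (fun m => (\sum_(a < m.+2) scl m ^+ (r + 2) * t a m) * (kap m ^+ (r + 2))^-1).
  apply/funext => m; rewrite -mulr_sumr -scl_om; field.
  by rewrite !expf_neq0 ?om_neq0 // gt_eqF ?scl_gt0.
apply: cvgM => //; apply: cvgV; first by rewrite expf_neq0 // gt_eqF.
elim: (r + 2)%N => [|k IH]; first by under eq_fun do rewrite expr0; exact: cvg_cst.
by under eq_fun do rewrite exprS; rewrite exprS; apply: cvgM.
Qed.

Let rescale a k (X : nat -> R) (l : R) : (fun m => z a m ^+ k * X m) @ \oo --> l ->
  (fun m => scl m ^+ k * X m) @ \oo --> l * (a.+1%:R ^+ k)^-1.
Proof.
have -> : (fun m => scl m ^+ k * X m) = (fun m => z a m ^+ k * X m * (a.+1%:R ^+ k)^-1).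
  by apply/funext => m; rewrite /z [(scl m * _) ^+ k]exprMn mulrAC mulfK // expf_neq0 // pnatr_eq0.
by move=> h; apply: cvgM => //; exact: cvg_cst.
Qed.

Lemma mean0_lim : (fun m => (\sum_(a < m.+2) box_sum m.+1 0 (scl m * a.+1%:R)) / om m ^+ 8) @ \oo
   --> zeta 2 / kap0 ^+ 2.
Proof.
apply: (@mean_lim 0 0 (fun a m => box_sum m.+1 0 (z a m)) (fun a => 1 * (a.+1%:R ^+ 2)^-1)) => //.
- by move=> a m; rewrite box_sum_ge0 expr0 mul1r /=.
- by move=> a; apply: rescale; apply: box_sum0_lim.
- by under eq_fun do under eq_bigr do rewrite mul1r; exact: zetaP.
Qed.

Lemma mean1_lim : (fun m => (\sum_(a < m.+2) box_sum m.+1 1 (scl m * a.+1%:R)) / om m ^+ 12) @ \oo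
   --> 2 * zeta 3 / kap0 ^+ 3.
Proof.
apply: (@mean_lim 1 0 (fun a m => box_sum m.+1 1 (z a m)) (fun a => 2 * (a.+1%:R ^+ 3)^-1)) => //.
- by move=> a m; rewrite box_sum_ge0 expr0 mul1r /=.
- by move=> a; apply: rescale; apply: box_sum1_lim.
- under eq_fun do rewrite -mulr_sumr.
  by apply: cvgM; [exact: cvg_cst | exact: zetaP].
Qed.

(** The weight a.+1 lowers the exponent 4 to 3, so 2 zeta(3) occurs here as in [mean1_lim]; for kap0
    = kappa the limit collapses to 1 / kappa. *)
Lemma mean2_lim : (fun m => (\sum_(a < m.+2) a.+1%:R * box_dif m.+1 (scl m * a.+1%:R)) / om m ^+ 16) @ \oo
   --> 2 * zeta 3 / kap0 ^+ 4.
Proof.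
apply: (@mean_lim 2 1 (fun a m => a.+1%:R * box_dif m.+1 (z a m)) (fun a => 2 * (a.+1%:R ^+ 3)^-1)) => //.
- by move=> a m; rewrite expr1 mulr_ge0 ?box_dif_ge0 // ler_wpM2l ?box_dif_le.
- move=> a; have h : (fun m => z a m ^+ 4 * box_dif m.+1 (z a m)) @ \oo --> (2 : R).
    by apply: box_dif_lim.
  have hc : (fun _ : nat => a.+1%:R : R) @ \oo --> (a.+1%:R : R) by exact: cvg_cst.
  have {}h := cvgM hc (rescale h).
  have a0 : a.+1%:R != 0 :> R by rewrite pnatr_eq0.
  apply: (@cvg_to_eq R _ _ (a.+1%:R * (2 * (a.+1%:R ^+ 4)^-1))); last by field.
  have -> : (fun m => scl m ^+ (2 + 2) * (a.+1%:R * box_dif m.+1 (z a m))) =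
     (fun m => a.+1%:R * (scl m ^+ 4 * box_dif m.+1 (z a m))).
    by apply/funext => m; ring.
  exact: h.
- under eq_fun do rewrite -mulr_sumr.
  by apply: cvgM; [exact: cvg_cst | exact: zetaP].
Qed.

End scaling.

(** * The Boltzmann measure *)

Section model.
Context {R : realType} (m : nat).
Local Notation T := (box m.+1).
(* The cap m.+2 exceeds m.+1, so it does not affect configurations with hook_mass <= m.+1. *)
Local Notation conf := {ffun T -> 'I_m.+3}.
Implicit Types (s l t L : R) (p : T) (N : conf).

Definition wgt s p (k : 'I_m.+3) : R := capgeo m.+2 (expR (- (s * (hook p)%:R))) k.

Definition flipT p : T := (p.2, p.1).

Lemma flipTK : involutive flipT. Proof. by case. Qed.

Lemma hook_flip p : hook (flipT p) = hook p.
Proof. by rewrite /hook addnC. Qed.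

Lemma dif_sqr_flip p : dif_sqr (flipT p) = dif_sqr p :> R.
Proof. by rewrite /dif_sqr /= -sqrrN opprB. Qed.

(** The random time V. It depends only on the unordered pairs of mirror entries, hence is unchanged
    by exchanges. *)
Definition spread N : R :=
  \sum_(p : T | (p.1 < p.2)%N) dif_sqr p * ((N p)%:R - (N (flipT p))%:R) ^+ 2.

(** Truncation, later at L = om ^+ 5 = n^(5/12). This exceeds the typical size 1 / s by a factor of
    order om, so the complement is exponentially small in om. *)
Definition bounded_by L N : bool := [forall p, (hook p)%:R * (N p)%:R <= L].

Section positive.
Variable s : R.
Hypothesis s_gt0 : 0 < s.
Local Notation Ex := (Ex (wgt s)).

Let x p := expR (- (s * (hook p)%:R)).

Let x_ge0 p : 0 <= x p. Proof. exact: expR_ge0. Qed.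

Let x_lt1 p : x p < 1.
Proof. by rewrite /x -[ltRHS]expR0 ltr_expR oppr_lt0 mulr_gt0. Qed.

Lemma wgt_ge0 p k : 0 <= wgt s p k.
Proof. by apply: capgeo_ge0; [exact: x_ge0 | exact: ltW (x_lt1 p)]. Qed.

Lemma wgt_sum p : \sum_k wgt s p k = 1.
Proof. exact: capgeo_sum1. Qed.

Let Ex_le F G := @le_Ex R _ _ (wgt s) wgt_ge0 F G.

Lemma x_pow p a : x p ^+ a.+1 = expR (- (s * a.+1%:R * (hook p)%:R)).
Proof. by rewrite -expRM_natl; congr expR; ring. Qed.

(** Expanding moments in powers of x p and summing over the box first turns every mean into a series
    in a of box sums at s * a.+1. *)
Lemma box_exchange (g : T -> R) (d : nat -> R) c :
  \sum_p g p * (\sum_(a < c) d a * x p ^+ a.+1) =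
  \sum_(a < c) d a * \sum_p g p * expR (- (s * a.+1%:R * (hook p)%:R)).
Proof.
under eq_bigr do rewrite mulr_sumr; rewrite exchange_big /=; apply: eq_bigr => a _.
by rewrite mulr_sumr; apply: eq_bigr => p _; rewrite x_pow; ring.
Qed.

Lemma Ex_value p : Ex (fun N => (N p)%:R) = geo1 m.+2 (x p).
Proof. by rewrite (Ex_marginal wgt_sum p (fun k : 'I_m.+3 => k%:R)) capgeo_mean. Qed.

Lemma Ex_value_sqr p : Ex (fun N => (N p)%:R ^+ 2) = geo2 m.+2 (x p).
Proof. by rewrite (Ex_marginal wgt_sum p (fun k : 'I_m.+3 => k%:R ^+ 2)) capgeo_sqr. Qed.

Lemma Ex_mass : Ex (fun N => (mass N)%:R) = \sum_(a < m.+2) box_sum m.+1 0 (s * a.+1%:R).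
Proof.
under eq_Ex do rewrite /mass natr_sum; rewrite Ex_sum.
transitivity (\sum_p 1 * \sum_(a < m.+2) 1 * x p ^+ a.+1).
  by apply: eq_bigr => p _; rewrite Ex_value mul1r; apply: eq_bigr => a _; rewrite mul1r.
rewrite (box_exchange (fun=> 1) (fun=> 1)); apply: eq_bigr => a _; rewrite mul1r.
by apply: eq_bigr => p _; rewrite expr0.
Qed.

Lemma Ex_hook_mass : Ex (fun N => (hook_mass N)%:R) = \sum_(a < m.+2) box_sum m.+1 1 (s * a.+1%:R).
Proof.
under eq_Ex do rewrite /hook_mass natr_sum; rewrite Ex_sum.
transitivity (\sum_p (hook p)%:R * \sum_(a < m.+2) 1 * x p ^+ a.+1).
  apply: eq_bigr => p _; under eq_Ex do rewrite natrM; rewrite ExZ Ex_value; congr (_ * _).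
  by apply: eq_bigr => a _; rewrite mul1r.
rewrite (box_exchange _ (fun=> 1)); apply: eq_bigr => a _; rewrite mul1r.
by apply: eq_bigr => p _; rewrite expr1.
Qed.

Lemma geo2_le p : geo2 m.+2 (x p) <= \sum_(a < m.+2) 2 * a.+1%:R * x p ^+ a.+1.
Proof.
apply: ler_sum => a _; rewrite ler_wpM2r ?exprn_ge0 // -natr1; lra.
Qed.

Lemma second_moments r q (F : T -> conf -> R) C : 0 <= C -> (q <= r.+1)%N ->
  (forall p, Ex (F p) <= (hook p)%:R ^+ r * \sum_(a < m.+2) (C * a.+1%:R ^+ q) * x p ^+ a.+1) ->
  \sum_p Ex (F p) <= C * (2 * boxC r.+1 / s ^+ (r.+1 + 2)).
Proof.
move=> C0 qr hF; apply: le_trans (ler_sum _ (fun p _ => hF p)) _.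
rewrite (box_exchange (fun p => (hook p)%:R ^+ r) (fun a => C * a.+1%:R ^+ q)).
have := box_sum_series m.+1 m.+2 s_gt0 qr => h; apply: le_trans (ler_wpM2l C0 h).
rewrite mulr_sumr; apply: ler_sum => a _; rewrite mulrA.
rewrite ler_wpM2l ?mulr_ge0 ?exprn_ge0 //; apply: ler_sum => p _.
rewrite ler_wpM2r ?expR_ge0 // ler_weXn2l // /hook ler1n //.
Qed.

Lemma second_moment_mass :
  \sum_p Ex (fun N => (N p)%:R ^+ 2) <= 2 * (2 * boxC 1 / s ^+ 3).
Proof.
apply: (second_moments (r := 0) (q := 1)) => // p.
by rewrite Ex_value_sqr expr0 mul1r; under eq_bigr do rewrite expr1; exact: geo2_le.
Qed.

Lemma second_moment_hook :
  \sum_p Ex (fun N => ((hook p)%:R * (N p)%:R) ^+ 2) <= 2 * (2 * boxC 3 / s ^+ 5).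
Proof.
apply: (second_moments (r := 2) (q := 1)) => // p.
under eq_Ex do rewrite exprMn; rewrite ExZ Ex_value_sqr ler_wpM2l ?exprn_ge0 //.
by under eq_bigr do rewrite expr1; exact: geo2_le.
Qed.

(** For a, b >= 0, (a - b)^4 <= a^4 + b^4. The two terms are placed at p and at its mirror cell,
    which bounds the sum above the diagonal by one over the box. *)
Lemma second_moment_spread :
  \sum_(p : T | (p.1 < p.2)%N)
    Ex (fun N => (dif_sqr p * ((N p)%:R - (N (flipT p))%:R) ^+ 2) ^+ 2)
  <= 4 * (2 * boxC 5 / s ^+ 7).
Proof.
pose F p N : R := (hook p)%:R ^+ 4 * (N p)%:R ^+ 4.
have FF : \sum_p Ex (F p) <= 4 * (2 * boxC 5 / s ^+ 7).
  apply: (second_moments (r := 4) (q := 3)) => // p.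
  rewrite ExZ ler_wpM2l ?exprn_ge0 //.
  by rewrite (Ex_marginal wgt_sum p (fun k : 'I_m.+3 => k%:R ^+ 4)) capgeo_pow4.
apply: le_trans FF; rewrite [leRHS](bigID (fun p : T => (p.1 < p.2)%N)) /=.
have : \sum_(p : T | (p.1 < p.2)%N) Ex (F (flipT p)) <= \sum_(p : T | ~~ (p.1 < p.2)%N) Ex (F p).
  rewrite [leRHS](reindex_inj (inv_inj flipTK)) /=.
  rewrite [leRHS](bigID (fun p : T => (p.1 < p.2)%N)) /= -[leLHS]addr0 lerD //.
    rewrite le_eqVlt; apply/orP; left; apply/eqP; apply: eq_bigl => p.
    by rewrite -leqNgt; case: ltngtP.
  apply: sumr_ge0 => p _; apply: Ex_ge0 => [|N]; first exact: wgt_ge0.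
  by rewrite mulr_ge0 ?exprn_ge0.
move=> h; apply: le_trans (lerD (lexx _) h); rewrite -big_split /=; apply: ler_sum => p _.
rewrite -ExD; apply: Ex_le => N; rewrite /F hook_flip -mulrDr exprMn.
have d0 := dif_sqr_ge0 (R := R) p; have d1 := dif_sqr_le (R := R) p.
apply: ler_pM; rewrite ?sqr_ge0 //.
  by rewrite (exprM _ 2 2) lerXn2r ?nnegrE ?sqr_ge0.
move: ((N p)%:R : R) ((N (flipT p))%:R : R) (ler0n R (N p)) (ler0n R (N (flipT p))) => a b a0 b0.
have ab : 0 <= a * b by rewrite mulr_ge0.
rewrite -exprM.
have -> : (a - b) ^+ (2 * 2) = a ^+ 4 + b ^+ 4 - a * b * (4 * (a - b) ^+ 2 + 2 * (a * b)) by ring.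
rewrite gerBl; apply: mulr_ge0 => //; apply: addr_ge0; apply: mulr_ge0 => //; exact: sqr_ge0.
Qed.

Lemma Ex_spread : `|Ex spread - \sum_(a < m.+2) a.+1%:R * box_dif m.+1 (s * a.+1%:R)| <=
  m.+1%:R ^+ 4 * ((2 * m.+2%:R + 2) * expR (- (s * m.+1%:R)) / (1 - expR (- s)) ^+ 2).
Proof.
(* Mirror entries are independent with the same law, so their mean squared difference is twice the
   variance; one copy goes to p and one to [flipT p]. Diagonal cells have [dif_sqr] 0, so the sum
   runs over the whole box. *)
have e1 : Ex spread = \sum_p dif_sqr p * (geo2 m.+2 (x p) - geo1 m.+2 (x p) ^+ 2).
  rewrite Ex_sum.
  have e p : (p.1 < p.2)%N -> Ex (fun N => dif_sqr p * ((N p)%:R - (N (flipT p))%:R) ^+ 2) =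
     dif_sqr p * (geo2 m.+2 (x p) - geo1 m.+2 (x p) ^+ 2)
      + dif_sqr (flipT p) * (geo2 m.+2 (x (flipT p)) - geo1 m.+2 (x (flipT p)) ^+ 2).
    move=> pp; have xf : x (flipT p) = x p by rewrite /x hook_flip.
    rewrite ExZ dif_sqr_flip xf.
    have -> : Ex (fun N => ((N p)%:R - (N (flipT p))%:R) ^+ 2) =
       Ex (fun N => (N p)%:R ^+ 2) + Ex (fun N => (N (flipT p))%:R ^+ 2)
        + (-2) * Ex (fun N => (N p)%:R * (N (flipT p))%:R).
      by rewrite -ExZ -!ExD; apply: eq_Ex => N; ring.
    have ind : Ex (fun N => (N p)%:R * (N (flipT p))%:R) = geo1 m.+2 (x p) * geo1 m.+2 (x p).
      rewrite (@Ex_indep _ _ _ _ wgt_sum [set p]) ?Ex_value ?xf //.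
        by move=> N N' h; rewrite h ?inE.
      move=> N N' h; rewrite h // !inE; apply: contraTN pp => /eqP e.
      by rewrite -leqNgt; have := congr1 fst e; rewrite /= => ->.
    by rewrite ind !Ex_value_sqr xf; ring.
  rewrite (eq_bigr _ e) big_split /=.
  rewrite [RHS](bigID (fun p : T => (p.1 < p.2)%N)) /=; congr (_ + _).
  rewrite [RHS](reindex_inj (inv_inj flipTK)) /=.
  rewrite [RHS](bigID (fun p : T => (p.1 < p.2)%N)) /= [X in _ = _ + X]big1 ?addr0.
    by apply: eq_bigl => p; rewrite -leqNgt; case: ltngtP.
  move=> p; rewrite -!leqNgt => /andP[p1 p2]; have e12 : p.1 = p.2 :> nat by apply/eqP; rewrite eqn_leq p1 p2.
  by rewrite /dif_sqr /= e12 subrr expr0n mul0r.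
have e2 : \sum_(a < m.+2) a.+1%:R * box_dif m.+1 (s * a.+1%:R) =
   \sum_p dif_sqr p * (\sum_(a < m.+2) a.+1%:R * x p ^+ a.+1).
  by rewrite (box_exchange _ (fun a => a.+1%:R)).
rewrite e1 e2 -sumrB.
apply: le_trans (ler_norm_sum _ _ _) _.
have -> : m.+1%:R ^+ 4 = \sum_(p : T) m.+1%:R ^+ 2 :> R.
  by rewrite sumr_const card_prod card_ord -(mulr_natr _ (m.+1 * m.+1)) natrM; ring.
rewrite mulr_suml; apply: ler_sum => p _; rewrite -mulrBr normrM (ger0_norm (dif_sqr_ge0 _)).
apply: ler_pM => //; first exact: dif_sqr_ge0.
  rewrite /dif_sqr -(real_normK (num_real (p.2%:R - p.1%:R))) lerXn2r ?nnegrE //.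
  have a1 : p.1%:R <= m.+1%:R :> R by rewrite ler_nat ltnW.
  have a2 : p.2%:R <= m.+1%:R :> R by rewrite ler_nat ltnW.
  have : 0 <= p.1%:R :> R by []. have : 0 <= p.2%:R :> R by [].
  rewrite ler_norml; lra.
rewrite distrC; apply: le_trans (geo_var _ _) _; first by rewrite x_ge0 x_lt1.
have xs : x p <= expR (- s).
  rewrite /x ler_expR lerN2 ler_peMr ?(ltW s_gt0) // /hook ler1n //.
have y0 : 0 < 1 - expR (- s) by rewrite subr_gt0 -[ltRHS]expR0 ltr_expR oppr_lt0.
have x0 : 0 < 1 - x p by rewrite subr_gt0 x_lt1.
apply: ler_pM.
- by rewrite mulr_ge0 ?exprn_ge0 ?addr_ge0 ?mulr_ge0.
- by rewrite invr_ge0 sqr_ge0.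
- rewrite ler_wpM2l ?addr_ge0 ?mulr_ge0 // x_pow ler_expR lerN2 -mulrA ler_wpM2l ?(ltW s_gt0) //.
  rewrite -natrM ler_nat; apply: leq_trans (leq_pmulr _ _) => //; lia.
- by rewrite lef_pV2 ?posrE ?exprn_gt0 // lerXn2r ?nnegrE ?(ltW y0) ?(ltW x0) // lerB.
Qed.

Lemma tail_value p L : 0 <= L -> Ex (fun N => (L < (hook p)%:R * (N p)%:R)%R%:R) <= expR (- (s * L)).
Proof.
move=> L0; rewrite (Ex_marginal wgt_sum p (fun k : 'I_m.+3 => (L < (hook p)%:R * k%:R)%R%:R)).
apply: (@capgeo_tail _ m.+2 _ _ (fun a : nat => (L < (hook p)%:R * a%:R)%R)).
- exact: x_ge0.
- exact: ltW (x_lt1 p).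
- by rewrite mulr0 ltNge L0.
- by move=> a h; apply: lt_le_trans h _; rewrite ler_wpM2l // ler_nat.
- move=> a h; rewrite -expRM_natl ler_expR mulrN lerN2.
  by rewrite mulrCA ler_wpM2l ?(ltW s_gt0) // mulrC ltW.
- exact: expR_ge0.
Qed.

Lemma tail_bounded L : 0 <= L -> Ex (fun N => (~~ bounded_by L N)%:R) <= m.+1%:R ^+ 2 * expR (- (s * L)).
Proof.
move=> L0; apply: (@le_trans _ _ (\sum_(p : T) Ex (fun N => (L < (hook p)%:R * (N p)%:R)%R%:R))).
  rewrite -Ex_sum; apply: Ex_le => N; rewrite /bounded_by negb_forall.
  case: existsP => [[p]|_]; last by apply: sumr_ge0.
  by rewrite -ltNge (bigD1 p) //= => ->; rewrite lerDl sumr_ge0.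
apply: le_trans (ler_sum _ (fun p _ => tail_value p L0)) _.
by rewrite sumr_const card_prod card_ord -(mulr_natl _ (m.+1 * m.+1)) natrM expr2.
Qed.

Section chernoff_family.
Variables (P : pred T) (D : T -> {set T}) (Y : T -> conf -> R) (l L : R).
Hypothesis l_gt0 : 0 < l.
Hypothesis dis : forall p q, P p -> P q -> p != q -> [disjoint D p & D q]%B.
Hypothesis dY : forall p, depends_on (D p) (Y p).
Hypothesis Y_ge0 : forall p N, 0 <= Y p N.
Hypothesis Y_small : forall p N, P p -> bounded_by L N -> l * Y p N <= 2^-1.

Lemma chernoff_two_sided t B : \sum_(p | P p) Ex (fun N => Y p N ^+ 2) <= B ->
  Ex (fun N => (bounded_by L N &&
     (t <= `|\sum_(p | P p) Y p N - Ex (fun N => \sum_(p | P p) Y p N)|))%:R) <=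
  2 * expR (2 * l ^+ 2 * B - l * t).
Proof.
move=> B_ge; rewrite Ex_sum.
pose r := [seq p <- enum {: T} | P p].
have ur : uniq r by rewrite filter_uniq ?enum_uniq.
have er (F : T -> R) : \sum_(p <- r) F p = \sum_(p | P p) F p.
  by rewrite big_filter big_enum_cond.
have dr : {in r &, forall i j, i != j -> [disjoint D i & D j]%B}.
  by move=> i j; rewrite !mem_filter => /andP[Pi _] /andP[Pj _]; exact: dis.
have up := chernoff_upper wgt_ge0 wgt_sum ur dr dY Y_ge0 t l_gt0.
have down := chernoff_lower wgt_ge0 wgt_sum ur dr dY Y_ge0 t l_gt0.
have eB : 2 * l ^+ 2 * \sum_(p <- r) Ex (fun N => Y p N ^+ 2) - l * t <= 2 * l ^+ 2 * B - l * t.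
  by rewrite er lerD2r ler_wpM2l // mulr_ge0 ?sqr_ge0.
have -> : 2 * expR (2 * l ^+ 2 * B - l * t) = expR (2 * l ^+ 2 * B - l * t) + expR (2 * l ^+ 2 * B - l * t) by ring.
apply: (le_trans _ (lerD (le_trans up _) (le_trans down _))); rewrite ?ler_expR //.
rewrite -ExD; apply: Ex_le => N.
case: (boolP (bounded_by L N)) => [bN|_] /=; last by rewrite addr_ge0.
set d := \sum_(p | P p) Y p N - _.
case: (leP t `|d|) => [h|_]; last by rewrite addr_ge0.
rewrite !er; move: h; rewrite ler_normr /d => /orP[h|h].
  have -> : all (fun j => l * Y j N <= 2^-1) r.
    by apply/allP => p; rewrite mem_filter => /andP[Pp _]; exact: Y_small.
  have -> : \sum_(p | P p) Ex (Y p) + t <= \sum_(p | P p) Y p N by lra.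
  by rewrite lerDl.
have -> : \sum_(p | P p) Y p N <= \sum_(p | P p) Ex (Y p) - t by lra.
by rewrite lerDr.
Qed.
End chernoff_family.

Lemma mass_tail l t L : 0 < l -> l * L <= 2^-1 ->
  Ex (fun N => (bounded_by L N && (t <= `|(mass N)%:R - Ex (fun N => (mass N)%:R)|))%:R) <=
  2 * expR (2 * l ^+ 2 * (2 * (2 * boxC 1 / s ^+ 3)) - l * t).
Proof.
move=> l0 lL; have eM N : (mass N)%:R = \sum_p (N p)%:R :> R by rewrite /mass natr_sum.
under eq_Ex do rewrite eM (eq_Ex _ eM).
apply: (@chernoff_two_sided predT (fun p => [set p]%SET) (fun p N => (N p)%:R)) => //.
- by move=> p q _ _ pq; rewrite disjoints1 inE.
- by move=> p N N' h; rewrite h // inE.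
- move=> p N _ /forallP /(_ p) h; apply: le_trans lL; rewrite ler_wpM2l ?(ltW l0) //.
  by apply: le_trans h; rewrite ler_peMl // ler1n.
- exact: second_moment_mass.
Qed.

Lemma hook_mass_tail l t L : 0 < l -> l * L <= 2^-1 ->
  Ex (fun N => (bounded_by L N && (t <= `|(hook_mass N)%:R - Ex (fun N => (hook_mass N)%:R)|))%:R) <=
  2 * expR (2 * l ^+ 2 * (2 * (2 * boxC 3 / s ^+ 5)) - l * t).
Proof.
move=> l0 lL; have eM N : (hook_mass N)%:R = \sum_p (hook p)%:R * (N p)%:R :> R.
  by rewrite /hook_mass natr_sum; apply: eq_bigr => p _; rewrite natrM.
under eq_Ex do rewrite eM (eq_Ex _ eM).
apply: (@chernoff_two_sided predT (fun p => [set p]%SET) (fun p N => (hook p)%:R * (N p)%:R)) => //.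
- by move=> p q _ _ pq; rewrite disjoints1 inE.
- by move=> p N N' h; rewrite h // inE.
- by move=> p N _ /forallP /(_ p) h; apply: le_trans lL; rewrite ler_wpM2l ?(ltW l0).
- exact: second_moment_hook.
Qed.

Lemma spread_tail l t L : 0 < l -> 0 <= L -> l * L ^+ 2 <= 2^-1 ->
  Ex (fun N => (bounded_by L N && (t <= `|spread N - Ex spread|))%:R) <=
  2 * expR (2 * l ^+ 2 * (4 * (2 * boxC 5 / s ^+ 7)) - l * t).
Proof.
move=> l0 L0 lL.
apply: (@chernoff_two_sided (fun p : T => (p.1 < p.2)%N) (fun p => [set p; flipT p]%SET)
  (fun p N => dif_sqr p * ((N p)%:R - (N (flipT p))%:R) ^+ 2)) => //.
- move=> p q pp qq pq; apply/pred0P => r /=; rewrite !inE; apply/negP.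
  move=> /andP[/orP[/eqP->|/eqP->] /orP[/eqP e|/eqP e]].
  + by rewrite e eqxx in pq.
  + by move: pp; rewrite e /= ltnNge ltnW.
  + by move: qq; rewrite -e /= ltnNge ltnW.
  + by move: pq; rewrite (inv_inj flipTK e) eqxx.
- by move=> p N N' h; rewrite !h // !inE eqxx ?orbT.
- by move=> p N; rewrite mulr_ge0 ?dif_sqr_ge0 ?sqr_ge0.
- move=> p N _ /forallP h; apply: le_trans lL; rewrite ler_wpM2l ?(ltW l0) //.
  have h1 := h p; have := h (flipT p); rewrite hook_flip => h2.
  apply: (@le_trans _ _ (((hook p)%:R * ((N p)%:R - (N (flipT p))%:R)) ^+ 2)).
    by rewrite exprMn ler_wpM2r ?sqr_ge0 ?dif_sqr_le.
  rewrite -(real_normK (num_real _)) lerXn2r ?nnegrE // mulrBr ler_norml.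
  have : 0 <= (hook p)%:R * (N p)%:R :> R by rewrite mulr_ge0.
  have : 0 <= (hook p)%:R * (N (flipT p))%:R :> R by rewrite mulr_ge0.
  lra.
- exact: second_moment_spread.
Qed.

End positive.
End model.

(** * Probabilities smaller than every power of n *)

Section negligible.
Context {R : realType}.
Local Notation om := (@om R).

Definition negl (u : nat -> R) := forall k, (fun m => om m ^+ k * u m) @ \oo --> (0 : R).

Lemma negl_le (u v : nat -> R) : (\forall m \near \oo, 0 <= u m <= v m) -> negl v -> negl u.
Proof.
move=> uv nv k; apply: (@squeeze_cvgr _ _ _ _ (fun=> 0) (fun m => om m ^+ k * v m)) => //.
  apply: filterS uv => m /andP[u0 uv]; have o := exprn_ge0 k (ltW (om_gt0 (R := R) m)).
  by rewrite mulr_ge0 // ler_wpM2l.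
exact: cvg_cst.
Qed.

Lemma neglD (u v : nat -> R) : negl u -> negl v -> negl (fun m => u m + v m).
Proof.
move=> nu nv k; apply: (@cvg_to_eq R _ _ (0 + 0)); last by rewrite addr0.
by under eq_fun do rewrite mulrDr; apply: cvgD.
Qed.

Lemma negl_exp j (C e : R) : 0 < e -> negl (fun m => C * (om m ^+ j * expR (- (e * om m)))).
Proof.
move=> e0 k; apply: (@cvg_to_eq R _ _ (C * 0)); last by rewrite mulr0.
have -> : (fun m => om m ^+ k * (C * (om m ^+ j * expR (- (e * om m))))) =
  (fun m => C * (om m ^+ (k + j) * expR (- (e * om m)))).
  by apply/funext => m; rewrite exprD; ring.
by apply: cvgM; [exact: cvg_cst | exact: om_exp_cvg].
Qed.

Lemma negl_cvg (u : nat -> R) : negl u -> u @ \oo --> (0 : R).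
Proof. by move=> /(_ 0%N); under eq_fun do rewrite expr0 mul1r. Qed.

Lemma om_large (B : R) : \forall m \near \oo, B <= om m.
Proof.
have B2 : 0 < 1 + `|B| by rewrite ltr_pwDl.
have B1 : 0 < (1 + `|B|)^-1 by rewrite invr_gt0.
have /cvgrPdist_le /(_ _ B1) := @om_inv_cvg R; apply: filterS => m.
have o := om_gt0 (R := R) m.
rewrite sub0r normrN ger0_norm ?invr_ge0 ?(ltW o) // lef_pV2 ?posrE //.
by apply: le_trans; have := ler_norm B; lra.
Qed.
End negligible.

Section boltzmann_concentration.
Context {R : realType}.
Variables (kap : nat -> R) (kap0 : R).
Hypothesis kap_gt0 : forall m, 0 < kap m.
Hypothesis kap0_gt0 : 0 < kap0.
Hypothesis kap_lim : kap @ \oo --> kap0.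
Local Notation om := (@om R).
Local Notation scl := (scl kap).
Local Notation E m := (Ex (wgt (m := m) (scl m))).
Local Notation conf m := {ffun box m.+1 -> 'I_m.+3}.
Let s_gt0 m : 0 < scl m := scl_gt0 kap_gt0 m.

Lemma boltzmann_le m (F G : conf m -> R) : (forall N, F N <= G N) -> E m F <= E m G.
Proof. by move=> FG; apply: le_Ex => //; apply: wgt_ge0. Qed.

Lemma boltzmann_ge0 m (F : conf m -> R) : (forall N, 0 <= F N) -> 0 <= E m F.
Proof. by move=> F0; apply: Ex_ge0 => //; apply: wgt_ge0. Qed.

Lemma negl_unbounded : negl (fun m => E m (fun N => (~~ bounded_by (om m ^+ 5) N)%:R)).
Proof.
have e0 : 0 < kap0 / 2 by rewrite divr_gt0.
apply: negl_le (negl_exp 24 1 e0).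
apply: filterS (kap_half kap0_gt0 kap_lim) => m km.
rewrite boltzmann_ge0 //=; have o := om_gt0 (R := R) m.
apply: le_trans (tail_bounded m (s_gt0 m) (exprn_ge0 5 (ltW o))) _.
rewrite mul1r -(om12 m) -exprM ler_wpM2l ?exprn_ge0 ?(ltW o) // ler_expR lerN2.
have -> : scl m * om m ^+ 5 = scl m ^+ 1 * om m ^+ (4 * 1) * om m by ring.
by rewrite scl_om // expr1 ler_wpM2r // ltW.
Qed.

(** The three applications take the Chernoff parameter l = om ^ (2 - d). Their summed second moments
    are of order om ^ (2 d - 4), so the quadratic term of the exponent stays below a constant C,
    while a deviation e om ^ d contributes - e om ^ 2. *)
Lemma concentration (X : forall m, conf m -> R) (d : nat) (l C e : R) : 0 < e ->
  (fun m => E m (X m) / om m ^+ d) @ \oo --> l ->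
  (\forall m \near \oo, forall t, E m (fun N => (bounded_by (om m ^+ 5) N &&
      (t <= `|X m N - E m (X m)|))%:R) <= 2 * expR (C - t * (om m ^+ 2 / om m ^+ d))) ->
  negl (fun m => E m (fun N => (bounded_by (om m ^+ 5) N && (e <= `|X m N / om m ^+ d - l|))%:R)).
Proof.
move=> e0 lim tail; have e2 : 0 < e / 2 by rewrite divr_gt0.
apply: negl_le (negl_exp 0 (2 * expR C) e2).
have /cvgrPdist_le /(_ _ e2) close := lim.
near=> m; rewrite boltzmann_ge0 //= expr0 mul1r -mulrA -expRD.
have o := om_gt0 (R := R) m; have od : 0 < om m ^+ d by rewrite exprn_gt0.
have cl : `|l - E m (X m) / om m ^+ d| <= e / 2 by near: m.
have tl : E m (fun N => (bounded_by (om m ^+ 5) N &&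
      (e / 2 * om m ^+ d <= `|X m N - E m (X m)|))%:R) <=
    2 * expR (C - e / 2 * om m ^+ d * (om m ^+ 2 / om m ^+ d)).
  by near: m; apply: filterS tail => m; apply.
apply: le_trans (le_trans tl _); last first.
  have -> : e / 2 * om m ^+ d * (om m ^+ 2 / om m ^+ d) = e / 2 * om m ^+ 2 by field; rewrite gt_eqF.
  rewrite ler_wpM2l // ler_expR lerD2l lerN2 ler_wpM2l ?(ltW e2) //.
  by rewrite expr2 ler_peMl ?(ltW o) // om_ge1.
apply: boltzmann_le => N; rewrite ler_nat.
case: (bounded_by _ _) => //=; case: (leP e _) => //= h.
suff -> : e / 2 * om m ^+ d <= `|X m N - E m (X m)| by [].
have -> : X m N - E m (X m) = (X m N / om m ^+ d - E m (X m) / om m ^+ d) * om m ^+ d.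
  by field; rewrite gt_eqF.
rewrite normrM (ger0_norm (ltW od)) ler_pM2r //.
have := ler_normD (X m N / om m ^+ d - E m (X m) / om m ^+ d) (E m (X m) / om m ^+ d - l).
rewrite subrKA; rewrite distrC in cl; lra.
Unshelve. all: by end_near. Qed.

Let scl_pow_le k : \forall m \near \oo, (scl m ^+ k)^-1 <= om m ^+ (4 * k) / (kap0 / 2) ^+ k.
Proof.
apply: filterS (kap_half kap0_gt0 kap_lim) => m km.
have k2 : 0 < kap0 / 2 by rewrite divr_gt0.
have s0 := exprn_gt0 k (s_gt0 m).
rewrite ler_pdivlMr ?exprn_gt0 // -ler_pdivlMl ?invr_gt0 // invrK scl_om //.
by rewrite lerXn2r ?nnegrE ?(ltW k2) // ltW.
Qed.

Lemma mass_mean : (fun m => E m (fun N => (mass N)%:R) / om m ^+ 8) @ \oo --> zeta 2 / kap0 ^+ 2.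
Proof. by under eq_fun do rewrite (Ex_mass _ (scl _)); exact: mean0_lim. Qed.

Lemma hook_mass_mean : (fun m => E m (fun N => (hook_mass N)%:R) / om m ^+ 12) @ \oo
  --> 2 * zeta 3 / kap0 ^+ 3.
Proof. by under eq_fun do rewrite (Ex_hook_mass _ (scl _)); exact: mean1_lim. Qed.

Lemma spread_mean : (fun m => E m (spread (m := m)) / om m ^+ 16) @ \oo --> 2 * zeta 3 / kap0 ^+ 4.
Proof.
pose S m := \sum_(a < m.+2) a.+1%:R * box_dif m.+1 (scl m * a.+1%:R).
have err : (fun m => (E m (spread (m := m)) - S m) / om m ^+ 16) @ \oo --> (0 : R).
  (* 68 = 48 + 12 + 8: the fourth power of m.+1, the factor 2 m.+2 + 2 <= 6 om ^+ 12, and (1 - exp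
     (- s))^-2 <= 4 s^-2 with s >= (kap0 / 2) om ^ -4. *)
  apply/norm_cvg0P; pose C : R := 6 * (4 * 4 / kap0 ^+ 2).
  have hC : (fun m => C * (om m ^+ 68 * expR (- (scl m * m.+1%:R)))) @ \oo --> (0 : R).
    apply: (@cvg_to_eq R _ _ (C * 0)); last by rewrite mulr0.
    by apply: cvgM; [exact: cvg_cst | exact: scl_poly_exp kap_lim 68].
  apply: (@squeeze_cvgr _ _ _ _ (fun=> 0)
    (fun m => C * (om m ^+ 68 * expR (- (scl m * m.+1%:R))))) => //; last exact: cvg_cst.
  have s1 : \forall m \near \oo, scl m <= 1.
    have /cvgrPdist_le /(_ _ ltr01) := scl_cvg0 kap_lim.
    by apply: filterS => m; rewrite sub0r normrN ger0_norm // ltW.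
  near=> m; rewrite normr_ge0 /=; have o := om_gt0 (R := R) m; have o1 := om_ge1 (R := R) m.
  rewrite normrM normfV (ger0_norm (exprn_ge0 16 (ltW o))).
  have o16 : (om m ^+ 16)^-1 <= 1 by rewrite invf_le1 ?exprn_gt0 // exprn_ege1.
  apply: le_trans (ler_piMr (normr_ge0 _) o16) _.
  apply: le_trans (Ex_spread m (s_gt0 m)) _.
  rewrite -(om12 m) -exprM.
  have sm1 : scl m <= 1 by near: m.
  have sm := s_gt0 m.
  have y0 : 0 < 1 - expR (- scl m) by rewrite subr_gt0 -[ltRHS]expR0 ltr_expR oppr_lt0.
  have y1 : scl m / 2 <= 1 - expR (- scl m).
    apply: le_trans (one_sub_exp_ge (ltW sm)).
    by rewrite ler_wpM2l ?(ltW sm) // lef_pV2 ?posrE; lra.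
  have y2 : ((1 - expR (- scl m)) ^+ 2)^-1 <= 4 * (scl m ^+ 2)^-1.
    have s2 : 0 < scl m / 2 by rewrite divr_gt0.
    have -> : 4 * (scl m ^+ 2)^-1 = ((scl m / 2) ^+ 2)^-1 by field; rewrite gt_eqF.
    by rewrite lef_pV2 ?posrE ?exprn_gt0 // lerXn2r ?nnegrE ?(ltW s2) ?(ltW y0).
  have y3 : (scl m ^+ 2)^-1 <= om m ^+ 8 / (kap0 / 2) ^+ 2.
    by near: m; exact: (scl_pow_le 2).
  have y4 : 2 * m.+2%:R + 2 <= 6 * om m ^+ 12 :> R.
    have m1 : 1 <= m.+1%:R :> R by rewrite ler1n.
    by rewrite om12 -[m.+2%:R]natr1; lra.
  have x0 := expR_ge0 (- (scl m * om m ^+ 12)); rewrite om12 in x0.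
  apply: (@le_trans _ _ (om m ^+ 48 * (6 * om m ^+ 12 * expR (- (scl m * m.+1%:R)) *
     (4 * (om m ^+ 8 / (kap0 / 2) ^+ 2))))).
    rewrite ler_wpM2l ?exprn_ge0 ?(ltW o) // om12; apply: ler_pM.
    - by rewrite mulr_ge0 ?addr_ge0 ?mulr_ge0.
    - by rewrite invr_ge0 sqr_ge0.
    - by rewrite ler_wpM2r // -(om12 m).
    - by apply: le_trans y2 _; rewrite ler_wpM2l.
  rewrite le_eqVlt; apply/orP; left; apply/eqP; rewrite /C -(om12 m); field.
  by rewrite gt_eqF.
have -> : (fun m => E m (spread (m := m)) / om m ^+ 16) =
  (fun m => (E m (spread (m := m)) - S m) / om m ^+ 16 + S m / om m ^+ 16).
  by apply/funext => m; rewrite -mulrDl subrK.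
apply: (@cvg_to_eq R _ _ (0 + 2 * zeta 3 / kap0 ^+ 4)); last by rewrite add0r.
by apply: cvgD => //; exact: mean2_lim.
Unshelve. all: by end_near. Qed.

Lemma mass_concentration (e : R) : 0 < e ->
  negl (fun m => E m (fun N => (bounded_by (om m ^+ 5) N &&
    (e <= `|(mass N)%:R / om m ^+ 8 - zeta 2 / kap0 ^+ 2|))%:R)).
Proof.
move=> e0; apply: (concentration (C := 8 * boxC 1 / (kap0 / 2) ^+ 3) e0 mass_mean).
near=> m => t; have o := om_gt0 (R := R) m.
have l0 : 0 < (om m ^+ 6)^-1 by rewrite invr_gt0 exprn_gt0.
have lL : (om m ^+ 6)^-1 * om m ^+ 5 <= 2^-1.
  have -> : (om m ^+ 6)^-1 * om m ^+ 5 = (om m)^-1 by field; rewrite gt_eqF.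
  by rewrite lef_pV2 ?posrE //; near: m; exact: om_large.
apply: le_trans (mass_tail m (s_gt0 m) t l0 lL) _; rewrite ler_wpM2l // ler_expR lerB //; last first.
  by rewrite le_eqVlt; apply/orP; left; apply/eqP; field; rewrite gt_eqF.
have y3 : (scl m ^+ 3)^-1 <= om m ^+ 12 / (kap0 / 2) ^+ 3 by near: m; exact: (scl_pow_le 3).
have b0 := boxC_ge0 (R := R) 1.
have c0 : 0 <= 2 * (om m ^+ 6)^-1 ^+ 2 * (4 * boxC 1) by rewrite !mulr_ge0 ?(ltW l0).
have := ler_wpM2l c0 y3 => h.
apply: (le_trans (le_trans _ h)); rewrite le_eqVlt; apply/orP; left; apply/eqP.
  by ring.
by field; rewrite ?gt_eqF.
Unshelve. all: by end_near. Qed.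

Lemma hook_mass_concentration (e : R) : 0 < e ->
  negl (fun m => E m (fun N => (bounded_by (om m ^+ 5) N &&
    (e <= `|(hook_mass N)%:R / om m ^+ 12 - 2 * zeta 3 / kap0 ^+ 3|))%:R)).
Proof.
move=> e0; apply: (concentration (C := 8 * boxC 3 / (kap0 / 2) ^+ 5) e0 hook_mass_mean).
near=> m => t; have o := om_gt0 (R := R) m.
have l0 : 0 < (om m ^+ 10)^-1 by rewrite invr_gt0 exprn_gt0.
have lL : (om m ^+ 10)^-1 * om m ^+ 5 <= 2^-1.
  have -> : (om m ^+ 10)^-1 * om m ^+ 5 = (om m ^+ 5)^-1 by field; rewrite gt_eqF.
  rewrite lef_pV2 ?posrE ?exprn_gt0 //.
  apply: (@le_trans _ _ (om m)); first by near: m; exact: om_large.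
  by rewrite -[leLHS]expr1 ler_weXn2l // om_ge1.
apply: le_trans (hook_mass_tail m (s_gt0 m) t l0 lL) _; rewrite ler_wpM2l // ler_expR lerB //; last first.
  by rewrite le_eqVlt; apply/orP; left; apply/eqP; field; rewrite gt_eqF.
have y3 : (scl m ^+ 5)^-1 <= om m ^+ 20 / (kap0 / 2) ^+ 5 by near: m; exact: (scl_pow_le 5).
have b0 := boxC_ge0 (R := R) 3.
have c0 : 0 <= 2 * (om m ^+ 10)^-1 ^+ 2 * (4 * boxC 3) by rewrite !mulr_ge0 ?(ltW l0).
have := ler_wpM2l c0 y3 => h.
apply: (le_trans (le_trans _ h)); rewrite le_eqVlt; apply/orP; left; apply/eqP.
  by ring.
by field; rewrite ?gt_eqF.
Unshelve. all: by end_near. Qed.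

Lemma spread_concentration (e : R) : 0 < e ->
  negl (fun m => E m (fun N => (bounded_by (om m ^+ 5) N &&
    (e <= `|spread N / om m ^+ 16 - 2 * zeta 3 / kap0 ^+ 4|))%:R)).
Proof.
move=> e0; apply: (concentration (C := 16 * boxC 5 / (kap0 / 2) ^+ 7) e0 spread_mean).
near=> m => t; have o := om_gt0 (R := R) m.
have l0 : 0 < (om m ^+ 14)^-1 by rewrite invr_gt0 exprn_gt0.
have lL : (om m ^+ 14)^-1 * (om m ^+ 5) ^+ 2 <= 2^-1.
  have -> : (om m ^+ 14)^-1 * (om m ^+ 5) ^+ 2 = (om m ^+ 4)^-1 by field; rewrite gt_eqF.
  rewrite lef_pV2 ?posrE ?exprn_gt0 //.
  apply: (@le_trans _ _ (om m)); first by near: m; exact: om_large.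
  by rewrite -[leLHS]expr1 ler_weXn2l // om_ge1.
apply: le_trans (spread_tail m (s_gt0 m) t l0 (exprn_ge0 5 (ltW o)) lL) _.
rewrite ler_wpM2l // ler_expR lerB //; last first.
  by rewrite le_eqVlt; apply/orP; left; apply/eqP; field; rewrite gt_eqF.
have y3 : (scl m ^+ 7)^-1 <= om m ^+ 28 / (kap0 / 2) ^+ 7 by near: m; exact: (scl_pow_le 7).
have b0 := boxC_ge0 (R := R) 5.
have c0 : 0 <= 2 * (om m ^+ 14)^-1 ^+ 2 * (8 * boxC 5) by rewrite !mulr_ge0 ?(ltW l0).
have := ler_wpM2l c0 y3 => h.
apply: (le_trans (le_trans _ h)); rewrite le_eqVlt; apply/orP; left; apply/eqP.
  by ring.
by field; rewrite ?gt_eqF.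
Unshelve. all: by end_near. Qed.

End boltzmann_concentration.

(** * Conditioning on the size *)

Section hook_mass_law.
Context {R : realType} (m : nat).
Local Notation T := (box m.+1).
Local Notation conf := {ffun T -> 'I_m.+3}.
Implicit Types (N : conf).

Definition conf_count (P : pred conf) (k : nat) : nat := #|[set N : conf | (hook_mass N == k) && P N]%SET|.

Lemma value_le_hook_mass N p : (hook p * N p <= hook_mass N)%N.
Proof. by rewrite /hook_mass (bigD1 p) //= leq_addr. Qed.

(* The corner cell has hook length 1: its entry absorbs the missing mass. *)
Lemma conf_count_mono k : (k <= m.+1)%N -> (conf_count xpredT k <= conf_count xpredT m.+1)%N.
Proof.
move=> km; pose o : T := (ord0, ord0).
pose f N : conf := [ffun p => if p == o then inord (N p + (m.+1 - k))%N else N p].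
have fo N : hook_mass N = k -> f N o = (N o + (m.+1 - k))%N :> nat.
  move=> hN; rewrite ffunE eqxx inordK //; have := value_le_hook_mass N o.
  by rewrite hN /hook /= mul1n; lia.
rewrite /conf_count -(card_in_imset (f := f)).
  apply/subset_leq_card/fintype.subsetP => N' /imsetP[N]; rewrite inE andbT => /eqP hN ->.
  rewrite inE andbT; apply/eqP.
  transitivity (hook_mass N + (m.+1 - k))%N; last by rewrite hN subnKC.
  rewrite /hook_mass (bigD1 o) //= [in RHS](bigD1 o) //= fo // !mul1n addnAC; congr (_ + _ + _)%N.
  by apply: eq_bigr => p /negPf po; rewrite ffunE po.
move=> N N'; rewrite !inE !andbT => /eqP hN /eqP hN' e; apply/ffunP => p.
have [->|/negPf po] := eqVneq p o.
  by apply: val_inj; have := congr1 (fun g : conf => g o : nat) e; rewrite !fo //= => /addIn.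
by have := congr1 (fun g : conf => g p) e; rewrite !ffunE po.
Qed.

Section positive.
Variable s : R.
Hypothesis s_gt0 : 0 < s.
Local Notation E := (Ex (wgt (m := m) s)).
Definition norm_const : R := \prod_(p : T) (1 - expR (- (s * (hook p)%:R))).

Lemma norm_const_gt0 : 0 < norm_const.
Proof.
apply: prodr_gt0 => p _; rewrite subr_gt0 -[ltRHS]expR0 ltr_expR oppr_lt0.
by rewrite mulr_gt0 // /hook ltr0n.
Qed.

Lemma pw_small N : (hook_mass N <= m.+1)%N ->
  pw (wgt s) N = norm_const * expR (- (s * (hook_mass N)%:R)).
Proof.
move=> hN; rewrite /pw /norm_const.
have -> : expR (- (s * (hook_mass N)%:R)) = \prod_(p : T) expR (- (s * (hook p)%:R)) ^+ N p.
  rewrite /hook_mass natr_sum mulr_sumr -sumrN expR_sum; apply: eq_bigr => p _.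
  by rewrite -expRM_natl natrM -[(p.1 + p.2).+1]/(hook p); congr expR; ring.
rewrite -big_split; apply: eq_bigr => p _ /=; rewrite /wgt /capgeo ifT //.
rewrite ltnS; apply: leq_trans hN; apply: leq_trans (value_le_hook_mass N p).
by rewrite /hook leq_pmull.
Qed.

Lemma Ex_hook_mass_eq (P : pred conf) k : (k <= m.+1)%N ->
  E (fun N => ((hook_mass N == k) && P N)%:R) =
  norm_const * expR (- (s * k%:R)) * (conf_count P k)%:R.
Proof.
move=> km; rewrite /Ex (bigID (fun N => (hook_mass N == k) && P N)) /= [X in _ + X]big1 ?addr0.
  rewrite (eq_bigr (fun=> norm_const * expR (- (s * k%:R)))).
    rewrite /conf_count -sum1_card natr_sum mulr_sumr.
    by apply: eq_big => [N|N _]; rewrite ?inE ?mulr1.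
  by move=> N /andP[/eqP hN ->]; rewrite pw_small hN // eqxx mulr1.
by move=> N /negPf ->; rewrite mulr0.
Qed.

(** By [pw_small] all configurations with H = m.+1 have the same weight, so counting them is
    conditioning, whatever the tilt s > 0. *)
Lemma conditional_count (P : pred conf) : (conf_count P m.+1)%:R / (conf_count xpredT m.+1)%:R =
  E (fun N => ((hook_mass N == m.+1) && P N)%:R) / E (fun N => (hook_mass N == m.+1)%:R).
Proof.
have -> : E (fun N => (hook_mass N == m.+1)%:R) = E (fun N => ((hook_mass N == m.+1) && xpredT N)%:R).
  by apply: eq_Ex => N; rewrite andbT.
rewrite !Ex_hook_mass_eq //; set c := norm_const * _.
have c0 : c != 0 by rewrite gt_eqF // mulr_gt0 ?norm_const_gt0 ?expR_gt0.
by rewrite -mulf_div divff // mul1r.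
Qed.

(** Counts increase with the size by [conf_count_mono], so the mass at n - d exceeds that at n at
    most by the ratio exp (s d) of the weights; the window has L.+1 points. *)
Lemma window_le (L : nat) : E (fun N => (m.+1 <= hook_mass N + L <= m.+1 + L)%N%:R) <=
  L.+1%:R * expR (s * L%:R) * E (fun N => (hook_mass N == m.+1)%:R).
Proof.
set p := E (fun N => (hook_mass N == m.+1)%:R).
have w0 := @wgt_ge0 R m s s_gt0.
apply: (@le_trans _ _ (\sum_(d < L.+1) E (fun N => (hook_mass N + d == m.+1)%N%:R))).
  rewrite -Ex_sum; apply: le_Ex => // N; case: (boolP (m.+1 <= hook_mass N + L <= m.+1 + L)%N) => [/andP[h1 h2]|_]; last exact: sumr_ge0.
  have dL : (m.+1 - hook_mass N < L.+1)%N by lia.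
  rewrite (bigD1 (Ordinal dL)) //= subnKC ?eqxx; last by lia.
  by rewrite lerDl sumr_ge0.
have -> : L.+1%:R * expR (s * L%:R) * p = \sum_(d < L.+1) expR (s * L%:R) * p.
  by rewrite sumr_const card_ord -mulrA mulr_natl.
have p0 : 0 <= p by apply: Ex_ge0.
apply: ler_sum => d _; have [dm|dm] := leqP d m.+1; last first.
  rewrite (@eq_Ex _ _ _ _ _ (fun=> 0)) ?Ex_cst ?mulr_ge0 ?expR_ge0 //.
    exact: wgt_sum.
  by move=> N; rewrite (_ : (_ == _) = false) //; lia.
rewrite (@eq_Ex _ _ _ _ _ (fun N => ((hook_mass N == m.+1 - d)%N && xpredT N)%:R)); last first.
  by move=> N; rewrite andbT; congr (nat_of_bool _)%:R; lia.
have -> : p = E (fun N => ((hook_mass N == m.+1) && xpredT N)%:R).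
  by apply: eq_Ex => N; rewrite andbT.
rewrite !Ex_hook_mass_eq ?leq_subr //.
have -> : expR (s * L%:R) * (norm_const * expR (- (s * m.+1%:R)) * (conf_count xpredT m.+1)%:R) =
  norm_const * expR (s * L%:R - s * m.+1%:R) * (conf_count xpredT m.+1)%:R by rewrite expRD; ring.
have n0 := norm_const_gt0.
apply: ler_pM; rewrite ?mulr_ge0 ?expR_ge0 ?(ltW n0) ?ler_nat ?conf_count_mono ?leq_subr //.
rewrite ler_wpM2l ?(ltW n0) //.
rewrite ler_expR natrB // mulrBr opprB; have : s * d%:R <= s * L%:R.
  by rewrite ler_wpM2l ?(ltW s_gt0) // ler_nat -ltnS.
lra.
Qed.

Lemma hook_mass_eq_lower (L : nat) : E (fun N => (hook_mass N <= m.+1)%N%:R) = 2^-1 ->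
  4^-1 <= (m.+1%:R ^+ 2 + 1) * (L.+1%:R * expR (s * L%:R) * E (fun N => (hook_mass N == m.+1)%:R))
    + m.+1%:R ^+ 2 * expR (- (s * L%:R)).
Proof.
move=> half; have w0 := @wgt_ge0 R m s s_gt0; have w1 := @wgt_sum R m s.
have other : E (fun N => (m.+1 < hook_mass N)%N%:R) = 2^-1.
  have : E (fun N => (hook_mass N <= m.+1)%N%:R + (m.+1 < hook_mass N)%N%:R) = 1.
    by rewrite -[RHS](Ex_cst w1); apply: eq_Ex => N; rewrite ltnNge; case: leqP; rewrite ?addr0 ?add0r.
  by rewrite ExD half; lra.
have := window_mass w0 w1 (fun (p : T) (k : 'I_m.+3) => (hook p * k)%N) m.+1 L.
rewrite -[X in X * _ <= _ -> _]/(E (fun N => (hook_mass N <= m.+1)%N%:R)) half.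
rewrite -[X in _ * X <= _ -> _]/(E (fun N => (m.+1 < hook_mass N)%N%:R)) other.
have -> : 2^-1 * 2^-1 = 4^-1 :> R by field.
move/le_trans; apply.
have cT : #|{: T}|.+1%:R = m.+1%:R ^+ 2 + 1 :> R.
  by rewrite card_prod card_ord -natr1 natrM expr2.
rewrite cT; apply: lerD; first by rewrite ler_wpM2l ?addr_ge0 ?sqr_ge0 // window_le.
have t p : E (fun N => (L < hook p * N p)%N%:R) <= expR (- (s * L%:R)).
  apply: le_trans (tail_value s_gt0 p (ler0n R L)); rewrite le_eqVlt; apply/orP; left; apply/eqP.
  by apply: eq_Ex => N; rewrite -natrM ltr_nat.
apply: le_trans (ler_sum _ (fun p _ => t p)) _.
by rewrite sumr_const card_prod card_ord -(mulr_natl _ (m.+1 * m.+1)) natrM expr2.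
Qed.

End positive.
End hook_mass_law.

(** * Polynomial lower bound for the probability of the conditioning event *)

Section local_lower_bound.
Context {R : realType}.
Variables (kap : nat -> R) (kap0 : R).
Hypothesis kap_gt0 : forall m, 0 < kap m.
Hypothesis kap0_gt0 : 0 < kap0.
Hypothesis kap_lim : kap @ \oo --> kap0.
Local Notation om := (@om R).
Local Notation scl := (scl kap).
Local Notation E m := (Ex (wgt (m := m) (scl m))).
Local Notation conf m := {ffun box m.+1 -> 'I_m.+3}.
Hypothesis half : \forall m \near \oo, E m (fun N => (hook_mass N <= m.+1)%N%:R) = 2^-1.

Lemma hook_mass_eq_poly : \forall m \near \oo,
  (om m ^+ 130)^-1 <= E m (fun N => (hook_mass N == m.+1)%:R).
Proof.
(* L is about tau n^(1/3) ln om, and kap lies between kap0 / 2 and 2 kap0, so s L lies between 25 ln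
   om - 1 and 100 ln om. Then exp (- s L) is at most a constant times om ^ -25, which beats the om
   ^+ 24 cells, and exp (s L) <= om ^+ 100. The loss is 24 for the cells, 5 for L.+1, 100 for the
   exponential, and one more power for the constants: 130. *)
pose tau : R := 50 / kap0.
have tau0 : 0 < tau by rewrite divr_gt0.
have k2 : \forall m \near \oo, kap m <= 2 * kap0.
  move/cvgrPdist_le/(_ _ kap0_gt0): kap_lim; apply: filterS => m; rewrite ler_norml; lra.
have s1 : \forall m \near \oo, scl m <= 1.
  have /cvgrPdist_le /(_ _ ltr01) := scl_cvg0 kap_lim.
  by apply: filterS => m; rewrite sub0r normrN ger0_norm // ltW // scl_gt0.
near=> m.
have hm : E m (fun N => (hook_mass N <= m.+1)%N%:R) = 2^-1 by near: m.
have km : kap0 / 2 <= kap m by near: m; exact: kap_half.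
have km2 : kap m <= 2 * kap0 by near: m.
have sm1 : scl m <= 1 by near: m.
have sm := scl_gt0 kap_gt0 m.
have o := om_gt0 (R := R) m; have o1 := om_ge1 (R := R) m.
have big : 16 * (tau + 1) <= om m by near: m; exact: om_large.
have big2 : 8 * expR 1 <= om m by near: m; exact: om_large.
set p := E m _.
have ln0 : 0 <= ln (om m) by rewrite ln_ge0.
have lno : ln (om m) <= om m.
  by rewrite -ler_expR lnK ?posrE //; apply: le_trans (expR_ge1Dx _); rewrite lerDr.
pose y := tau * om m ^+ 4 * ln (om m).
have y0 : 0 <= y by rewrite mulr_ge0 // mulr_ge0 ?(ltW tau0) ?exprn_ge0 ?(ltW o).
pose L := Num.truncn y.
have Ly : L%:R <= y by rewrite truncn_le.
have yL : y - 1 <= L%:R by have := truncnS_gt y; rewrite -natr1 -/L; lra.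
have sy : scl m * y = kap m * tau * ln (om m).
  have := @scl_om R kap 1 m; rewrite !expr1 muln1 => <-; rewrite /y; ring.
have lower := hook_mass_eq_lower sm L hm; rewrite -/p in lower.
have eo k : expR (k%:R * ln (om m)) = om m ^+ k by rewrite expRM_natl lnK.
have ktau : kap0 * tau = 50 by rewrite /tau; field; rewrite gt_eqF.
have e1 : expR (- (scl m * L%:R)) <= expR 1 / om m ^+ 25.
  rewrite -eo -expRN -expRD ler_expR.
  have := ler_wpM2l (ltW sm) yL; rewrite mulrBr mulr1 sy.
  have := ler_wpM2r ln0 (ler_wpM2r (ltW tau0) km).
  have -> : kap0 / 2 * tau * ln (om m) = (kap0 * tau) / 2 * ln (om m) by ring.
  rewrite ktau; lra.
have e2 : expR (scl m * L%:R) <= om m ^+ 100.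
  rewrite -eo ler_expR; have := ler_wpM2l (ltW sm) Ly; rewrite sy.
  have := ler_wpM2r ln0 (ler_wpM2r (ltW tau0) km2).
  have -> : 2 * kap0 * tau * ln (om m) = 2 * (kap0 * tau) * ln (om m) by ring.
  rewrite ktau; lra.
have n24 : m.+1%:R ^+ 2 = om m ^+ 24 by rewrite -(om12 m) -exprM.
have small : m.+1%:R ^+ 2 * expR (- (scl m * L%:R)) <= 8^-1.
  apply: (@le_trans _ _ (om m ^+ 24 * (expR 1 / om m ^+ 25))).
    by rewrite n24 ler_wpM2l ?exprn_ge0 ?(ltW o).
  have -> : om m ^+ 24 * (expR 1 / om m ^+ 25) = expR 1 / om m by field; rewrite gt_eqF.
  rewrite ler_pdivrMr //; lra.
have L1 : L.+1%:R <= (tau + 1) * om m ^+ 5.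
  rewrite -natr1; have o5 : 1 <= om m ^+ 5 by rewrite exprn_ege1.
  have : y <= tau * om m ^+ 5.
    by rewrite /y [om m ^+ 5]exprSr mulrA ler_wpM2l // mulr_ge0 ?exprn_ge0 ?(ltW tau0) ?(ltW o).
  rewrite mulrDl mul1r; lra.
have n1 : m.+1%:R ^+ 2 + 1 <= 2 * om m ^+ 24.
  by rewrite n24; have := exprn_ege1 24 o1; lra.
have p0 : 0 <= p by apply: Ex_ge0 => //; exact: wgt_ge0.
have main : 8^-1 <= 2 * om m ^+ 24 * ((tau + 1) * om m ^+ 5 * om m ^+ 100 * p).
  apply: (@le_trans _ _ ((m.+1%:R ^+ 2 + 1) * (L.+1%:R * expR (scl m * L%:R) * p))); first lra.
  apply: ler_pM; last by rewrite ler_wpM2r // ler_pM ?expR_ge0.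
  - by rewrite addr_ge0 ?sqr_ge0.
  - by rewrite !mulr_ge0 ?expR_ge0.
  - exact: n1.
have t1 : 0 < tau + 1 by lra.
rewrite -[leLHS]mul1r ler_pdivrMr ?exprn_gt0 // mulrC.
apply: (@le_trans _ _ (16 * (tau + 1) * om m ^+ 129 * p)).
  have -> : 16 * (tau + 1) * om m ^+ 129 * p = 8 * (2 * om m ^+ 24 * ((tau + 1) * om m ^+ 5 * om m ^+ 100 * p)) by ring.
  lra.
by rewrite [om m ^+ 130]exprS ler_wpM2r // ler_wpM2r // exprn_ge0 // ltW.
Unshelve. all: by end_near. Qed.

(** Conditioning multiplies a probability by at most om ^+ 130, which [negl] absorbs. *)
Lemma negl_conditional (P : forall m, pred (conf m)) :
  negl (fun m => E m (fun N => (P m N)%:R)) ->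
  (fun m => (conf_count (P m) m.+1)%:R / (conf_count (m := m) xpredT m.+1)%:R) @ \oo --> (0 : R).
Proof.
move=> /(_ 130%N) nP.
apply: (@squeeze_cvgr _ _ _ _ (fun=> 0) (fun m => om m ^+ 130 * E m (fun N => (P m N)%:R))) => //;
  last exact: cvg_cst.
apply: filterS hook_mass_eq_poly => m lb; have o := exprn_gt0 130 (om_gt0 (R := R) m).
rewrite divr_ge0 //= (conditional_count (scl_gt0 kap_gt0 m)).
have w0 := @wgt_ge0 R m _ (scl_gt0 kap_gt0 m).
have lb0 : 0 < E m (fun N => (hook_mass N == m.+1)%:R) by apply: lt_le_trans lb; rewrite invr_gt0.
rewrite ler_pdivrMr // mulrAC.
apply: (@le_trans _ _ (E m (fun N => (P m N)%:R))).
  by apply: le_Ex => // N; rewrite ler_nat; case: (_ == _).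
rewrite -[leLHS]mul1r ler_wpM2r ?Ex_ge0 //.
by rewrite -ler_pdivrMl // mulr1.
Qed.

End local_lower_bound.

(** * Choice of the tilt by the median of H *)

Section tilt.
Context {R : realType}.
Local Notation om := (@om R).

Lemma continuous_bigsum (I : Type) (r : seq I) (f : I -> R -> R) :
  (forall i, continuous (f i)) -> continuous (fun x => \sum_(i <- r) f i x).
Proof.
move=> cf; elim: r => [|i r IH] x.
  by under eq_fun do rewrite big_nil; exact: cvg_cst.
by under eq_fun do rewrite big_cons; apply: cvgD; [exact: cf | exact: IH].
Qed.

Lemma continuous_bigprod (I : Type) (r : seq I) (f : I -> R -> R) :
  (forall i, continuous (f i)) -> continuous (fun x => \prod_(i <- r) f i x).
Proof.
move=> cf; elim: r => [|i r IH] x.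
  by under eq_fun do rewrite big_nil; exact: cvg_cst.
by under eq_fun do rewrite big_cons; apply: cvgM; [exact: cf | exact: IH].
Qed.

Definition below_prob (m : nat) (k : R) : R :=
  Ex (wgt (m := m) (k / om m ^+ 4)) (fun N => (hook_mass N <= m.+1)%N%:R).

Lemma below_prob_continuous m : continuous (below_prob m).
Proof.
apply: continuous_bigsum => N x; apply: cvgM; last exact: cvg_cst.
apply: (continuous_bigprod (f := fun p k => wgt (k / om m ^+ 4) p (N p))) => p {}x.
have cx : (fun k : R => expR (- (k / om m ^+ 4 * (hook p)%:R))) y @[y --> x] -->
    expR (- (x / om m ^+ 4 * (hook p)%:R)).
  apply: (cvg_comp (fun k : R => - (k / om m ^+ 4 * (hook p)%:R)) expR); last exact: continuous_expR.
  by apply: cvgN; apply: cvgM; [apply: cvgM; [exact: cvg_id | exact: cvg_cst] | exact: cvg_cst].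
rewrite /continuous_at /wgt /capgeo; case: ifP => _.
  apply: cvgM; first by apply: cvgB => //; exact: cvg_cst.
  by apply: (cvg_comp _ (fun x : R => x ^+ _) cx); exact: exprn_continuous.
by apply: (cvg_comp _ (fun x : R => x ^+ _) cx); exact: exprn_continuous.
Qed.

Lemma zeta3_gt0 : 0 < zeta 3 :> R.
Proof.
have := @zetaP R 3 isT => h; apply: (lt_le_trans ltr01).
rewrite -(cvg_lim (@Rhausdorff R) h); apply: limr_ge; first by apply/cvg_ex; exists (zeta 3).
near=> N; have N0 : (0 < N)%N by near: N; exact: nbhs_infty_gt.
rewrite (bigD1 (Ordinal N0)) //= expr1n invr1 lerDl sumr_ge0 //.
Unshelve. all: by end_near. Qed.

Definition kappa : R := (2 * zeta 3) `^ (1 / 3).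

Lemma kappa_gt0 : 0 < kappa.
Proof. by rewrite powR_gt0 // mulr_gt0 // zeta3_gt0. Qed.

Lemma kappa3 : kappa ^+ 3 = 2 * zeta 3.
Proof.
have z := zeta3_gt0; rewrite /kappa -powR_mulrn ?powR_ge0 // -powRrM.
by rewrite mul1r mulVf ?pnatr_eq0 // powRr1 // mulr_ge0 // ltW.
Qed.

(** For fixed k, H / n concentrates at 2 zeta(3) / k^3 = (kappa / k)^3. On either side of kappa this
    differs from 1, so one of H <= n and H > n becomes improbable, which traps a median tilt near
    kappa. *)
Let deviation_cvg0 (k e : R) (P : forall m, pred {ffun box m.+1 -> 'I_m.+3}) : 0 < k -> 0 < e ->
  (forall m N, P m N -> e <= `|(hook_mass N)%:R / om m ^+ 12 - 2 * zeta 3 / k ^+ 3|) ->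
  \forall m \near \oo, Ex (wgt (m := m) (k / om m ^+ 4)) (fun N => (P m N)%:R) <= 4^-1.
Proof.
move=> k0 e0 hP; have kl : (fun _ : nat => k) @ \oo --> k by exact: cvg_cst.
have kp (m : nat) : 0 < (fun=> k) m by [].
have n1 := negl_unbounded kp k0 kl.
have n2 := hook_mass_concentration kp k0 kl e0.
have /cvgrPdist_le /(_ 4^-1) := negl_cvg (neglD n1 n2).
rewrite invr_gt0 => /(_ (ltr0Sn R 3)) h; near=> m.
apply: (@le_trans _ _ `|0 - (Ex (wgt (m := m) (scl (fun=> k) m)) (fun N => (~~ bounded_by (om m ^+ 5) N)%:R) +
  Ex (wgt (m := m) (scl (fun=> k) m)) (fun N => (bounded_by (om m ^+ 5) N &&
    (e <= `|(hook_mass N)%:R / om m ^+ 12 - 2 * zeta 3 / k ^+ 3|))%:R))|); last by near: m.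
rewrite sub0r normrN -ExD; apply: le_trans (ler_norm _).
apply: le_Ex => [t j|N]; first by apply: wgt_ge0; rewrite divr_gt0 ?exprn_gt0 ?om_gt0.
case: (boolP (P m N)) => [/hP ->|_]; first by case: (bounded_by _ _); rewrite ?addr0 ?add0r.
by rewrite addr_ge0.
Unshelve. all: by end_near. Qed.

Lemma below_prob_hi k : kappa < k -> \forall m \near \oo, 2^-1 <= below_prob m k.
Proof.
move=> kk; have k0 : 0 < k := lt_trans kappa_gt0 kk.
have l1 : 2 * zeta 3 / k ^+ 3 < 1.
  by rewrite ltr_pdivrMr ?exprn_gt0 // mul1r -kappa3 ltrXn2r ?nnegrE ?ltW ?kappa_gt0.
have e0 : 0 < 1 - 2 * zeta 3 / k ^+ 3 by lra.
have := @deviation_cvg0 k _ (fun m N => (m.+1 < hook_mass N)%N) k0 e0.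
move=> /(_ _) h; apply: filterS (h _) => [m|m N hN]; last first.
  apply: le_trans (ler_norm _); rewrite lerD2r ler_pdivlMr ?exprn_gt0 ?om_gt0 //.
  by rewrite mul1r om12 ler_nat ltnW.
have w1 := @wgt_sum R m (k / om m ^+ 4).
have : Ex (wgt (m := m) (k / om m ^+ 4)) (fun N => (hook_mass N <= m.+1)%N%:R + (m.+1 < hook_mass N)%N%:R) = 1.
  by rewrite -[RHS](Ex_cst w1); apply: eq_Ex => N; rewrite ltnNge; case: leqP; rewrite ?addr0 ?add0r.
rewrite ExD -/(below_prob m k); lra.
Qed.

Lemma below_prob_lo k : 0 < k -> k < kappa -> \forall m \near \oo, below_prob m k <= 2^-1.
Proof.
move=> k0 kk.
have l1 : 1 < 2 * zeta 3 / k ^+ 3.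
  by rewrite ltr_pdivlMr ?exprn_gt0 // mul1r -kappa3 ltrXn2r ?nnegrE ?ltW ?kappa_gt0.
have e0 : 0 < 2 * zeta 3 / k ^+ 3 - 1 by lra.
have := @deviation_cvg0 k _ (fun m N => (hook_mass N <= m.+1)%N) k0 e0.
move=> /(_ _) h; apply: filterS (h _) => [m|m N hN]; first by rewrite /below_prob; lra.
rewrite distrC; apply: le_trans (ler_norm _); rewrite lerD2l lerN2 ler_pdivrMr ?exprn_gt0 ?om_gt0 //.
by rewrite mul1r om12 ler_nat.
Qed.

Lemma median_near (e : R) : 0 < e -> \forall m \near \oo,
  exists k, [/\ 0 < k, below_prob m k = 2^-1 & `|k - kappa| <= e].
Proof.
move=> e0; have k0 := kappa_gt0.
pose d := Num.min e (kappa / 2).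
have d0 : 0 < d by rewrite lt_min e0 divr_gt0.
have de : d <= e by rewrite ge_min lexx.
have dk : d <= kappa / 2 by rewrite ge_min lexx orbT.
have lo0 : 0 < kappa - d by lra.
have lo1 : kappa - d < kappa by lra.
have hi1 : kappa < kappa + d by lra.
have lo := below_prob_lo lo0 lo1; have hi := below_prob_hi hi1.
near=> m.
have lom : below_prob m (kappa - d) <= 2^-1 by near: m.
have him : 2^-1 <= below_prob m (kappa + d) by near: m.
have ab : kappa - d <= kappa + d by lra.
have [||c] := @IVT R (below_prob m) _ _ 2^-1 ab.
- by apply: continuous_subspaceT; exact: below_prob_continuous.
- by rewrite ge_min lom /= le_max him orbT.
rewrite in_itv /= => /andP[c1 c2] hc; exists c; split => //; first lra.
by rewrite ler_norml; lra.
Unshelve. all: by end_near. Qed.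

(** [median_near] gives, for each e, solutions within e of kappa once m is large, possibly several.
    A solution within 1 / m.+1 of the least distance to kappa serves all e at once; where none
    exists, kappa is the default. *)
Lemma median_sequence : exists kap : nat -> R, [/\ forall m, 0 < kap m,
  \forall m \near \oo, below_prob m (kap m) = 2^-1 & kap @ \oo --> kappa].
Proof.
pose Q m k := 0 < k /\ below_prob m k = 2^-1.
pose D m := [set `|k - kappa| | k in [set k | Q m k]].
have lbD m : lbound (D m) 0 by move=> _ [k _ <-].
have [kap kapP] : {kap : nat -> R & forall m, 0 < kap m /\
    ((exists k, Q m k) -> Q m (kap m) /\ `|kap m - kappa| <= inf (D m) + m.+1%:R^-1)}.
  apply: (@choice nat R (fun m k => 0 < k /\
    ((exists k', Q m k') -> Q m k /\ `|k - kappa| <= inf (D m) + m.+1%:R^-1))) => m.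
  have [[k Qk]|nQ] := pselect (exists k, Q m k); last first.
    by exists kappa; split=> [|/nQ //]; exact: kappa_gt0.
  have hD : has_inf (D m) by split; [exists `|k - kappa|; exists k | exists 0].
  have m0 : 0 < m.+1%:R^-1 :> R by rewrite invr_gt0.
  have [_ [k' Qk' <-] lt] := inf_adherent m0 hD.
  by exists k'; split=> [|_]; [case: Qk' | split => //; exact: ltW].
exists kap; split=> [m||]; first by case: (kapP m).
  apply: filterS (median_near ltr01) => m [k [k0 hk _]].
  have [_ /(_ _) h] := kapP m; have [|[]//] := h _.
  by exists k.
apply/cvgrPdist_le => e e0; have e2 : 0 < e / 2 by rewrite divr_gt0.
have md := median_near e2; near=> m.
have [k [k0 hk kd]] : exists k, [/\ 0 < k, below_prob m k = 2^-1 & `|k - kappa| <= e / 2] by near: m.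
have [_ h] := kapP m; have [|_ le] := h; first by exists k.
have i : inf (D m) <= e / 2.
  by apply: le_trans kd; apply: ge_inf; [exists 0 | exists k].
have mm : m.+1%:R^-1 <= e / 2.
  rewrite -[leRHS]invrK lef_pV2 ?posrE ?invr_gt0 //.
  apply: ltW; apply: lt_le_trans (truncnS_gt _) _; rewrite ler_nat ltnS.
  by near: m; exact: nbhs_infty_ge.
by rewrite distrC; apply: le_trans le _; rewrite [leRHS]splitr lerD.
Unshelve. all: by end_near. Qed.

End tilt.

(** * The limit law *)

Section swaps.
Context {R : realType} (m : nat).
Local Notation T := (box m.+1).
Local Notation conf := {ffun T -> 'I_m.+3}.
Implicit Types (N : conf) (j p : T).
Local Notation om := (@om R).

Definition swap_cell j p : T :=
  if (j.1 < j.2)%N && ((p == j) || (p == flipT j)) then flipT p else p.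

Lemma swap_cellK j : involutive (swap_cell j).
Proof.
move=> p; rewrite /swap_cell; case: (j.1 < j.2)%N => //=.
have [->|pj] := eqVneq p j; first by rewrite eqxx orbT /= flipTK.
have [->|pj'] := eqVneq p (flipT j); first by rewrite flipTK eqxx.
by rewrite /= (negPf pj) (negPf pj').
Qed.

Lemma hook_swap_cell j p : hook (swap_cell j p) = hook p.
Proof. by rewrite /swap_cell; case: ifP => // _; rewrite hook_flip. Qed.

Definition swap j N : conf := [ffun p => N (swap_cell j p)].

Lemma swapK j : involutive (swap j).
Proof. by move=> N; apply/ffunP => p; rewrite !ffunE swap_cellK. Qed.

Lemma mass_swap j N : mass (swap j N) = mass N.
Proof.
rewrite /mass [RHS](reindex_inj (inv_inj (swap_cellK j))) /=.
by apply: eq_bigr => p _; rewrite ffunE.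
Qed.

Lemma hook_mass_swap j N : hook_mass (swap j N) = hook_mass N.
Proof.
rewrite /hook_mass [RHS](reindex_inj (inv_inj (swap_cellK j))) /=.
by apply: eq_bigr => p _; rewrite ffunE -[in RHS]/(hook _) hook_swap_cell.
Qed.

Lemma bounded_by_swap (L : R) j N : bounded_by L (swap j N) = bounded_by L N.
Proof.
apply/forallP/forallP => h p.
  by have := h (swap_cell j p); rewrite ffunE swap_cellK hook_swap_cell.
by rewrite ffunE -(hook_swap_cell j p).
Qed.

(** The sign is opposite to that of the contribution to w_+ - w_-, because the heat function is
    evaluated at y - stat. *)
Definition incr j N : R :=
  if (j.1 < j.2)%N then (j.1%:R - j.2%:R) * ((N j)%:R - (N (flipT j))%:R) / om m ^+ 8 else 0.

Lemma incr_swap j N : incr j (swap j N) = - incr j N.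
Proof.
rewrite /incr; case: ifP => jj; last by rewrite oppr0.
by rewrite !ffunE /swap_cell jj !eqxx orbT /= flipTK; ring.
Qed.

Lemma incr_swap_neq i j N : i != j -> incr i (swap j N) = incr i N.
Proof.
move=> ij; rewrite /incr; case: ifP => // ii; rewrite !ffunE /swap_cell.
case: ifP => [/andP[jj]|_]; first rewrite (negPf ij) /= => /eqP e.
  by move: ii; rewrite e /= ltnNge ltnW.
case: ifP => // /andP[jj]; rewrite (inj_eq (inv_inj (@flipTK m))) (negPf ij) orbF => /eqP e.
by move: jj; rewrite -e /= ltnNge ltnW.
Qed.

Lemma sum_incr_sqr N : \sum_(j : T) incr j N ^+ 2 = spread N / om m ^+ 16 :> R.
Proof.
rewrite /spread mulr_suml [RHS]big_mkcond; apply: eq_bigr => j _; rewrite /incr.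
case: ifP => _; last by rewrite expr0n.
by rewrite /dif_sqr; field; exact: om_neq0.
Qed.

Lemma spread_swap j N : spread (swap j N) = spread N :> R.
Proof.
have o16 : om m ^+ 16 != 0 :> R by rewrite expf_neq0 ?om_neq0.
apply: (mulIf (invr_neq0 o16)); rewrite -!sum_incr_sqr; apply: eq_bigr => i _.
by have [->|ij] := eqVneq i j; rewrite ?incr_swap ?sqrrN // incr_swap_neq.
Qed.

Lemma sum_incr N : \sum_(j : T) incr j N = - (((col_mass N)%:R - (row_mass N)%:R) / om m ^+ 8).
Proof.
have -> : (col_mass N)%:R - (row_mass N)%:R = \sum_(p : T) (p.2%:R - p.1%:R) * (N p)%:R :> R.
  rewrite /col_mass /row_mass !natr_sum -sumrB; apply: eq_bigr => p _.
  by rewrite !natrM mulrBl.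
rewrite [X in - (X / _)](bigID (fun p : T => (p.1 < p.2)%N)) /=.
have -> : \sum_(p : T | ~~ (p.1 < p.2)%N) (p.2%:R - p.1%:R) * (N p)%:R =
   \sum_(p : T | (p.1 < p.2)%N) (p.1%:R - p.2%:R) * (N (flipT p))%:R :> R.
  rewrite [LHS](reindex_inj (inv_inj (@flipTK m))) /=.
  rewrite [LHS](bigID (fun p : T => (p.1 < p.2)%N)) /= [X in _ + X]big1 ?addr0.
    by apply: eq_bigl => p; rewrite -leqNgt; case: ltngtP.
  move=> p; rewrite -!leqNgt => /andP[p1 p2]; have e12 : p.1 = p.2 :> nat by apply/eqP; rewrite eqn_leq p1 p2.
  by rewrite e12 subrr mul0r.
rewrite -big_split /= mulr_suml -sumrN [RHS]big_mkcond; apply: eq_bigr => p _; rewrite /incr.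
by case: ifP => // _; ring.
Qed.

Lemma incr_small N p : bounded_by (om m ^+ 5) N -> `|incr p N| <= (om m ^+ 3)^-1 :> R.
Proof.
move=> /forallP h; have o := om_gt0 (R := R) m.
rewrite /incr; case: ifP => _; last by rewrite normr0 invr_ge0 exprn_ge0 // ltW.
rewrite normrM normfV (ger0_norm (exprn_ge0 8 (ltW o))) ler_pdivrMr ?exprn_gt0 //.
have -> : (om m ^+ 3)^-1 * om m ^+ 8 = om m ^+ 5 by field; rewrite gt_eqF.
have h1 := h p; have := h (flipT p); rewrite hook_flip => h2.
have d : `|p.1%:R - p.2%:R| <= (hook p)%:R :> R.
  rewrite /hook -natr1 natrD ler_norml.
  have : 0 <= p.1%:R :> R by []. have : 0 <= p.2%:R :> R by [].
  by move=> *; apply/andP; split; lra.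
rewrite normrM; apply: le_trans (ler_wpM2r (normr_ge0 _) d) _.
rewrite -[X in X * _]ger0_norm // -normrM mulrBr ler_norml.
have : 0 <= (hook p)%:R * (N p)%:R :> R by rewrite mulr_ge0.
have : 0 <= (hook p)%:R * (N (flipT p))%:R :> R by rewrite mulr_ge0.
lra.
Qed.

End swaps.

Lemma dist_le1 (R : realDomainType) (p q : R) : 0 <= p -> p <= 1 -> 0 <= q -> q <= 1 -> `|p - q| <= 1.
Proof. by move=> *; rewrite ler_norml; apply/andP; split; lra. Qed.

Lemma squeeze_dist (R : realDomainType) (h c u l u' l' d : R) :
  `|u' - u| <= d -> `|l' - l| <= d -> `|u' - h| <= d -> `|l' - h| <= d ->
  c <= u + d -> l - d <= c -> `|h - c| <= 4 * d.
Proof. by rewrite !ler_norml => /andP[? ?] /andP[? ?] /andP[? ?] /andP[? ?] *; apply/andP; split; lra. Qed.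

Section heat_regularity.
Context {R : realType}.

Lemma heat_ge0 (t y : R) : 0 <= heat t y. Proof. exact: normal_cdf_ge0. Qed.
Lemma heat_le1 (t y : R) : heat t y <= 1. Proof. exact: normal_cdf_le1. Qed.

Lemma heat_mono (t y y' : R) : 0 < t -> y <= y' -> heat t y <= heat t y'.
Proof. by move=> t0 yy; apply: normal_cdf_mono; rewrite ler_wpM2r // invr_ge0 sqrtr_ge0. Qed.

Lemma indicator_le_heat (eta a d x u : R) : 0 < eta -> 0 <= d -> 1 - d <= heat eta a ->
  (u <= x)%R%:R <= heat eta (x + a - u) + d.
Proof.
move=> eta0 d0 ha; case: (leP u x) => ux; last by rewrite addr_ge0 ?heat_ge0.
have : heat eta a <= heat eta (x + a - u) by apply: heat_mono => //; lra.
by rewrite mulr1n; lra.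
Qed.

Lemma heat_le_indicator (eta a d x u : R) : 0 < eta -> 0 <= d -> heat eta (- a) <= d ->
  heat eta (x - a - u) - d <= (u <= x)%R%:R.
Proof.
move=> eta0 d0 ha; case: (leP u x) => ux.
  by have := heat_le1 eta (x - a - u); rewrite mulr1n; lra.
have : heat eta (x - a - u) <= heat eta (- a) by apply: heat_mono => //; lra.
by rewrite mulr0n; lra.
Qed.

(** The time increment is multiplied by the absolute value of w' alone: w' will be a deterministic
    point, so the resulting constant does not depend on the configuration. *)
Lemma heat_lipschitz (eta t t' w w' : R) : 0 < eta -> eta <= t -> eta <= t' ->
  `|heat t w - heat t' w'| <= normal_peak 1 *
    (`|w - w'| / Num.sqrt eta + `|w'| * `|t - t'| / (eta * Num.sqrt eta)).
Proof.
move=> e0 te te'; have t0 := lt_le_trans e0 te; have t0' := lt_le_trans e0 te'.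
have dN (x : R) : is_derive x 1 (normal_cdf 0 1) (normal_pdf 0 1 x).
  exact: is_derive_normal_cdf (oner_neq0 R).
have bd x : `|normal_pdf 0 1 x| <= normal_peak 1 :> R.
  by rewrite ger0_norm ?normal_pdf_ge0 // normal_pdf_ub ?oner_neq0.
apply: le_trans (is_derive_lipschitz (w' / Num.sqrt t') (w / Num.sqrt t) dN bd) _.
rewrite ler_wpM2l ?normal_peak_ge0 //.
set r := Num.sqrt t; set r' := Num.sqrt t'; set e := Num.sqrt eta.
have r0 : 0 < r by rewrite sqrtr_gt0.
have r0' : 0 < r' by rewrite sqrtr_gt0.
have e0' : 0 < e by rewrite sqrtr_gt0.
have er : e <= r by rewrite ler_wsqrtr.
have er' : e <= r' by rewrite ler_wsqrtr.
have rt : r ^+ 2 = t by rewrite sqr_sqrtr // ltW.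
have rt' : r' ^+ 2 = t' by rewrite sqr_sqrtr // ltW.
have ee : e ^+ 2 = eta by rewrite sqr_sqrtr // ltW.
have -> : w / r - w' / r' = (w - w') / r + w' * (t' - t) / (r * r' * (r + r')).
  by rewrite -rt -rt'; field; rewrite !gt_eqF // addr_gt0.
apply: le_trans (ler_normD _ _) _; apply: lerD.
  by rewrite normrM normfV (ger0_norm (ltW r0)) ler_wpM2l // lef_pV2.
have q0 : 0 < r * r' * (r + r') by rewrite !mulr_gt0 // addr_gt0.
rewrite normrM normfV (ger0_norm (ltW q0)) normrM (distrC t' t) ler_wpM2l ?mulr_ge0 //.
rewrite lef_pV2 ?posrE ?mulr_gt0 ?addr_gt0 // -ee expr2.
by apply: ler_pM; rewrite ?mulr_ge0 ?(ltW e0') ?ler_pM ?(ltW e0') // ler_wpDr // ltW.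
Qed.
End heat_regularity.

Section conditional_limit.
Context {R : realType}.
Variable delta : R.
Local Notation om := (@om R).
Local Notation kappa := (@kappa R).
Local Notation conf m := {ffun box m.+1 -> 'I_m.+3}.
Let sig2 : R := kappa^-1.
Let mu0 : R := zeta 2 / kappa ^+ 2.

Let sig2_gt0 : 0 < sig2. Proof. by rewrite invr_gt0 kappa_gt0. Qed.

Let sig2E : 2 * zeta 3 / kappa ^+ 4 = sig2.
Proof. by rewrite -kappa3 /sig2; field; rewrite gt_eqF ?kappa_gt0. Qed.

Definition stat (m : nat) (N : conf m) : R :=
  delta * ((mass N)%:R / om m ^+ 8) + ((col_mass N)%:R - (row_mass N)%:R) / om m ^+ 8.

Let Omega m := [set N : conf m | hook_mass N == m.+1]%SET.
Let total m : R := (conf_count (m := m) xpredT m.+1)%:R.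

Let totalE m : total m = #|Omega m|%:R.
Proof. by rewrite /total /conf_count; congr (#|pred_of_set _|)%:R; apply/setP => N; rewrite !inE andbT. Qed.

Let total_gt0 m : 0 < total m.
Proof.
(* The zero configuration has size 0, and the counts increase up to m.+1. *)
rewrite ltr0n; apply: (leq_trans _ (@conf_count_mono m 0 isT)).
apply/card_gt0P; exists [ffun=> ord0]; rewrite inE andbT /hook_mass big1 // => p _.
by rewrite ffunE muln0.
Qed.

(** All three conditions are invariant under the swaps, so the replacement argument can be run on
    the good configurations alone. *)
Let good m (e : R) (N : conf m) : bool :=
  [&& bounded_by (om m ^+ 5) N, `|(mass N)%:R / om m ^+ 8 - mu0| <= e
    & `|spread N / om m ^+ 16 - sig2| <= e].

Let bad_cvg (e : R) : 0 < e ->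
  (fun m => (conf_count (fun N : conf m => ~~ good e N) m.+1)%:R / total m) @ \oo --> (0 : R).
Proof.
move=> e0; have [kap [kp half kl]] := @median_sequence R.
apply: (negl_conditional kp (@kappa_gt0 R) kl half (P := fun m N => ~~ good e N)).
have n1 := negl_unbounded kp (@kappa_gt0 R) kl.
have n2 := mass_concentration kp (@kappa_gt0 R) kl e0.
have n3 := spread_concentration kp (@kappa_gt0 R) kl e0.
rewrite sig2E -/mu0 in n2 n3.
apply: negl_le (neglD (neglD n1 n2) n3); apply: nearW => m.
have w0 := @wgt_ge0 R m _ (scl_gt0 kp m).
rewrite Ex_ge0 //= -!ExD; apply: le_Ex => // N; rewrite /good.
case: (bounded_by _ _) => /=; last by rewrite addr0 addr0.
rewrite add0r negb_and -!ltNge.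
case: (ltP e `|(mass N)%:R / om m ^+ 8 - mu0|) => [/ltW ->|_] /=; first by rewrite lerDl.
case: (ltP e `|spread N / om m ^+ 16 - sig2|) => [/ltW ->|_] /=; first by rewrite lerDr.
by rewrite addr_ge0.
Qed.

(** Three errors of e0 / 3. On good configurations, [lindeberg] trades the increments for the time
    V, with cubes summing to at most om ^ -3 times V; then V and the trace are replaced by their
    limits, by [heat_lipschitz]. The bad configurations have vanishing proportion. *)
Lemma heat_mean_cvg (eta y : R) : 0 < eta ->
  (fun m => (\sum_(N in Omega m) heat eta (y - stat N)) / total m) @ \oo -->
    heat (eta + sig2) (y - delta * mu0).
Proof.
move=> eta0; apply/cvgrPdist_le => e0 e00.
set h := heat (eta + sig2) _.
pose K : R := normal_peak 1 * (`|delta| / Num.sqrt eta + `|y - delta * mu0| / (eta * Num.sqrt eta)).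
have sq0 : 0 < Num.sqrt eta by rewrite sqrtr_gt0.
have K0 : 0 <= K.
  rewrite mulr_ge0 ?normal_peak_ge0 // addr_ge0 // divr_ge0 // ?ltW //.
  by rewrite mulr_gt0.
(* The bound 1 gives V <= sig2 + 1 on good configurations; the other bound makes the Lipschitz error
   K e at most e0 / 3. *)
pose e : R := Num.min 1 (e0 / (3 * (K + 1))).
have K1 : 0 < 3 * (K + 1) by lra.
have e_gt0 : 0 < e by rewrite lt_min ltr01 divr_gt0.
have e_le1 : e <= 1 by rewrite ge_min lexx.
have eK : K * e <= e0 / 3.
  apply: (@le_trans _ _ (K * (e0 / (3 * (K + 1))))).
    by rewrite ler_wpM2l // ge_min lexx orbT.
  have -> : K * (e0 / (3 * (K + 1))) = e0 / 3 * (K / (K + 1)) by field; lra.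
  rewrite ler_piMr ?divr_ge0 ?(ltW e00) // ler_pdivrMr; lra.
pose C : R := 13 * normal_peak 1 / Num.sqrt eta ^+ 3.
have C0 : 0 <= C by rewrite divr_ge0 ?exprn_ge0 ?(ltW sq0) // mulr_ge0 // normal_peak_ge0.
have e3 : 0 < e0 / 3 by rewrite divr_gt0.
have /cvgrPdist_le /(_ _ e3) bad := bad_cvg e_gt0.
have sm : (fun m => C * (sig2 + 1) * (om m ^+ 3)^-1) @ \oo --> (0 : R).
  apply: (@cvg_to_eq R _ _ (C * (sig2 + 1) * 0)); last by rewrite mulr0.
  by apply: cvgM; [exact: cvg_cst | exact: om_pow_inv_cvg].
have /cvgrPdist_le /(_ _ e3) sm' := sm.
near=> m.
have b1 : `|0 - (conf_count (fun N : conf m => ~~ good e N) m.+1)%:R / total m| <= e0 / 3 by near: m.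
have b2 : `|0 - C * (sig2 + 1) * (om m ^+ 3)^-1| <= e0 / 3 by near: m.
have tp := total_gt0 m; have o := om_gt0 (R := R) m.
rewrite sub0r normrN ger0_norm in b1; last by rewrite divr_ge0 // ltW.
rewrite sub0r normrN ger0_norm in b2; last first.
  by rewrite !mulr_ge0 ?invr_ge0 ?exprn_ge0 ?(ltW o) // addr_ge0 // ltW.
pose G := [set N in Omega m | good e N]%SET.
pose off (N : conf m) : R := y - delta * ((mass N)%:R / om m ^+ 8).
have V_swap j N : good e (swap j N) = good e N.
  by rewrite /good bounded_by_swap mass_swap spread_swap.
have G_swap j N : (swap j N \in G) = (N \in G) by rewrite !inE hook_mass_swap V_swap.
have off_swap j N : off (swap j N) = off N by rewrite /off mass_swap.
have lind := @lindeberg R _ _ G (@incr R m) (@swap m) off eta eta0 (@swapK m) G_swap (@incr_swap R m)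
  (@incr_swap_neq R m) off_swap (enum {: box m.+1}) (fun=> eta) (enum_uniq _) (fun=> lexx _)
  (fun _ _ _ => erefl).
pose V (N : conf m) : R := spread N / om m ^+ 16.
have VE N : \sum_(j <- enum {: box m.+1}) incr j N ^+ 2 = V N by rewrite big_enum /= sum_incr_sqr.
have V0 N : 0 <= V N by rewrite -VE sumr_ge0 // => j _; exact: sqr_ge0.
have offE N : off N + \sum_(j <- enum {: box m.+1}) incr j N = y - stat N.
  by rewrite big_enum /= sum_incr /off /stat opprD addrA.
have GP N : N \in G -> [/\ bounded_by (om m ^+ 5) N,
    `|(mass N)%:R / om m ^+ 8 - mu0| <= e & `|V N - sig2| <= e].
  by rewrite !inE => /andP[_ /and3P].
have Gt : #|G|%:R <= total m.
  rewrite totalE ler_nat; apply/subset_leq_card/fintype.subsetP => N.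
  by rewrite !inE => /andP[].
have cubes N : N \in G -> \sum_(j <- enum {: box m.+1}) `|incr j N| ^+ 3 <= (om m ^+ 3)^-1 * (sig2 + 1).
  move=> /GP[bN _ Vs]; apply: (@le_trans _ _ ((om m ^+ 3)^-1 * V N)).
    rewrite -VE mulr_sumr; apply: ler_sum => j _.
    by rewrite exprS real_normK ?num_real // ler_wpM2r ?sqr_ge0 // incr_small.
  rewrite ler_wpM2l ?invr_ge0 ?exprn_ge0 ?(ltW o) //.
  by move: Vs; rewrite ler_norml; lra.
have part1 : `|\sum_(N in G) (heat eta (y - stat N) - heat (eta + V N) (off N))| <= total m * (e0 / 3).
  have -> : \sum_(N in G) (heat eta (y - stat N) - heat (eta + V N) (off N)) =
    \sum_(N in G) (heat eta (off N + \sum_(j <- enum {: box m.+1}) incr j N) -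
      heat (eta + \sum_(j <- enum {: box m.+1}) incr j N ^+ 2) (off N)).
    by apply: eq_bigr => N _; rewrite offE VE.
  apply: le_trans lind _; rewrite -/C.
  apply: (@le_trans _ _ (\sum_(N in G) C * (sig2 + 1) * (om m ^+ 3)^-1)).
    apply: ler_sum => N /cubes cN; rewrite -mulrA ler_wpM2l // mulrC.
    by rewrite [X in _ <= X]mulrC mulrC.
  rewrite sumr_const -(mulr_natl _ #|G|).
  by apply: ler_pM; rewrite // !mulr_ge0 ?invr_ge0 ?exprn_ge0 ?(ltW o) // addr_ge0 // ltW.
have part2 : `|\sum_(N in G) (heat (eta + V N) (off N) - h)| <= total m * (e0 / 3).
  apply: le_trans (ler_norm_sum _ _ _) _.
  apply: (@le_trans _ _ (\sum_(N in G) e0 / 3)); last first.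
    by rewrite sumr_const -(mulr_natl _ #|G|) ler_wpM2r // ltW.
  apply: ler_sum => N /GP[_ Ws Vs]; apply: le_trans eK.
  have eV : eta <= eta + V N by rewrite lerDl.
  have es : eta <= eta + sig2 by rewrite lerDl ltW.
  apply: le_trans (heat_lipschitz (off N) (y - delta * mu0) eta0 eV es) _.
  rewrite /K -[leRHS]mulrA ler_wpM2l ?normal_peak_ge0 // mulrDl; apply: lerD.
    have -> : off N - (y - delta * mu0) = - delta * ((mass N)%:R / om m ^+ 8 - mu0) by rewrite /off; ring.
    by rewrite normrM normrN mulrAC ler_wpM2l ?divr_ge0 ?(ltW sq0).
  have -> : eta + V N - (eta + sig2) = V N - sig2 by ring.
  by rewrite mulrAC ler_wpM2l ?divr_ge0 ?mulr_ge0 ?(ltW sq0) ?(ltW eta0).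
have part3 : `|\sum_(N in Omega m | ~~ good e N) (heat eta (y - stat N) - h)| <= total m * (e0 / 3).
  apply: (@le_trans _ _ (conf_count (fun N : conf m => ~~ good e N) m.+1)%:R); last first.
    by move: b1; rewrite ler_pdivrMr // [_ * total m]mulrC.
  apply: le_trans (ler_norm_sum _ _ _) _.
  rewrite /conf_count -sum1_card natr_sum.
  rewrite [leRHS](eq_bigl (fun N => (N \in Omega m) && ~~ good e N)) => [|N]; last by rewrite !inE.
  by apply: ler_sum => N _; rewrite dist_le1 ?heat_ge0 ?heat_le1.
have -> : h - (\sum_(N in Omega m) heat eta (y - stat N)) / total m =
   - ((\sum_(N in Omega m) (heat eta (y - stat N) - h)) / total m).
  rewrite sumrB sumr_const -(mulr_natl _ #|Omega m|) -totalE; field.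
  by rewrite gt_eqF.
rewrite normrN normrM normfV (ger0_norm (ltW tp)) ler_pdivrMr //.
rewrite (bigID (good e)) /=.
have -> : \sum_(N in Omega m | good e N) (heat eta (y - stat N) - h) =
   \sum_(N in G) (heat eta (y - stat N) - heat (eta + V N) (off N)) + \sum_(N in G) (heat (eta + V N) (off N) - h).
  rewrite -big_split /=; apply: eq_big => [N|N _]; first by rewrite !inE.
  by rewrite subrKA.
have -> : e0 * total m = total m * (e0 / 3) + total m * (e0 / 3) + total m * (e0 / 3) by field.
by apply: le_trans (ler_normD _ _) (lerD (le_trans (ler_normD _ _) (lerD part1 part2)) part3).
Unshelve. all: by end_near. Qed.

Let cdf_mean m (x : R) : R := (conf_count (fun N : conf m => stat N <= x) m.+1)%:R / total m.

Let cdf_meanE m x : cdf_mean m x = (\sum_(N in Omega m) (stat N <= x)%R%:R) / total m.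
Proof.
rewrite /cdf_mean /conf_count -sum1_card natr_sum; congr (_ / _).
rewrite [RHS](bigID (fun N => stat N <= x)) /= [X in _ = _ + X]big1 ?addr0 => [|N /andP[_ /negPf ->]//].
apply: eq_big => [N|N]; first by rewrite !inE.
by rewrite inE => /andP[_ ->].
Qed.

(* heat eta (x + a - _) and heat eta (x - a - _) squeeze the indicator of ]-oo, x] up to the
   tails of the normal law beyond a / sqrt eta; taking eta = a ^+ 4 makes both errors small. *)
Lemma stat_cdf_cvg (x : R) : (fun m => cdf_mean m x) @ \oo --> heat sig2 (x - delta * mu0).
Proof.
apply/cvgrPdist_le => e e0; have e4 : 0 < e / 4 by rewrite divr_gt0.
set w := x - delta * mu0.
have s0 : 0 < Num.sqrt sig2 by rewrite sqrtr_gt0.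
pose K : R := normal_peak 1 * (1 / Num.sqrt sig2 + `|w| / (sig2 * Num.sqrt sig2)).
have K0 : 0 <= K.
  rewrite mulr_ge0 ?normal_peak_ge0 // addr_ge0 // divr_ge0 // ?ltW //.
  by rewrite mulr_gt0.
have [M [M0 M1 M2]] : exists M : R, [/\ 0 < M, 1 - normal_cdf 0 1 M <= e / 4 &
    normal_cdf 0 1 (- M) <= e / 4].
  have /cvgrPdist_le /(_ _ e4) [M1 [_ h1]] := @normal_cdfy R 0 1.
  have /cvgrPdist_le /(_ _ e4) [M2 [_ h2]] := @normal_cdfNy R 0 1.
  exists (1 + `|M1| + `|M2|); split.
  - by rewrite -addrA ltr_pwDl // addr_ge0.
  - apply: le_trans (ler_norm _) _; apply: h1.
    by have := ler_norm M1; have := normr_ge0 M2; lra.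
  - apply: le_trans (ler_norm _) _; rewrite -normrN -sub0r; apply: h2.
    by have := ler_norm (- M2); rewrite normrN; have := normr_ge0 M1; lra.
(* a <= 1 / M puts a / sqrt (a ^+ 4) = 1 / a beyond M. With a <= 1 the time shift a ^+ 4 is at most
   a, so K a <= e / 4 pays for the shifts in time and space together. *)
pose a : R := Num.min (Num.min 1 M^-1) (e / (4 * (K + 1))).
have K1 : 0 < 4 * (K + 1) by lra.
have a0 : 0 < a by rewrite !lt_min ltr01 invr_gt0 M0 divr_gt0.
have a1 : a <= 1 by rewrite /a !ge_min lexx.
have aM : a <= M^-1 by rewrite /a !ge_min lexx orbT.
have aK : K * a <= e / 4.
  apply: (@le_trans _ _ (K * (e / (4 * (K + 1))))).
    by rewrite ler_wpM2l // /a ge_min lexx orbT.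
  have -> : K * (e / (4 * (K + 1))) = e / 4 * (K / (K + 1)) by field; lra.
  rewrite ler_piMr ?(ltW e4) // ler_pdivrMr; lra.
have eta0 : 0 < a ^+ 4 by rewrite exprn_gt0.
have sa : Num.sqrt (a ^+ 4) = a ^+ 2 by rewrite (exprM a 2 2) sqrtr_sqr ger0_norm // sqr_ge0.
have Ma : M <= a^-1 by rewrite -[leLHS]invrK lef_pV2 ?posrE ?invr_gt0.
have hi : 1 - e / 4 <= heat (a ^+ 4) a.
  rewrite /heat sa; have -> : a / a ^+ 2 = a^-1 by field; rewrite gt_eqF.
  have := normal_cdf_mono 0 1 Ma; lra.
have lo : heat (a ^+ 4) (- a) <= e / 4.
  rewrite /heat sa; have -> : - a / a ^+ 2 = - a^-1 by field; rewrite gt_eqF.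
  apply: le_trans M2; apply: normal_cdf_mono; lra.
have shift b : `|b| <= a -> `|heat (a ^+ 4 + sig2) (w + b) - heat sig2 w| <= e / 4.
  move=> ba; apply: le_trans aK.
  have t1 : sig2 <= a ^+ 4 + sig2 by rewrite lerDr ltW.
  apply: le_trans (heat_lipschitz (w + b) w sig2_gt0 t1 (lexx _)) _.
  rewrite /K -[leRHS]mulrA ler_wpM2l ?normal_peak_ge0 // mulrDl; apply: lerD.
    by rewrite addrAC subrr add0r mul1r mulrC ler_wpM2l // invr_ge0 ltW.
  rewrite addrK (ger0_norm (ltW eta0)) mulrAC ler_wpM2l ?divr_ge0 ?mulr_ge0 ?(ltW s0) ?(ltW sig2_gt0) //.
  by rewrite exprS ler_piMr ?(ltW a0) // exprn_ile1 // ?(ltW a0).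
have up := @heat_mean_cvg _ (x + a) eta0; have down := @heat_mean_cvg _ (x - a) eta0.
have /cvgrPdist_le /(_ _ e4) up' := up; have /cvgrPdist_le /(_ _ e4) down' := down.
apply: filterS2 up' down' => m u1 d1.
have u2 : `|heat (a ^+ 4 + sig2) (x + a - delta * mu0) - heat sig2 w| <= e / 4.
  have -> : x + a - delta * mu0 = w + a by rewrite /w; ring.
  by apply: shift; rewrite ger0_norm // ltW.
have d2 : `|heat (a ^+ 4 + sig2) (x - a - delta * mu0) - heat sig2 w| <= e / 4.
  have -> : x - a - delta * mu0 = w + - a by rewrite /w; ring.
  by apply: shift; rewrite normrN ger0_norm // ltW.
have tp := total_gt0 m.
have avg (F : conf m -> R) (c : R) : (\sum_(N in Omega m) (F N + c)) / total m =
    (\sum_(N in Omega m) F N) / total m + c.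
  rewrite big_split sumr_const -(mulr_natl _ #|Omega m|) -totalE /=; field.
  by rewrite gt_eqF.
have up3 : cdf_mean m x <= (\sum_(N in Omega m) heat (a ^+ 4) (x + a - stat N)) / total m + e / 4.
  rewrite cdf_meanE -avg ler_wpM2r ?invr_ge0 ?(ltW tp) //; apply: ler_sum => N _.
  exact: indicator_le_heat eta0 (ltW e4) hi.
have down3 : (\sum_(N in Omega m) heat (a ^+ 4) (x - a - stat N)) / total m + - (e / 4) <= cdf_mean m x.
  rewrite cdf_meanE -avg ler_wpM2r ?invr_ge0 ?(ltW tp) //; apply: ler_sum => N _.
  exact: heat_le_indicator eta0 (ltW e4) lo.
have -> : e = 4 * (e / 4) by field.
exact: squeeze_dist u1 d1 u2 d2 up3 down3.
Qed.

(** [card_pp] at the cap m.+2, once for the event and once for the total number; om ^+ 8 is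
    n^(2/3). *)
Lemma Yn_cdf_stat m (x : R) : Yn_cdf delta m.+1 x = cdf_mean m x.
Proof.
have o8 : m.+1%:R `^ (2 / 3) = om m ^+ 8 :> R.
  rewrite /om -powR_mulrn ?powR_ge0 // -powRrM; congr (_ `^ _); by field.
pose P (a b c : nat) := delta * (a%:R / om m ^+ 8) + b%:R / om m ^+ 8 - c%:R / om m ^+ 8 <= x.
have mk : (m < m.+2)%N by [].
rewrite /Yn_cdf /cdf_mean /total /conf_count. congr (_ / _); congr (_%:R).
  have := card_pp P mk; rewrite /P => e; transitivity #|[set f in PP m.+1 | P (w_zero f) (w_plus f) (w_minus f)]%SET|.
    by congr (#|pred_of_set _|); apply/setP => f; rewrite !inE /Yn o8.
  rewrite e; congr (#|pred_of_set _|); apply/setP => N; rewrite !inE /stat.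
  by rewrite mulrBl addrA.
have := card_pp (fun _ _ _ => true) mk => e.
transitivity #|[set f in PP m.+1 | true]%SET|; last by rewrite e.
by congr (#|pred_of_set _|); apply/setP => f; rewrite !inE andbT.
Qed.

Lemma Yn_cdf_cvg (x : R) :
  (fun n => Yn_cdf delta n x) @ \oo --> normal_cdf (delta * mu0) (Num.sqrt sig2) x.
Proof.
have s0 : 0 < Num.sqrt sig2 by rewrite sqrtr_gt0.
rewrite normal_cdf_std // -cvg_shiftS /=.
rewrite (_ : (fun n => _) = (fun m => cdf_mean m x)); last by apply/funext => m; exact: Yn_cdf_stat.
exact: stat_cdf_cvg.
Qed.

End conditional_limit.

Theorem theorem1 (R : realType) (delta : R) :
  let mu : R := delta * zeta 2 / ((2 * zeta 3) `^ (2/3)) in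
  let sigma2 : R := ((2 * zeta 3) `^ (1/3))^-1 in
  forall x : R,
    (fun n : nat => (Yn_cdf delta n x)%:E) @ \oo -->
      normal_prob mu (Num.sqrt sigma2) `]-oo, x].
Proof.
move=> mu sigma2 x; rewrite normal_cdfE; apply: cvg_EFin; first exact: nearW.
have -> : mu = delta * (zeta 2 / kappa ^+ 2).
  rewrite /mu -mulrA /kappa -powR_mulrn ?powR_ge0 // -powRrM.
  by congr (_ * (_ / _ `^ _)); field.
exact: Yn_cdf_cvg.
Qed.
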